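(* Let $k>0$ be irrational and let $c,g,\tau$ be real constants. Let $\tilde\eta_0(\alpha_1,\alpha_2)=\sum_{(j_1,j_2)\in\mathbb Z^2}\hat\eta_{j_1,j_2}e^{i(j_1\alpha_1+j_2\alpha_2)}$ be a function on $\mathbb T^2$ such that, for some constants $C$ and $\varepsilon>0$, $$\hat\eta_{-j_1,-j_2}=\overline{\hat\eta_{j_1,j_2}},\qquad |\hat\eta_{j_1,j_2}|\le C e^{-3\varepsilon \max(k,1)\max(|j_1|,|j_2|)},\qquad (j_1,j_2)\in\mathbb Z^2 .$$ Define $\tilde\xi_0=H[\tilde\eta_0]$, $\tilde\zeta_0=\tilde\xi_0+i\tilde\eta_0$, $\tilde\varphi_0=c\,\tilde\xi_0$, and for $\alpha,\theta\in\mathbb R$ let $$\eta_0(\alpha;\theta)=\tilde\eta_0(\alpha,\theta+k\alpha),\quad \varphi_0(\alpha;\theta)=\tilde\varphi_0(\alpha,\theta+k\alpha),\quad \xi_0(\alpha;\theta)=\alpha+\tilde\xi_0(\alpha,\theta+k\alpha),\quad \zeta_0=\xi_0+i\eta_0 .$$ Suppose that for each $\theta\in[0,2\pi)$ the map $\alpha\mapsto\zeta_0(\alpha;\theta)$ is injective from $\mathbb R$ to $\mathbb C$ and $\partial_\alpha\zeta_0(\alpha;\theta)\neq0$ for all $\alpha\in\mathbb R$. Suppose also that $\tilde\eta_0$ satisfies the torus version of the traveling wave equations with constants $c,g,\tau$ (see context). Let $\alpha_0(t)$ be any continuously differentiable, real-valued function. Then, for each $\theta\in\mathbb R$, $$\zeta(\alpha,t;\theta)=\zeta_0(\alpha-\alpha_0(t);\theta)+ct,\qquad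 \varphi(\alpha,t;\theta)=\varphi_0(\alpha-\alpha_0(t);\theta)$$ are solutions of the one-dimensional conformal water wave evolution equations (see context) with $C_1=c\,P_0[\xi_\alpha/J]-\alpha_0'(t)$. The corresponding solutions of the torus version of the evolution equations (see context) for this choice of $C_1$ are $$\tilde\zeta(\alpha_1,\alpha_2,t)=\tilde\zeta_0\big(\alpha_1-\alpha_0(t),\alpha_2-k\alpha_0(t)\big)+ct-\alpha_0(t),$$ $$\tilde\varphi(\alpha_1,\alpha_2,t)=\tilde\varphi_0\big(\alpha_1-\alpha_0(t),\alpha_2-k\alpha_0(t)\big).$$
   Context: $\mathbb T^2=\mathbb R^2/2\pi\mathbb Z^2$, and $k>0$ is a fixed irrational number. Torus operators. For $\tilde u(\alpha_1,\alpha_2)=\sum_{j_1,j_2}\hat u_{j_1,j_2}e^{i(j_1\alpha_1+j_2\alpha_2)}$ on $\mathbb T^2$, $H[\tilde u]=\sum_{j_1,j_2}(-i)\operatorname{sgn}(j_1+j_2k)\,\hat u_{j_1,j_2}e^{i(j_1\alpha_1+j_2\alpha_2)}$ with $\operatorname{sgn}(0)=0$; $P_0[\tilde u]=\hat u_{0,0}$ (the mean over $\mathbb T^2$); $P=\mathrm{id}-P_0$; and $D=\partial_{\alpha_1}+k\,\partial_{\alpha_2}$. Quasi-periodic functions. If $u(\alpha)=\tilde u(\alpha,\theta+k\alpha)$ for some fixed $\theta\in\mathbb R$, then $H[u](\alpha)=H[\tilde u](\alpha,\theta+k\alpha)$, $P_0[u]=P_0[\tilde u]$, $P[u](\alpha)=P[\tilde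 u](\alpha,\theta+k\alpha)$, and $u_\alpha(\alpha)=(D\tilde u)(\alpha,\theta+k\alpha)$. Torus version of the traveling wave equations for $\tilde\eta$ (with constants $c,g,\tau$): setting $X=1+H[D\tilde\eta]$, $\tilde J=X^2+(D\tilde\eta)^2$ and $\tilde\kappa=\tilde J^{-3/2}\left(X\,D^2\tilde\eta-(D\tilde\eta)(DX)\right)$, $$P\left[\frac{c^2}{2\tilde J}+g\tilde\eta-\tau\tilde\kappa\right]=0\quad\text{on }\mathbb T^2 .$$ One-dimensional conformal water wave evolution equations (with constants $g,\tau$ and a prescribed real function $C_1$ of $t$, constant in $\alpha$): the unknowns are $\zeta=\xi+i\eta$ and $\varphi$, functions of $(\alpha,t)$ such that, at each fixed $t$, each of $\eta$, $\xi-\alpha$, $\varphi$ is quasi-periodic in $\alpha$, i.e. of the form $u(\alpha)=\tilde u(\alpha,\theta+k\alpha)$ with $\tilde u$ a function on $\mathbb T^2$ and $\theta\in\mathbb R$ fixed (the same $\theta$ for all three functions and all $t$), and $\xi=\alpha+x_0(t)+H[\eta]$ for a real function $x_0(t)$. With $$\xi_\alpha=1+H[\eta_\alpha],\quad \psi=-H[\varphi],\quad J=\xi_\alpha^2+\eta_\alpha^2,\quad \chi=\frac{\psi_\alpha}{J},\quad \kappa=\frac{\xi_\alpha\eta_{\alpha\alpha}-\eta_\alpha\xi_{\alpha\alpha}}{J^{3/2}},$$ the equations are $$\frac{dx_0}{dt}=P_0\left[\xi_\alpha\left(-H[\chi]+C_1\right)+\eta_\alpha\chi\right],\qquad \eta_t=-\eta_\alpha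 H[\chi]-\xi_\alpha\chi+C_1\eta_\alpha,$$ $$\varphi_t=P\left[\frac{\psi_\alpha^2-\varphi_\alpha^2}{2J}-\varphi_\alpha H[\chi]+C_1\varphi_\alpha-g\eta+\tau\kappa\right].$$ Torus version of the evolution equations: the unknowns are $\tilde\zeta=\tilde\xi+i\tilde\eta$ and $\tilde\varphi$, functions of $(\alpha_1,\alpha_2,t)\in\mathbb T^2\times\mathbb R$, with $\tilde\xi=x_0(t)+H[\tilde\eta]$; the equations are the same as the one-dimensional ones with $\eta,\varphi,\psi$ replaced by $\tilde\eta,\tilde\varphi,\tilde\psi=-H[\tilde\varphi]$, every $\alpha$-derivative replaced by $D$, $\xi_\alpha$ replaced by $1+D\tilde\xi$, and $H,P,P_0$ replaced by their torus versions. A torus solution and the one-dimensional family correspond via $\zeta(\alpha,t;\theta)=\alpha+\tilde\zeta(\alpha,\theta+k\alpha,t)$ and $\varphi(\alpha,t;\theta)=\tilde\varphi(\alpha,\theta+k\alpha,t)$. *)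

(* Defs.v *)
From Stdlib Require Import Reals ZArith ClassicalEpsilon.
From Coquelicot Require Import Coquelicot.
Open Scope R_scope.

(** Real functions on T^2 = R^2 / 2 pi Z^2 are doubly periodic [R -> R -> R];
    Coquelicot's [C] is the type of complex numbers. *)

Definition irrational (k : R) : Prop :=
  forall p q : Z, q <> 0%Z -> k <> IZR p / IZR q.

Definition char2 (j1 j2 : Z) (a1 a2 : R) : C :=
  (cos (IZR j1 * a1 + IZR j2 * a2), sin (IZR j1 * a1 + IZR j2 * a2)).

Definition mean2 (u : R -> R -> R) : R :=
  / (2 * PI) ^ 2 * RInt (fun a1 => RInt (fun a2 => u a1 a2) 0 (2 * PI)) 0 (2 * PI).

Definition mean2C (f : R -> R -> C) : C :=
  (mean2 (fun a1 a2 => Re (f a1 a2)), mean2 (fun a1 a2 => Im (f a1 a2))).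

Definition fcoef (u : R -> R -> R) (j1 j2 : Z) : C :=
  mean2C (fun a1 a2 => RtoC (u a1 a2) * char2 (- j1) (- j2) a1 a2)%C.

Definition zsum {G : AbelianMonoid} (a : Z -> G) (N : nat) : G :=
  sum_n (fun m => a (Z.of_nat m - Z.of_nat N)%Z) (2 * N).

(** Sum over Z^2, as the limit of the sums over |j1|, |j2| <= N.  It is only
    meaningful for families satisfying [summable2], for which it does not
    depend on the order of summation. *)
Definition Csum2 (a : Z -> Z -> C) : C :=
  let S (N : nat) : C := zsum (fun j1 => zsum (fun j2 => a j1 j2) N) N in
  (real (Lim_seq (fun N => Re (S N))), real (Lim_seq (fun N => Im (S N)))).

Definition summable2 (a : Z -> Z -> C) : Prop :=
  exists M : R, forall N : nat,
    zsum (fun j1 => zsum (fun j2 => Cmod (a j1 j2)) N) N <= M.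

Definition fourier_series (a : Z -> Z -> C) (a1 a2 : R) : C :=
  Csum2 (fun j1 j2 => a j1 j2 * char2 j1 j2 a1 a2)%C.

Definition torus_fun (u : R -> R -> R) : Prop :=
  forall a1 a2,
    u (a1 + 2 * PI) a2 = u a1 a2 /\ u a1 (a2 + 2 * PI) = u a1 a2 /\
    continuity_2d_pt u a1 a2.

Definition d1 (u : R -> R -> R) (a1 a2 : R) : R := Derive (fun x => u x a2) a1.
Definition d2 (u : R -> R -> R) (a1 a2 : R) : R := Derive (fun y => u a1 y) a2.

Fixpoint torus_Cn (n : nat) (u : R -> R -> R) : Prop :=
  torus_fun u /\
  match n with
  | O => True
  | S m =>
      (forall a1 a2, ex_derive (fun x => u x a2) a1 /\
                     ex_derive (fun y => u a1 y) a2) /\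
      torus_Cn m (d1 u) /\ torus_Cn m (d2 u)
  end.

(** The functions to which [torus_H] is applied: the multiplier series then
    converges absolutely at every point. *)
Definition torus_abs (u : R -> R -> R) : Prop :=
  torus_fun u /\ summable2 (fcoef u).

(** For real [u] the multiplier series has Hermitian coefficients, so its sum is
    real and [Re] only changes the type. *)
Definition torus_H (k : R) (u : R -> R -> R) (a1 a2 : R) : R :=
  Re (fourier_series
        (fun j1 j2 => - Ci * RtoC (sign (IZR j1 + IZR j2 * k)) * fcoef u j1 j2)%C
        a1 a2).

Definition torus_P0 (u : R -> R -> R) : R := mean2 u.

Definition torus_P (u : R -> R -> R) (a1 a2 : R) : R := u a1 a2 - torus_P0 u.

Definition torus_D (k : R) (u : R -> R -> R) (a1 a2 : R) : R :=
  d1 u a1 a2 + k * d2 u a1 a2.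

(** In the next two definitions [X] stands for [1 + H[D eta]] (traveling
    waves) or [1 + D xi] (evolution equations). *)
Definition torus_J (k : R) (X eta : R -> R -> R) (a1 a2 : R) : R :=
  (X a1 a2) ^ 2 + (torus_D k eta a1 a2) ^ 2.

Definition torus_kappa (k : R) (X eta : R -> R -> R) (a1 a2 : R) : R :=
  (X a1 a2 * torus_D k (torus_D k eta) a1 a2
   - torus_D k eta a1 a2 * torus_D k X a1 a2)
  / Rpower (torus_J k X eta a1 a2) (3 / 2).

Definition torus_traveling_wave (k c g tau : R) (eta : R -> R -> R) : Prop :=
  let X a1 a2 := 1 + torus_H k (torus_D k eta) a1 a2 in
  forall a1 a2,
    torus_P (fun b1 b2 => c ^ 2 / (2 * torus_J k X eta b1 b2) + g * eta b1 b2
                          - tau * torus_kappa k X eta b1 b2) a1 a2 = 0.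

Definition torus_evolution (k g tau : R) (C1 : R -> R)
    (zeta : R -> R -> R -> C) (phi : R -> R -> R -> R) : Prop :=
  exists x0 : R -> R, forall t : R,
    let xi a1 a2 := Re (zeta a1 a2 t) in
    let eta a1 a2 := Im (zeta a1 a2 t) in
    let ph a1 a2 := phi a1 a2 t in
    let psi a1 a2 := - torus_H k ph a1 a2 in
    let xi_a a1 a2 := 1 + torus_D k xi a1 a2 in
    let eta_a := torus_D k eta in
    let ph_a := torus_D k ph in
    let psi_a := torus_D k psi in
    let J := torus_J k xi_a eta in
    let chi a1 a2 := psi_a a1 a2 / J a1 a2 in
    let kappa := torus_kappa k xi_a eta in
    (* regularity making every expression in the equations well defined *)
    torus_Cn 2 xi /\ torus_Cn 2 eta /\ torus_Cn 1 ph /\ torus_Cn 1 psi /\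
    (forall a1 a2, J a1 a2 <> 0) /\
    torus_abs eta /\ torus_abs eta_a /\ torus_abs ph /\ torus_abs chi /\
    (forall a1 a2, xi a1 a2 = x0 t + torus_H k eta a1 a2) /\
    (forall a1 a2, xi_a a1 a2 = 1 + torus_H k eta_a a1 a2) /\
    is_derive x0 t
      (torus_P0 (fun a1 a2 => xi_a a1 a2 * (- torus_H k chi a1 a2 + C1 t)
                              + eta_a a1 a2 * chi a1 a2)) /\
    (forall a1 a2,
       is_derive (fun s => Im (zeta a1 a2 s)) t
         (- eta_a a1 a2 * torus_H k chi a1 a2 - xi_a a1 a2 * chi a1 a2
          + C1 t * eta_a a1 a2)) /\
    (forall a1 a2,
       is_derive (fun s => phi a1 a2 s) t
         (torus_P (fun b1 b2 =>
            ((psi_a b1 b2) ^ 2 - (ph_a b1 b2) ^ 2) / (2 * J b1 b2)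
            - ph_a b1 b2 * torus_H k chi b1 b2 + C1 t * ph_a b1 b2
            - g * eta b1 b2 + tau * kappa b1 b2) a1 a2)).

Definition qp_rep (k theta : R) (U : R -> R -> R) (u : R -> R) : Prop :=
  forall a, u a = U a (theta + k * a).

Definition qp_in (K : (R -> R -> R) -> Prop) (k theta : R) (u : R -> R) : Prop :=
  exists U, K U /\ qp_rep k theta U u.

Definition quasi_periodic : R -> R -> (R -> R) -> Prop := qp_in torus_fun.

(** The torus function of a quasi-periodic [u].  Since [k] is irrational, the
    line [a |-> (a, theta + k a)] is dense in T^2, so the continuous
    representative is unique. *)
Definition qp_lift (k theta : R) (u : R -> R) : R -> R -> R :=
  epsilon (inhabits (fun _ _ : R => 0))
    (fun U => torus_fun U /\ qp_rep k theta U u).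

Definition qp_H (k theta : R) (u : R -> R) (a : R) : R :=
  torus_H k (qp_lift k theta u) a (theta + k * a).

Definition qp_P0 (k theta : R) (u : R -> R) : R := torus_P0 (qp_lift k theta u).

Definition qp_P (k theta : R) (u : R -> R) (a : R) : R :=
  torus_P (qp_lift k theta u) a (theta + k * a).

Definition conf_xi_a (k theta : R) (eta : R -> R) (a : R) : R :=
  1 + qp_H k theta (Derive eta) a.

Definition conf_J (k theta : R) (eta : R -> R) (a : R) : R :=
  (conf_xi_a k theta eta a) ^ 2 + (Derive eta a) ^ 2.

Definition conf_kappa (k theta : R) (eta : R -> R) (a : R) : R :=
  (conf_xi_a k theta eta a * Derive (Derive eta) a
   - Derive eta a * Derive (conf_xi_a k theta eta) a)
  / Rpower (conf_J k theta eta a) (3 / 2).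

Definition conformal_evolution (k g tau theta : R) (C1 : R -> R)
    (zeta : R -> R -> C) (phi : R -> R -> R) : Prop :=
  exists x0 : R -> R, forall t : R,
    let xi a := Re (zeta a t) in
    let eta a := Im (zeta a t) in
    let ph a := phi a t in
    let psi a := - qp_H k theta ph a in
    let xi_a := conf_xi_a k theta eta in
    let eta_a := Derive eta in
    let ph_a := Derive ph in
    let psi_a := Derive psi in
    let J := conf_J k theta eta in
    let chi a := psi_a a / J a in
    let kappa := conf_kappa k theta eta in
    let x0_rhs a :=
      xi_a a * (- qp_H k theta chi a + C1 t) + eta_a a * chi a in
    let phi_rhs a :=
      ((psi_a a) ^ 2 - (ph_a a) ^ 2) / (2 * J a)
      - ph_a a * qp_H k theta chi a + C1 t * ph_a a
      - g * eta a + tau * kappa a in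
    (* regularity making every expression in the equations well defined *)
    qp_in (torus_Cn 2) k theta (fun a => xi a - a) /\
    qp_in (torus_Cn 2) k theta eta /\
    qp_in (torus_Cn 1) k theta ph /\ qp_in (torus_Cn 1) k theta psi /\
    (forall a, J a <> 0) /\
    qp_in torus_abs k theta eta /\ qp_in torus_abs k theta eta_a /\
    qp_in torus_abs k theta ph /\ qp_in torus_abs k theta chi /\
    quasi_periodic k theta x0_rhs /\ quasi_periodic k theta phi_rhs /\
    (forall a, xi a = a + x0 t + qp_H k theta eta a) /\
    (forall a, is_derive xi a (xi_a a)) /\
    is_derive x0 t (qp_P0 k theta x0_rhs) /\
    (forall a,
       is_derive (fun s => Im (zeta a s)) t
         (- eta_a a * qp_H k theta chi a - xi_a a * chi a + C1 t * eta_a a)) /\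
    (forall a,
       is_derive (fun s => phi a s) t (qp_P k theta phi_rhs a)).

Definition DeriveC (f : R -> C) (x : R) : C :=
  (Derive (fun y => Re (f y)) x, Derive (fun y => Im (f y)) x).

(* Main.v *)
(** Write [zeta = xi + i eta], where [xi = H eta]: then [zeta - alpha] has no positive
    frequency [j1 + j2 k].  The substance of the theorem is that [1 / zeta_alpha] also has no
    positive frequency and has mean [1]; taking real and imaginary parts this reads
    [H[eta_alpha / J] = 1 - xi_alpha / J], after which the evolution equations for the
    translated wave reduce to algebra and the traveling wave equation.

    For this fact no complex analysis in a half plane is needed.  Injectivity of [zeta] says that
    the secants [R_h(alpha) = zeta (alpha + h) - zeta alpha] do not vanish for [h > 0], and
    [R_h / h] tends to [zeta_alpha <> 0] as [h -> 0] and to [1] as [h -> oo].  All [R_h] have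
    nonpositive frequencies only.  Division by [R_h] preserves the space of bounded continuous
    functions without positive frequencies when [h] is large, and this property survives small
    perturbations (Neumann series), so it can be continued in [h] down to [h = 0].  Fourier
    inversion for [C^4] functions on the torus then identifies the coefficients of
    [xi_alpha / J] and [eta_alpha / J].

    Since [k] is irrational, the line [alpha |-> (alpha, theta + k alpha)] is dense in the torus,
    and the one-dimensional statement is the restriction of the one on the torus. *)

From Stdlib Require Import Reals ZArith Lra Lia FunctionalExtensionality ClassicalEpsilon Classical.
From Stdlib Require Ranalysis5.
From Coquelicot Require Import Coquelicot.
Require Import Defs.
Open Scope R_scope.

(** * Means of continuous functions on the torus *)

(** The function space for the continuation is chosen so that one factor of every product has
    summable coefficients and the other is merely bounded and continuous. Such a space is closed
    under uniform limits, so a lower bound on the modulus of the divisor suffices for the Neumann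
    series, in place of an inversion theorem of Wiener type.

    The lower bound has to be uniform over the torus, whereas injectivity is given line by line.
    Modulo periods every point of the torus lies on a line with [theta] in [[0, 2 PI)], so no secant
    vanishes anywhere, and compactness in [(h, x, y)] gives a uniform bound for [h] between two
    positive values. Near [h = 0] the quadratic error of the secant against [h] times the tangent
    takes over.

    Irrationality of [k] enters twice: through density of the lines, and because [j1 + j2 k = 0]
    only at the origin, so that the mean of [zeta_alpha / zeta_alpha] involves only the two means;
    this is where mean [1] comes from. Consequently [P0[xi_alpha / J] = 1], [C1 = c - alpha0'] and
    [x0 = c t - alpha0]. *)

Definition cont2 (u : R -> R -> R) : Prop := forall x y, continuity_2d_pt u x y.

Lemma fun2_ext {A B T : Type} (u v : A -> B -> T) : (forall x y, u x y = v x y) -> u = v.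
Proof.
intros H; apply functional_extensionality; intros x.
apply functional_extensionality; intros y; apply H.
Qed.

Lemma cont2_const c : cont2 (fun _ _ => c).
Proof. intros x y; apply continuity_2d_pt_const. Qed.

Lemma cont2_plus u v : cont2 u -> cont2 v -> cont2 (fun x y => u x y + v x y).
Proof. intros Hu Hv x y; apply continuity_2d_pt_plus; auto. Qed.

Lemma cont2_minus u v : cont2 u -> cont2 v -> cont2 (fun x y => u x y - v x y).
Proof. intros Hu Hv x y; apply continuity_2d_pt_minus; auto. Qed.

Lemma cont2_mult u v : cont2 u -> cont2 v -> cont2 (fun x y => u x y * v x y).
Proof. intros Hu Hv x y; apply continuity_2d_pt_mult; auto. Qed.

Lemma cont2_opp u : cont2 u -> cont2 (fun x y => - u x y).
Proof. intros Hu x y; apply continuity_2d_pt_opp; auto. Qed.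

Lemma cont2_comp1 f u : continuity f -> cont2 u -> cont2 (fun x y => f (u x y)).
Proof. intros Hf Hu x y; apply continuity_1d_2d_pt_comp; auto. Qed.

Lemma cont2_fst : cont2 (fun x _ => x).
Proof. intros x y; apply continuity_2d_pt_id1. Qed.

Lemma cont2_snd : cont2 (fun _ y => y).
Proof. intros x y; apply continuity_2d_pt_id2. Qed.

Lemma cont2_abs u : cont2 u -> cont2 (fun x y => Rabs (u x y)).
Proof. apply (cont2_comp1 Rabs), Rcontinuity_abs. Qed.

Lemma cont2_line u (a b c d : R) :
  cont2 u -> continuity (fun s => u (a + b * s) (c + d * s)).
Proof.
intros Hu s.
apply continuity_pt_filterlim.
apply (filterlim_comp _ _ _ (fun s => (a + b * s, c + d * s))
         (fun z : R * R => u (fst z) (snd z)) _ (locally (a + b * s, c + d * s))).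
- assert (H1 : filterlim (fun s => a + b * s) (locally s) (locally (a + b * s))).
  { apply (proj1 (continuity_pt_filterlim (fun s => a + b * s) s)); apply derivable_continuous_pt; reg. }
  assert (H2 : filterlim (fun s => c + d * s) (locally s) (locally (c + d * s))).
  { apply (proj1 (continuity_pt_filterlim (fun s => c + d * s) s)); apply derivable_continuous_pt; reg. }
  intros P [eps HP].
  unfold filtermap.
  assert (K1 := H1 _ (locally_ball (a + b * s) eps)).
  assert (K2 := H2 _ (locally_ball (c + d * s) eps)).
  unfold filtermap in K1, K2.
  generalize (filter_and _ _ K1 K2); apply filter_imp.
  intros z [Z1 Z2]; apply HP; split; assumption.
- apply (proj1 (continuity_2d_pt_filterlim u (a + b * s) (c + d * s))), Hu.
Qed.

Lemma cont2_y u x : cont2 u -> continuity (fun y => u x y).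
Proof.
intros Hu; generalize (cont2_line u x 0 0 1 Hu).
intros H y; generalize (H y); apply continuity_pt_ext.
intros t; f_equal; ring.
Qed.

Lemma cont2_x u y : cont2 u -> continuity (fun x => u x y).
Proof.
intros Hu; generalize (cont2_line u 0 1 y 0 Hu).
intros H x; generalize (H x); apply continuity_pt_ext.
intros t; f_equal; ring.
Qed.

Lemma ex_RInt_cont (f : R -> R) a b : continuity f -> ex_RInt f a b.
Proof.
intros Hf; apply (ex_RInt_continuous (V := R_CompleteNormedModule)).
intros z _; apply continuity_pt_filterlim, Hf.
Qed.

Lemma RInt_param_continuity u a b :
  a <= b -> cont2 u -> continuity (fun x => RInt (fun y => u x y) a b).
Proof.
intros Hab Hu x0 e He.
(* The [+ 1] keeps the denominator positive when [a = b]. *)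
set (d := e / (2 * (b - a + 1))).
assert (Hd : 0 < d) by (apply Rdiv_lt_0_compat; lra).
destruct (uniform_continuity_2d u (x0 - 1) (x0 + 1) a b (fun x y _ _ => Hu x y) (mkposreal d Hd))
  as [delta Hdelta]; simpl in Hdelta.
exists (Rmin delta 1); split.
{ apply Rmin_pos; [apply cond_pos | lra]. }
intros x [_ Hx]; simpl in Hx |- *; unfold R_dist in *.
assert (Hx1 := Rlt_le_trans _ _ _ Hx (Rmin_l _ _)).
assert (Hx2 := Rlt_le_trans _ _ _ Hx (Rmin_r _ _)).
apply Rabs_def2 in Hx2.
assert (E1 := ex_RInt_cont _ a b (cont2_y u x Hu)).
assert (E2 := ex_RInt_cont _ a b (cont2_y u x0 Hu)).
change (Rabs (minus (RInt (fun y => u x y) a b) (RInt (fun y => u x0 y) a b)) < e).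
rewrite <- (RInt_minus (V := R_CompleteNormedModule) (fun y => u x y) (fun y => u x0 y) a b E1 E2).
apply Rle_lt_trans with ((b - a) * d).
- apply abs_RInt_le_const; auto.
  + apply (ex_RInt_minus (V := R_NormedModule)); auto.
  + intros t Ht; left.
    apply (Hdelta x0 t x t); try lra.
    rewrite Rminus_diag, Rabs_R0; apply cond_pos.
- unfold d.
  apply Rmult_lt_reg_r with (2 * (b - a + 1)); [lra|].
  field_simplify; nra.
Qed.

Lemma ex_RInt_param u a b c d : c <= d -> cont2 u ->
  ex_RInt (fun x => RInt (fun y => u x y) c d) a b.
Proof. intros H Hu; apply ex_RInt_cont, RInt_param_continuity; auto. Qed.

Lemma two_PI_pos : 0 < 2 * PI.
Proof. generalize PI_RGT_0; lra. Qed.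

Lemma mean2_plus u v : cont2 u -> cont2 v ->
  mean2 (fun x y => u x y + v x y) = mean2 u + mean2 v.
Proof.
intros Hu Hv; unfold mean2.
assert (P := two_PI_pos).
rewrite <- Rmult_plus_distr_l; f_equal.
rewrite <- (RInt_plus (V := R_CompleteNormedModule)) by (apply ex_RInt_param; auto; lra).
apply RInt_ext; intros x _.
apply (RInt_plus (V := R_CompleteNormedModule)); apply ex_RInt_cont, cont2_y; auto.
Qed.

Lemma mean2_scal c u : cont2 u -> mean2 (fun x y => c * u x y) = c * mean2 u.
Proof.
intros Hu; unfold mean2.
assert (P := two_PI_pos).
rewrite <- Rmult_assoc, (Rmult_comm c), Rmult_assoc; f_equal.
rewrite <- (RInt_scal (V := R_CompleteNormedModule)) by (apply ex_RInt_param; auto; lra).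
apply RInt_ext; intros x _.
apply (RInt_scal (V := R_CompleteNormedModule)); apply ex_RInt_cont, cont2_y; auto.
Qed.

Lemma mean2_minus u v : cont2 u -> cont2 v ->
  mean2 (fun x y => u x y - v x y) = mean2 u - mean2 v.
Proof.
intros Hu Hv.
replace (mean2 u - mean2 v) with (mean2 u + (-1) * mean2 v) by ring.
rewrite <- mean2_scal, <- mean2_plus; auto.
- f_equal; apply fun2_ext; intros; ring.
- apply cont2_mult; auto; apply cont2_const.
Qed.

Lemma mean2_const c : mean2 (fun _ _ => c) = c.
Proof.
unfold mean2.
rewrite (RInt_ext _ (fun _ => 2 * PI * c)).
- rewrite RInt_const; unfold scal; simpl; unfold mult; simpl.
  field; generalize PI_RGT_0; lra.
- intros x _; rewrite RInt_const; unfold scal; simpl; unfold mult; simpl; ring.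
Qed.

Lemma mean2_le u v : cont2 u -> cont2 v -> (forall x y, u x y <= v x y) -> mean2 u <= mean2 v.
Proof.
intros Hu Hv H; unfold mean2.
assert (P := two_PI_pos).
apply Rmult_le_compat_l.
{ left; apply Rinv_0_lt_compat, pow_lt; auto. }
apply RInt_le; try lra; try (apply ex_RInt_param; auto; lra).
intros x _; apply RInt_le; try lra; try (apply ex_RInt_cont, cont2_y; auto); auto.
Qed.

Lemma mean2_dom u v : cont2 u -> cont2 v -> (forall x y, Rabs (u x y) <= v x y) ->
  Rabs (mean2 u) <= mean2 v.
Proof.
intros Hu Hv H; apply Rabs_le; split.
- replace (- mean2 v) with (-1 * mean2 v) by ring; rewrite <- mean2_scal by auto.
  apply mean2_le; auto.
  + apply cont2_mult; auto; apply cont2_const.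
  + intros x y; generalize (H x y) (Rabs_maj2 (u x y)); lra.
- apply mean2_le; auto; intros x y; generalize (H x y) (Rle_abs (u x y)); lra.
Qed.

(** * Sums over Z^2 *)

Section Zsum.
Context {G : AbelianMonoid}.

Lemma zsum_0 (a : Z -> G) : zsum a 0 = a 0%Z.
Proof. unfold zsum; simpl; rewrite sum_O; reflexivity. Qed.

Lemma zsum_S (a : Z -> G) N :
  zsum a (S N) = plus (zsum a N) (plus (a (Z.of_nat (S N))) (a (- Z.of_nat (S N))%Z)).
Proof.
unfold zsum.
replace (2 * S N)%nat with (S (S (2 * N))) by lia.
rewrite sum_Sn.
unfold sum_n at 1; rewrite sum_Sn_m by lia.
rewrite <- sum_n_m_S.
rewrite (plus_comm (a _)), <- plus_assoc; f_equal.
- apply sum_n_ext; intros n; f_equal; lia.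
- rewrite plus_comm; f_equal; f_equal; lia.
Qed.

Lemma zsum_ext (a b : Z -> G) N : (forall j, a j = b j) -> zsum a N = zsum b N.
Proof. intros H; apply sum_n_ext; intros n; apply H. Qed.

Lemma zsum_plus (a b : Z -> G) N : zsum (fun j => plus (a j) (b j)) N = plus (zsum a N) (zsum b N).
Proof. apply sum_n_plus. Qed.

Lemma zsum_opp_index (a : Z -> G) N : zsum (fun j => a (- j)%Z) N = zsum a N.
Proof.
induction N.
- now rewrite !zsum_0.
- rewrite !zsum_S, IHN; f_equal; rewrite plus_comm; f_equal; f_equal; lia.
Qed.

Lemma zsum_delta (m : Z) (x : G) N : (Z.abs m <= Z.of_nat N)%Z ->
  zsum (fun j => if Z.eq_dec j m then x else zero) N = x.
Proof.
assert (H0 : forall N, (Z.abs m > Z.of_nat N)%Z ->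
  zsum (fun j => if Z.eq_dec j m then x else zero) N = zero).
{ intros K; induction K; intros HK.
  - rewrite zsum_0; destruct (Z.eq_dec 0 m); [lia|reflexivity].
  - rewrite zsum_S, IHK by lia.
    destruct (Z.eq_dec _ m); [lia|]; destruct (Z.eq_dec _ m); [lia|].
    now rewrite !plus_zero_l. }
induction N; intros HN.
- rewrite zsum_0; destruct (Z.eq_dec 0 m); [reflexivity|lia].
- rewrite zsum_S.
  destruct (Z_le_gt_dec (Z.abs m) (Z.of_nat N)).
  + rewrite IHN by lia.
    destruct (Z.eq_dec _ m); [lia|]; destruct (Z.eq_dec _ m); [lia|].
    now rewrite !plus_zero_r.
  + rewrite H0 by lia; rewrite plus_zero_l.
    destruct (Z.eq_dec (Z.of_nat (S N)) m); destruct (Z.eq_dec (- Z.of_nat (S N)) m); try lia.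
    * apply plus_zero_r.
    * apply plus_zero_l.
Qed.

(** Convertible to the partial sums inside [Csum2], so that limits of [bsum] are the limits defining
    [Csum2]. *)
Definition bsum (a : Z -> Z -> G) (N : nat) : G :=
  zsum (fun j1 => zsum (fun j2 => a j1 j2) N) N.

Lemma bsum_ext (a b : Z -> Z -> G) N :
  (forall j1 j2, a j1 j2 = b j1 j2) -> bsum a N = bsum b N.
Proof. intros H; apply zsum_ext; intros j; apply zsum_ext; auto. Qed.

Lemma bsum_opp_index (a : Z -> Z -> G) N :
  bsum (fun j1 j2 => a (- j1)%Z (- j2)%Z) N = bsum a N.
Proof.
unfold bsum.
rewrite <- (zsum_opp_index (fun j1 => zsum (fun j2 => a j1 j2) N)).
apply zsum_ext; intros j; apply (zsum_opp_index (a (- j)%Z)).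
Qed.

Lemma zsum_zero N : zsum (fun _ => zero : G) N = zero.
Proof. induction N; [apply zsum_0|]. now rewrite zsum_S, IHN, !plus_zero_l. Qed.

Lemma bsum_zero (a : Z -> Z -> G) N : (forall j1 j2, a j1 j2 = zero) -> bsum a N = zero.
Proof.
intros H; unfold bsum; rewrite <- (zsum_zero N); apply zsum_ext; intros j.
rewrite <- (zsum_zero N); apply zsum_ext; auto.
Qed.

Lemma bsum_delta (m1 m2 : Z) (a : Z -> Z -> G) N :
  (Z.abs m1 <= Z.of_nat N)%Z -> (Z.abs m2 <= Z.of_nat N)%Z ->
  (forall j1 j2, (j1, j2) <> (m1, m2) -> a j1 j2 = zero) -> bsum a N = a m1 m2.
Proof.
intros H1 H2 Ha; unfold bsum.
rewrite <- (zsum_delta m1 (a m1 m2) N H1); apply zsum_ext; intros j1.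
destruct (Z.eq_dec j1 m1) as [->|E].
- rewrite <- (zsum_delta m2 (a m1 m2) N H2); apply zsum_ext; intros j2.
  destruct (Z.eq_dec j2 m2) as [->|E]; auto.
  apply Ha; intros F; inversion F; auto.
- rewrite <- (zsum_zero N); apply zsum_ext; intros j2.
  apply Ha; intros F; inversion F; auto.
Qed.

(** The ring around the square consists of two sides [j2 = N + 1], [j2 = - (N + 1)] cut to
    [|j1| <= N], and two full sides in [j1], so that corners are counted once. *)
Lemma bsum_S (a : Z -> Z -> G) N :
  bsum a (S N) = plus (bsum a N)
    (plus (zsum (fun j1 => plus (a j1 (Z.of_nat (S N))) (a j1 (- Z.of_nat (S N))%Z)) N)
      (plus (zsum (a (Z.of_nat (S N))) (S N)) (zsum (a (- Z.of_nat (S N))%Z) (S N)))).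
Proof.
unfold bsum.
rewrite (zsum_S (fun j1 => zsum (fun j2 => a j1 j2) (S N))).
rewrite (zsum_ext _ _ N (fun j1 => zsum_S (fun j2 => a j1 j2) N)).
rewrite zsum_plus; symmetry; apply plus_assoc.
Qed.
End Zsum.

Lemma zsum_closed {G : AbelianMonoid} (P : G -> Prop) (a : Z -> G) N :
  (forall x y, P x -> P y -> P (plus x y)) -> (forall j, P (a j)) -> P (zsum a N).
Proof.
intros HP Ha; induction N; [rewrite zsum_0; auto|].
rewrite zsum_S; auto.
Qed.

Lemma zsum_morph {G H : AbelianMonoid} (f : G -> H) (a : Z -> G) N :
  (forall x y, f (plus x y) = plus (f x) (f y)) -> f (zsum a N) = zsum (fun j => f (a j)) N.
Proof.
intros Hf; induction N; [now rewrite !zsum_0|].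
now rewrite !zsum_S, !Hf, IHN.
Qed.

Lemma bsum_morph {G H : AbelianMonoid} (f : G -> H) (a : Z -> Z -> G) N :
  (forall x y, f (plus x y) = plus (f x) (f y)) ->
  f (bsum a N) = bsum (fun j1 j2 => f (a j1 j2)) N.
Proof.
intros Hf; unfold bsum; rewrite (zsum_morph f _ _ Hf); apply zsum_ext; intros j.
apply (zsum_morph f _ _ Hf).
Qed.

Lemma Re_plus (x y : C) : Re (plus x y) = plus (Re x) (Re y).
Proof. reflexivity. Qed.
Lemma Cmod_zsum (f : Z -> C) (b : Z -> R) N :
  (forall j, Cmod (f j) <= b j) -> Cmod (zsum f N) <= zsum b N.
Proof.
intros H; induction N; [rewrite !zsum_0; auto|].
rewrite !zsum_S.
eapply Rle_trans; [apply Cmod_triangle|]; apply Rplus_le_compat; auto.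
eapply Rle_trans; [apply Cmod_triangle|]; apply Rplus_le_compat; auto.
Qed.

Lemma Cmod_bsum (f : Z -> Z -> C) (b : Z -> Z -> R) N :
  (forall j1 j2, Cmod (f j1 j2) <= b j1 j2) -> Cmod (bsum f N) <= bsum b N.
Proof. intros H; apply Cmod_zsum; intros j; apply Cmod_zsum; auto. Qed.

Lemma bsum_le_scal (f : Z -> Z -> R) (b : Z -> Z -> R) M N :
  (forall j1 j2, f j1 j2 <= M * b j1 j2) -> bsum f N <= M * bsum b N.
Proof.
intros H; rewrite (bsum_morph (G := R_AbelianMonoid) (H := R_AbelianMonoid) (fun x => M * x)).
2: intros; unfold plus; simpl; ring.
assert (K : forall (u v : Z -> R) N, (forall j, u j <= v j) -> zsum u N <= zsum v N).
{ intros u v K Huv; induction K; [rewrite !zsum_0; auto|].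
  rewrite !zsum_S; apply Rplus_le_compat; [exact IHK|]; apply Rplus_le_compat; auto. }
apply K; intros j; apply K; auto.
Qed.

(** The squares grow one ring at a time, and each ring is dominated term by term; the differences
    therefore inherit the bound. *)
Lemma Cmod_bsum_diff (f : Z -> Z -> C) (b : Z -> Z -> R) N k :
  (forall j1 j2, Cmod (f j1 j2) <= b j1 j2) ->
  Cmod (bsum f (N + k) - bsum f N)%C <= bsum b (N + k) - bsum b N.
Proof.
intros H; induction k.
- rewrite Nat.add_0_r, Rminus_diag.
  replace (_ - _)%C with (RtoC 0) by ring; rewrite Cmod_0; lra.
- replace (N + S k)%nat with (S (N + k)) by lia.
  rewrite !bsum_S.
  match goal with |- Cmod (plus ?s ?r - ?t)%C <= plus ?s' ?r' - ?t' =>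
    assert (K : Cmod r <= r');
    [| replace (plus s r - t)%C with ((s - t) + r)%C by (unfold plus; simpl; ring);
       replace (plus s' r' - t') with ((s' - t') + r') by (unfold plus; simpl; ring)] end.
  + assert (T : forall x y x' y', Cmod x <= x' -> Cmod y <= y' -> Cmod (plus x y) <= plus x' y').
    { intros; eapply Rle_trans; [apply Cmod_triangle|]; apply Rplus_le_compat; auto. }
    apply T; [|apply T]; apply Cmod_zsum; auto.
  + eapply Rle_trans; [apply Cmod_triangle|]; apply Rplus_le_compat; auto.
Qed.

(** * Summable weights on [Z^2] and truncation errors *)

Definition wt (j1 j2 : Z) : R := (1 + IZR j1 ^ 2) * (1 + IZR j2 ^ 2).

Lemma wt_ge_1 j1 j2 : 1 <= wt j1 j2.
Proof. unfold wt; generalize (pow2_ge_0 (IZR j1)) (pow2_ge_0 (IZR j2)); nra. Qed.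

Definition wsum (N : nat) : R := bsum (fun j1 j2 => / wt j1 j2) N.

(** The bound telescopes: each of the two terms added in passing from [N] to [N + 1] is at most
    [2 / (N + 1) - 2 / (N + 2)], and at [N = 0] the bound equals the single term [1]. *)
Lemma zsum_inv_sq_le N : zsum (fun j => / (1 + IZR j ^ 2)) N <= 5 - 4 / (INR N + 1).
Proof.
induction N.
- rewrite zsum_0; simpl; lra.
- rewrite zsum_S.
  match goal with |- plus ?a (plus ?b ?c) <= ?d => change (a + (b + c) <= d) end.
  rewrite opp_IZR, <- INR_IZR_INZ.
  rewrite S_INR; assert (P := pos_INR N).
  set (x := INR N) in *.
  replace ((- (x + 1)) ^ 2) with ((x + 1) ^ 2) by ring.
  assert (/ (1 + (x + 1) ^ 2) <= 2 / (x + 1) - 2 / (x + 1 + 1)).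
  { replace (2 / (x + 1) - 2 / (x + 1 + 1)) with (/ ((x + 1) * (x + 2) / 2)) by (field; lra).
    apply Rinv_le_contravar; nra. }
  unfold Rdiv in *; lra.
Qed.

(** The weight is a product, so the double sum is the square of the one-dimensional sum, which stays
    below [5]. *)
Lemma wsum_le N : wsum N <= 25.
Proof.
assert (E : wsum N = zsum (fun j => / (1 + IZR j ^ 2)) N * zsum (fun j => / (1 + IZR j ^ 2)) N).
{ set (s := zsum _ N) at 2.
  rewrite (zsum_morph (G := R_AbelianMonoid) (H := R_AbelianMonoid) (fun x => x * s)).
  2: intros; unfold plus; simpl; ring.
  apply zsum_ext; intros j1; unfold s.
  rewrite (zsum_morph (G := R_AbelianMonoid) (H := R_AbelianMonoid) (fun x => / (1 + IZR j1 ^ 2) * x)).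
  2: intros; unfold plus; simpl; ring.
  apply zsum_ext; intros j2; unfold wt; apply Rinv_mult. }
rewrite E.
assert (A := zsum_inv_sq_le N).
assert (B : 0 < / (INR N + 1)) by (apply Rinv_0_lt_compat; generalize (pos_INR N); lra).
assert (D : 0 <= zsum (fun j => / (1 + IZR j ^ 2)) N).
{ apply (zsum_closed (G := R_AbelianMonoid) (fun x => 0 <= x)).
  - intros x y; unfold plus; simpl; lra.
  - intros j; left; apply Rinv_0_lt_compat; nra. }
unfold Rdiv in A; nra.
Qed.

Lemma wsum_incr N k : wsum N <= wsum (N + k).
Proof.
assert (H := Cmod_bsum_diff (fun _ _ => RtoC 0) (fun j1 j2 => / wt j1 j2) N k).
unfold wsum; eapply Rminus_le_0, Rle_trans; [|apply H].
- apply Cmod_ge_0.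
- intros j1 j2; rewrite Cmod_0; left; apply Rinv_0_lt_compat.
  generalize (wt_ge_1 j1 j2); lra.
Qed.

Lemma wsum_cv : is_lim_seq wsum (real (Lim_seq wsum)).
Proof.
apply Lim_seq_correct'.
apply ex_finite_lim_seq_incr with 25; [|apply wsum_le].
intros n; generalize (wsum_incr n 1); now rewrite Nat.add_1_r.
Qed.

Definition wtail (N : nat) : R := real (Lim_seq wsum) - wsum N.

Lemma wtail_lim : is_lim_seq wtail 0.
Proof.
unfold wtail.
replace (Finite 0) with (Finite (real (Lim_seq wsum) - real (Lim_seq wsum))) by (f_equal; ring).
apply is_lim_seq_minus'; [apply is_lim_seq_const|apply wsum_cv].
Qed.

Lemma wsum_diff_le_tail N k : wsum (N + k) - wsum N <= wtail N.
Proof.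
unfold wtail; apply Rplus_le_compat_r.
apply (is_lim_seq_incr_compare wsum _ wsum_cv).
intros n; generalize (wsum_incr n 1); now rewrite Nat.add_1_r.
Qed.

Lemma wtail_ge_0 N : 0 <= wtail N.
Proof.
generalize (wsum_diff_le_tail N 0); rewrite Nat.add_0_r, Rminus_diag; auto.
Qed.

(** Domination by the summable weights gives absolute convergence together with a truncation error
    that is the same at every point of the torus, because characters have modulus [1]. *)
Definition qdecay (M : R) (a : Z -> Z -> C) : Prop := forall j1 j2, Cmod (a j1 j2) <= M * / wt j1 j2.

Lemma qdecay_ge_0 M a : qdecay M a -> 0 <= M.
Proof.
intros H; generalize (H 0%Z 0%Z) (Cmod_ge_0 (a 0%Z 0%Z)); unfold wt.
replace (/ ((1 + IZR 0 ^ 2) * (1 + IZR 0 ^ 2))) with 1 by (simpl; field); lra.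
Qed.

Lemma qdecay_diff M a N k : qdecay M a -> Cmod (bsum a (N + k) - bsum a N)%C <= M * wtail N.
Proof.
intros H.
assert (HM := qdecay_ge_0 M a H).
eapply Rle_trans; [apply (Cmod_bsum_diff a _ N k H)|].
eapply Rle_trans; [|apply Rmult_le_compat_l; [exact HM|apply (wsum_diff_le_tail N k)]].
unfold wsum.
rewrite <- !(bsum_morph (G := R_AbelianMonoid) (H := R_AbelianMonoid) (fun x => M * x)).
- simpl; lra.
- intros; unfold plus; simpl; ring.
- intros; unfold plus; simpl; ring.
Qed.

(** Letting [k] tend to infinity in the Cauchy estimate turns it into a rate of convergence. *)
Lemma Cauchy_lim (u : nat -> R) (t : nat -> R) :
  is_lim_seq t 0 -> (forall N k, Rabs (u (N + k)%nat - u N) <= t N) ->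
  is_lim_seq u (real (Lim_seq u)) /\ forall N, Rabs (real (Lim_seq u) - u N) <= t N.
Proof.
intros Ht Hu.
assert (L : is_lim_seq u (real (Lim_seq u))).
{ apply Lim_seq_correct', ex_lim_seq_cauchy_corr.
  intros eps.
  assert (E2 : 0 < eps / 2) by (generalize (cond_pos eps); lra).
  apply is_lim_seq_spec in Ht; destruct (Ht (mkposreal _ E2)) as [N HN]; simpl in HN.
  exists N; intros n m Hn Hm.
  specialize (HN N (le_n N)); rewrite Rminus_0_r in HN.
  assert (A := Rle_lt_trans _ _ _ (Rle_trans _ _ _ (Hu N (n - N)%nat) (Rle_abs _)) HN).
  assert (B := Rle_lt_trans _ _ _ (Rle_trans _ _ _ (Hu N (m - N)%nat) (Rle_abs _)) HN).
  replace (N + (n - N))%nat with n in A by lia.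
  replace (N + (m - N))%nat with m in B by lia.
  replace (u n - u m) with ((u n - u N) - (u m - u N)) by ring.
  eapply Rle_lt_trans; [apply Rabs_triang|]; rewrite Rabs_Ropp; lra. }
split; auto; intros N.
apply (is_lim_seq_incr_n u N) in L.
assert (L2 : is_lim_seq (fun k => Rabs (u (k + N)%nat - u N)) (Rabs (real (Lim_seq u) - u N))).
{ apply (is_lim_seq_abs _ (Finite _)).
  apply is_lim_seq_minus'; auto; apply is_lim_seq_const. }
apply (is_lim_seq_le _ _ _ _ (fun k => eq_rect _ (fun n => Rabs (u n - u N) <= t N) (Hu N k) _ (Nat.add_comm N k))
        L2 (is_lim_seq_const (t N))).
Qed.

(** [Csum2] is built from the limits of real and imaginary parts, each of which converges at the
    rate [M * wtail N]; the factor [2] dominates the [sqrt 2] lost in returning to the modulus. *)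
Lemma Csum2_spec M a : qdecay M a ->
  is_lim_seq (fun N => Re (bsum a N)) (Re (Csum2 a)) /\
  is_lim_seq (fun N => Im (bsum a N)) (Im (Csum2 a)) /\
  forall N, Cmod (Csum2 a - bsum a N)%C <= 2 * M * wtail N.
Proof.
intros H.
assert (T : is_lim_seq (fun N => M * wtail N) 0).
{ replace (Finite 0) with (Finite (M * 0)) by (f_equal; ring).
  apply is_lim_seq_mult'; [apply is_lim_seq_const|apply wtail_lim]. }
destruct (Cauchy_lim (fun N => Re (bsum a N)) _ T) as [R1 R2].
{ intros N k; eapply Rle_trans; [|apply (qdecay_diff M a N k H)].
  apply (re_le_Cmod (bsum a (N + k) - bsum a N)%C). }
destruct (Cauchy_lim (fun N => Im (bsum a N)) _ T) as [I1 I2].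
{ intros N k; eapply Rle_trans; [|apply (qdecay_diff M a N k H)].
  eapply Rle_trans; [|apply Rmax_Cmod]; apply Rmax_r. }
split; [exact R1|split; [exact I1|]].
intros N; eapply Rle_trans; [apply Cmod_2Rmax|].
assert (S2 : sqrt 2 <= 2).
{ rewrite <- (sqrt_Rsqr 2) at 2 by lra; apply sqrt_le_1_alt; unfold Rsqr; lra. }
rewrite Rmult_assoc.
apply Rmult_le_compat; auto using sqrt_pos.
- eapply Rle_trans; [apply Rabs_pos|apply Rmax_l].
- apply Rmax_lub; [apply R2|apply I2].
Qed.

(** * Fourier coefficients of complex functions *)

Lemma C_ext (x y : C) : Re x = Re y -> Im x = Im y -> x = y.
Proof. destruct x, y; simpl; intros -> ->; reflexivity. Qed.

Definition ccont (f : R -> R -> C) : Prop :=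
  cont2 (fun x y => Re (f x y)) /\ cont2 (fun x y => Im (f x y)).

Lemma ccont_const c : ccont (fun _ _ => c).
Proof. split; apply cont2_const. Qed.

Lemma ccont_plus f g : ccont f -> ccont g -> ccont (fun x y => f x y + g x y)%C.
Proof. intros [F1 F2] [G1 G2]; split; apply cont2_plus; auto. Qed.

Lemma ccont_mult f g : ccont f -> ccont g -> ccont (fun x y => f x y * g x y)%C.
Proof.
intros [F1 F2] [G1 G2]; split.
- apply cont2_minus; apply cont2_mult; auto.
- apply cont2_plus; apply cont2_mult; auto.
Qed.

Lemma ccont_minus f g : ccont f -> ccont g -> ccont (fun x y => f x y - g x y)%C.
Proof.
intros Hf [G1 G2]; apply ccont_plus; auto.
split; apply cont2_opp; auto.
Qed.

Lemma ccont_RtoC u : cont2 u -> ccont (fun x y => RtoC (u x y)).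
Proof. intros H; split; [exact H|apply (cont2_const 0)]. Qed.

Lemma cont2_lin a b : cont2 (fun x y => a * x + b * y).
Proof.
apply cont2_plus; apply cont2_mult; auto using cont2_const, cont2_fst, cont2_snd.
Qed.

Lemma ccont_char2 j1 j2 : ccont (char2 j1 j2).
Proof.
split; simpl.
- apply (cont2_comp1 cos); [apply continuity_cos|apply cont2_lin].
- apply (cont2_comp1 sin); [apply continuity_sin|apply cont2_lin].
Qed.

Lemma char2_mult i1 i2 j1 j2 x y :
  (char2 i1 i2 x y * char2 j1 j2 x y)%C = char2 (i1 + j1) (i2 + j2) x y.
Proof.
unfold char2; rewrite !plus_IZR.
replace ((IZR i1 + IZR j1) * x + (IZR i2 + IZR j2) * y)
  with ((IZR i1 * x + IZR i2 * y) + (IZR j1 * x + IZR j2 * y)) by ring.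
set (u := IZR i1 * x + _); set (v := IZR j1 * x + _).
rewrite cos_plus, sin_plus; apply C_ext; simpl; ring.
Qed.

Lemma char2_shift j1 j2 x y s r :
  char2 j1 j2 (x + s) (y + r) = (char2 j1 j2 x y * char2 j1 j2 s r)%C.
Proof.
unfold char2.
replace (IZR j1 * (x + s) + IZR j2 * (y + r))
  with ((IZR j1 * x + IZR j2 * y) + (IZR j1 * s + IZR j2 * r)) by ring.
set (u := IZR j1 * x + _); set (v := IZR j1 * s + _).
rewrite cos_plus, sin_plus; apply C_ext; simpl; ring.
Qed.

Lemma char2_conj j1 j2 x y : char2 (- j1) (- j2) x y = Cconj (char2 j1 j2 x y).
Proof.
unfold char2, Cconj; rewrite !opp_IZR; simpl.
replace (- IZR j1 * x + - IZR j2 * y) with (- (IZR j1 * x + IZR j2 * y)) by ring.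
now rewrite cos_neg, sin_neg.
Qed.

Lemma char2_0 x y : char2 0 0 x y = RtoC 1.
Proof. unfold char2; rewrite !Rmult_0_l, Rplus_0_l, cos_0, sin_0; reflexivity. Qed.

Lemma Cmod_char2 j1 j2 x y : Cmod (char2 j1 j2 x y) = 1.
Proof.
unfold Cmod, char2; cbn [fst snd].
set (t := IZR j1 * x + IZR j2 * y).
rewrite <- sqrt_1; f_equal; generalize (sin2_cos2 t); unfold Rsqr; lra.
Qed.

Lemma mean2C_plus f g : ccont f -> ccont g ->
  mean2C (fun x y => f x y + g x y)%C = (mean2C f + mean2C g)%C.
Proof.
intros [F1 F2] [G1 G2]; unfold mean2C; apply C_ext; simpl; apply mean2_plus; auto.
Qed.

Lemma mean2C_scal c f : ccont f -> mean2C (fun x y => c * f x y)%C = (c * mean2C f)%C.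
Proof.
intros [F1 F2]; unfold mean2C; apply C_ext; simpl.
- rewrite mean2_minus by (apply cont2_mult; auto; apply cont2_const).
  now rewrite !mean2_scal.
- rewrite mean2_plus by (apply cont2_mult; auto; apply cont2_const).
  now rewrite !mean2_scal.
Qed.

Lemma mean2C_minus f g : ccont f -> ccont g ->
  mean2C (fun x y => f x y - g x y)%C = (mean2C f - mean2C g)%C.
Proof.
intros [F1 F2] [G1 G2]; unfold mean2C; apply C_ext; simpl; apply mean2_minus; auto.
Qed.

Lemma Cmod_le_ReIm (z : C) r : Rabs (Re z) <= r -> Rabs (Im z) <= r -> Cmod z <= 2 * r.
Proof.
intros H1 H2; eapply Rle_trans; [apply Cmod_2Rmax|].
assert (S2 : sqrt 2 <= 2).
{ rewrite <- (sqrt_Rsqr 2) at 2 by lra; apply sqrt_le_1_alt; unfold Rsqr; lra. }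
apply Rmult_le_compat; auto using sqrt_pos.
- eapply Rle_trans; [apply Rabs_pos|apply Rmax_l].
- apply Rmax_lub; auto.
Qed.

Lemma im_le_Cmod (z : C) : Rabs (Im z) <= Cmod z.
Proof. eapply Rle_trans; [|apply Rmax_Cmod]; apply Rmax_r. Qed.

Lemma mean2C_dom f u : ccont f -> cont2 u -> (forall x y, Cmod (f x y) <= u x y) ->
  Cmod (mean2C f) <= 2 * mean2 u.
Proof.
intros [F1 F2] Hu H; apply Cmod_le_ReIm; simpl; apply mean2_dom; auto; intros x y;
  eapply Rle_trans; try apply H; [apply re_le_Cmod|apply im_le_Cmod].
Qed.

Lemma ccont_zsum (F : Z -> R -> R -> C) N : (forall j, ccont (F j)) ->
  ccont (fun x y => zsum (fun j => F j x y) N).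
Proof.
intros H; induction N.
- replace (fun x y => zsum (fun j => F j x y) 0) with (F 0%Z); auto.
  apply fun2_ext; intros; now rewrite zsum_0.
- replace (fun x y => zsum (fun j => F j x y) (S N)) with
    (fun x y => zsum (fun j => F j x y) N + (F (Z.of_nat (S N)) x y + F (- Z.of_nat (S N))%Z x y))%C.
  + apply ccont_plus; auto; apply ccont_plus; auto.
  + apply fun2_ext; intros; now rewrite zsum_S.
Qed.

Lemma mean2C_zsum (F : Z -> R -> R -> C) N : (forall j, ccont (F j)) ->
  mean2C (fun x y => zsum (fun j => F j x y) N) = zsum (fun j => mean2C (F j)) N.
Proof.
intros H; induction N.
- rewrite zsum_0; f_equal; apply fun2_ext; intros; now rewrite zsum_0.
- rewrite zsum_S, <- IHN.
  replace (fun x y => zsum (fun j => F j x y) (S N)) with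
    (fun x y => zsum (fun j => F j x y) N + (F (Z.of_nat (S N)) x y + F (- Z.of_nat (S N))%Z x y))%C.
  2: apply fun2_ext; intros; now rewrite zsum_S.
  rewrite mean2C_plus, mean2C_plus; auto using ccont_zsum, ccont_plus.
Qed.

Lemma ccont_bsum (F : Z -> Z -> R -> R -> C) N : (forall j1 j2, ccont (F j1 j2)) ->
  ccont (fun x y => bsum (fun j1 j2 => F j1 j2 x y) N).
Proof.
intros H; apply (ccont_zsum (fun j1 x y => zsum (fun j2 => F j1 j2 x y) N)).
intros j; apply ccont_zsum; auto.
Qed.

Lemma mean2C_bsum (F : Z -> Z -> R -> R -> C) N : (forall j1 j2, ccont (F j1 j2)) ->
  mean2C (fun x y => bsum (fun j1 j2 => F j1 j2 x y) N) = bsum (fun j1 j2 => mean2C (F j1 j2)) N.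
Proof.
intros H; unfold bsum.
rewrite (mean2C_zsum (fun j1 x y => zsum (fun j2 => F j1 j2 x y) N)).
- apply zsum_ext; intros j; apply mean2C_zsum; auto.
- intros j; apply ccont_zsum; auto.
Qed.

Lemma cont2_uniform_limit u :
  (forall e, 0 < e -> exists v, cont2 v /\ forall x y, Rabs (u x y - v x y) <= e) -> cont2 u.
Proof.
intros H x y e.
destruct (H (e / 4)) as [v [Hv E]]; [generalize (cond_pos e); lra|].
assert (He : 0 < e / 4) by (generalize (cond_pos e); lra).
destruct (Hv x y (mkposreal _ He)) as [d Hd]; simpl in Hd.
exists d; intros a b Ha Hb.
specialize (Hd a b Ha Hb).
assert (E1 := E a b); assert (E2 := E x y).
replace (u a b - u x y) with ((u a b - v a b) + (v a b - v x y) - (u x y - v x y)) by ring.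
eapply Rle_lt_trans; [apply Rabs_triang|]; rewrite Rabs_Ropp.
eapply Rle_lt_trans; [apply Rplus_le_compat_r, Rabs_triang|]; lra.
Qed.

Definition fpart (a : Z -> Z -> C) (N : nat) (x y : R) : C :=
  bsum (fun j1 j2 => a j1 j2 * char2 j1 j2 x y)%C N.

Lemma qdecay_char2 M a x y : qdecay M a -> qdecay M (fun j1 j2 => a j1 j2 * char2 j1 j2 x y)%C.
Proof. intros H j1 j2; rewrite Cmod_mult, Cmod_char2, Rmult_1_r; apply H. Qed.

Lemma fpart_err M a N x y : qdecay M a ->
  Cmod (fourier_series a x y - fpart a N x y)%C <= 2 * M * wtail N.
Proof. intros H; apply (Csum2_spec _ _ (qdecay_char2 M a x y H)). Qed.

Lemma wtail_small M e : 0 < e -> exists N, 2 * M * wtail N <= e.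
Proof.
intros He.
assert (T : is_lim_seq (fun N => 2 * M * wtail N) 0).
{ replace (Finite 0) with (Finite (2 * M * 0)) by (f_equal; ring).
  apply is_lim_seq_mult'; [apply is_lim_seq_const|apply wtail_lim]. }
apply is_lim_seq_spec in T; destruct (T (mkposreal e He)) as [N HN]; exists N.
specialize (HN N (le_n N)); simpl in HN; rewrite Rminus_0_r in HN.
generalize (Rle_abs (2 * M * wtail N)); lra.
Qed.

Lemma ccont_fpart a N : ccont (fpart a N).
Proof.
apply (ccont_bsum (fun j1 j2 x y => a j1 j2 * char2 j1 j2 x y)%C).
intros; apply ccont_mult; [apply ccont_const|apply ccont_char2].
Qed.

Lemma ccont_series M a : qdecay M a -> ccont (fourier_series a).
Proof.
intros H; split; apply cont2_uniform_limit; intros e He;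
  destruct (wtail_small M e He) as [N HN].
- exists (fun x y => Re (fpart a N x y)); split; [apply ccont_fpart|].
  intros x y; eapply Rle_trans; [|exact HN].
  eapply Rle_trans; [|apply (fpart_err M a N x y H)].
  apply (re_le_Cmod (_ - _)%C).
- exists (fun x y => Im (fpart a N x y)); split; [apply ccont_fpart|].
  intros x y; eapply Rle_trans; [|exact HN].
  eapply Rle_trans; [|apply (fpart_err M a N x y H)].
  apply (im_le_Cmod (_ - _)%C).
Qed.

Definition ccoef (f : R -> R -> C) (m1 m2 : Z) : C :=
  mean2C (fun x y => f x y * char2 (- m1) (- m2) x y)%C.

Lemma ccoef_scal_char2 c j1 j2 f m1 m2 : ccont f ->
  ccoef (fun x y => c * char2 j1 j2 x y * f x y)%C m1 m2 = (c * ccoef f (m1 - j1) (m2 - j2))%C.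
Proof.
intros H; unfold ccoef.
rewrite <- mean2C_scal by (apply ccont_mult; auto using ccont_char2).
f_equal; apply fun2_ext; intros x y.
replace (- (m1 - j1))%Z with (j1 + - m1)%Z by lia.
replace (- (m2 - j2))%Z with (j2 + - m2)%Z by lia.
rewrite <- char2_mult; ring.
Qed.

Lemma ccoef_fpart_mult a N f m1 m2 : ccont f ->
  ccoef (fun x y => fpart a N x y * f x y)%C m1 m2 =
  bsum (fun j1 j2 => a j1 j2 * ccoef f (m1 - j1) (m2 - j2))%C N.
Proof.
intros H.
replace (bsum _ N) with (bsum (fun j1 j2 => ccoef (fun x y => a j1 j2 * char2 j1 j2 x y * f x y)%C m1 m2) N).
2: apply bsum_ext; intros; now apply ccoef_scal_char2.
unfold ccoef at 2; rewrite <- mean2C_bsum.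
2: { intros; repeat apply ccont_mult; auto using ccont_const, ccont_char2. }
unfold ccoef; f_equal; apply fun2_ext; intros x y; unfold fpart.
rewrite (bsum_morph (G := C_AbelianMonoid) (H := C_AbelianMonoid) (fun z : C => z * f x y)%C).
2: intros; unfold plus; simpl; ring.
rewrite (bsum_morph (G := C_AbelianMonoid) (H := C_AbelianMonoid) (fun z : C => z * char2 (- m1) (- m2) x y)%C).
2: intros; unfold plus; simpl; ring.
reflexivity.
Qed.

Lemma C_eq_small (z w : C) : (forall e, 0 < e -> Cmod (z - w)%C <= e) -> z = w.
Proof.
intros H.
assert (E : Cmod (z - w)%C = 0).
{ apply Rle_antisym; [|apply Cmod_ge_0].
  apply Rnot_lt_le; intros L.
  specialize (H (Cmod (z - w)%C / 2)); lra. }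
apply Cmod_eq_0 in E.
replace z with ((z - w) + w)%C by ring; rewrite E; ring.
Qed.

Lemma ccoef_uniform f g m1 m2 e : ccont f -> ccont g ->
  (forall x y, Cmod (f x y - g x y)%C <= e) -> Cmod (ccoef f m1 m2 - ccoef g m1 m2)%C <= 2 * e.
Proof.
intros Hf Hg H; unfold ccoef.
rewrite <- mean2C_minus by (apply ccont_mult; auto using ccont_char2).
rewrite <- (mean2_const e).
apply mean2C_dom.
- apply ccont_minus; apply ccont_mult; auto using ccont_char2.
- apply cont2_const.
- intros x y; replace (_ - _)%C with ((f x y - g x y) * char2 (- m1) (- m2) x y)%C by ring.
  rewrite Cmod_mult, Cmod_char2, Rmult_1_r; auto.
Qed.

(** The coefficients of a product with a trigonometric polynomial are finite convolutions, and these
    pass to the limit by uniform convergence. The result is stated for convolutions that are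
    eventually constant: in every application at most one term is nonzero. *)
Lemma ccoef_series_mult M a f K m1 m2 c N0 :
  qdecay M a -> ccont f -> (forall x y, Cmod (f x y) <= K) ->
  (forall N, (N0 <= N)%nat -> bsum (fun j1 j2 => a j1 j2 * ccoef f (m1 - j1) (m2 - j2))%C N = c) ->
  ccoef (fun x y => fourier_series a x y * f x y)%C m1 m2 = c.
Proof.
intros Ha Hf HK Hc; apply C_eq_small; intros e He.
assert (K0 : 0 <= K) by (eapply Rle_trans; [apply Cmod_ge_0|apply (HK 0 0)]).
assert (HM := qdecay_ge_0 M a Ha).
assert (T : is_lim_seq (fun N => 2 * (2 * M * wtail N * K)) 0).
{ replace (Finite 0) with (Finite (2 * (2 * M * 0 * K))) by (f_equal; ring).
  repeat first [apply wtail_lim | apply is_lim_seq_const | apply is_lim_seq_mult']. }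
apply is_lim_seq_spec in T; destruct (T (mkposreal e He)) as [N1 HN].
set (N := max N0 N1).
assert (B := HN N (Nat.le_max_r _ _)); simpl in B; rewrite Rminus_0_r in B.
rewrite <- (Hc N) by apply Nat.le_max_l.
rewrite <- ccoef_fpart_mult by auto.
eapply Rle_trans; [|left; eapply Rle_lt_trans; [apply Rle_abs|exact B]].
apply ccoef_uniform.
- apply ccont_mult; auto; apply (ccont_series M); auto.
- apply ccont_mult; auto; apply ccont_fpart.
- intros x y.
  replace (_ - _)%C with ((fourier_series a x y - fpart a N x y) * f x y)%C by ring.
  rewrite Cmod_mult; apply Rmult_le_compat; auto using Cmod_ge_0.
  apply fpart_err; auto.
Qed.

(** * Fourier series of real functions *)

Lemma periodic_Z {T : Type} (f : R -> T) (p : R) : (forall x, f (x + p) = f x) ->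
  forall (n : Z) x, f (x + IZR n * p) = f x.
Proof.
intros H.
assert (N : forall (n : nat) x, f (x + INR n * p) = f x).
{ induction n; intros x.
  - simpl; f_equal; ring.
  - rewrite S_INR; replace (x + (INR n + 1) * p) with ((x + INR n * p) + p) by ring.
    now rewrite H. }
intros n x; destruct (Z_le_gt_dec 0 n) as [L|L].
- rewrite <- (Z2Nat.id n) by auto; rewrite <- INR_IZR_INZ; apply N.
- rewrite <- (N (Z.to_nat (- n)) (x + IZR n * p)).
  rewrite INR_IZR_INZ, Z2Nat.id by lia; rewrite opp_IZR; f_equal; ring.
Qed.

Lemma char2_period j1 j2 (n1 n2 : Z) x y :
  char2 j1 j2 (x + IZR n1 * (2 * PI)) (y + IZR n2 * (2 * PI)) = char2 j1 j2 x y.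
Proof.
unfold char2.
replace (IZR j1 * (x + IZR n1 * (2 * PI)) + IZR j2 * (y + IZR n2 * (2 * PI)))
  with (IZR j1 * x + IZR j2 * y + IZR (j1 * n1 + j2 * n2) * (2 * PI))
  by (rewrite plus_IZR, !mult_IZR; ring).
f_equal; apply periodic_Z; intros t.
- rewrite cos_plus, cos_2PI, sin_2PI; ring.
- rewrite sin_plus, cos_2PI, sin_2PI; ring.
Qed.

Lemma series_shift a x y s r :
  fourier_series a (x + s) (y + r) = fourier_series (fun j1 j2 => a j1 j2 * char2 j1 j2 s r)%C x y.
Proof.
unfold fourier_series; f_equal; apply fun2_ext; intros j1 j2; rewrite char2_shift; ring.
Qed.

Lemma series_lin Ma Mb a b (c d : C) x y : qdecay Ma a -> qdecay Mb b ->
  fourier_series (fun j1 j2 => c * a j1 j2 + d * b j1 j2)%C x y =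
  (c * fourier_series a x y + d * fourier_series b x y)%C.
Proof.
intros Ha Hb; apply C_eq_small; intros e He.
assert (HM : qdecay (Cmod c * Ma + Cmod d * Mb) (fun j1 j2 => c * a j1 j2 + d * b j1 j2)%C).
{ intros j1 j2; eapply Rle_trans; [apply Cmod_triangle|]; rewrite !Cmod_mult, Rmult_plus_distr_r.
  rewrite !Rmult_assoc; apply Rplus_le_compat; apply Rmult_le_compat_l; auto using Cmod_ge_0. }
destruct (wtail_small (2 * (Cmod c * Ma + Cmod d * Mb)) e He) as [N HN].
set (ab := fun j1 j2 => _) in *.
assert (E : fpart ab N x y = (c * fpart a N x y + d * fpart b N x y)%C).
{ unfold fpart.
  rewrite (bsum_morph (G := C_AbelianMonoid) (H := C_AbelianMonoid) (fun z : C => c * z)%C).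
  2: intros; unfold plus; simpl; ring.
  rewrite (bsum_morph (G := C_AbelianMonoid) (H := C_AbelianMonoid) (fun z : C => d * z)%C).
  2: intros; unfold plus; simpl; ring.
  unfold bsum; rewrite <- (zsum_plus (G := C_AbelianMonoid)); apply zsum_ext; intros j1.
  rewrite <- (zsum_plus (G := C_AbelianMonoid)); apply zsum_ext; intros j2.
  unfold ab, plus; simpl; ring. }
replace (fourier_series ab x y - (c * fourier_series a x y + d * fourier_series b x y))%C
  with ((fourier_series ab x y - fpart ab N x y)
        + (- c * (fourier_series a x y - fpart a N x y)
           + - d * (fourier_series b x y - fpart b N x y)))%C by (rewrite E; ring).
eapply Rle_trans; [apply Cmod_triangle|].
eapply Rle_trans; [apply Rplus_le_compat_l, Cmod_triangle|].
rewrite !Cmod_mult, !Cmod_opp.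
assert (A1 := fpart_err _ _ N x y HM).
assert (A2 := Rmult_le_compat_l _ _ _ (Cmod_ge_0 c) (fpart_err _ _ N x y Ha)).
assert (A3 := Rmult_le_compat_l _ _ _ (Cmod_ge_0 d) (fpart_err _ _ N x y Hb)).
lra.
Qed.

Definition rser (a : Z -> Z -> C) (x y : R) : R := Re (fourier_series a x y).

Definition herm (a : Z -> Z -> C) : Prop := forall j1 j2, a (- j1)%Z (- j2)%Z = Cconj (a j1 j2).

(** Reversing the indices maps each square to itself and conjugates each term, so all partial sums
    are real. *)
Lemma series_herm a x y : herm a -> fourier_series a x y = RtoC (rser a x y).
Proof.
intros H; apply C_ext; [reflexivity|].
unfold fourier_series, Csum2; simpl.
rewrite (Lim_seq_ext _ (fun _ => 0)); [now rewrite Lim_seq_const|].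
intros N.
change (Im (fpart a N x y) = 0).
assert (E : Cconj (fpart a N x y) = fpart a N x y).
{ unfold fpart.
  rewrite <- (bsum_opp_index (G := C_AbelianMonoid)) at 2.
  rewrite (bsum_morph (G := C_AbelianMonoid) (H := C_AbelianMonoid) Cconj).
  2: { intros u v; unfold plus; simpl; apply C_ext; simpl; ring. }
  apply bsum_ext; intros j1 j2; rewrite H, char2_conj; apply C_ext; simpl; ring. }
apply (f_equal Im) in E; simpl in E.
change (- Im (fpart a N x y) = Im (fpart a N x y)) in E; lra.
Qed.

Lemma RInt_cos_period (j : Z) phi : j <> 0%Z ->
  RInt (fun t => cos (IZR j * t + phi)) 0 (2 * PI) = 0.
Proof.
intros Hj.
assert (J : IZR j <> 0) by (apply not_0_IZR; auto).
apply is_RInt_unique.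
replace 0 with (minus (sin (IZR j * (2 * PI) + phi) / IZR j) (sin (IZR j * 0 + phi) / IZR j)) at 2.
- apply (is_RInt_derive (V := R_CompleteNormedModule)
           (fun t => sin (IZR j * t + phi) / IZR j) (fun t => cos (IZR j * t + phi))).
  + intros t _; auto_derive; auto; field; auto.
  + intros t _; apply (continuity_pt_filterlim (fun t => cos (IZR j * t + phi))).
    apply derivable_continuous_pt; reg.
- unfold minus, plus, opp; simpl.
  replace (IZR j * (2 * PI) + phi) with (phi + IZR j * (2 * PI)) by ring.
  rewrite (periodic_Z sin).
  + rewrite Rmult_0_r, Rplus_0_l; ring.
  + intros t; rewrite sin_plus, cos_2PI, sin_2PI; ring.
Qed.

(** The free phase lets the cosine case contain the sine case, through [phi = - (PI / 2)]. *)
Lemma mean2_cos (j1 j2 : Z) phi : (j1, j2) <> (0, 0)%Z ->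
  mean2 (fun x y => cos (IZR j1 * x + IZR j2 * y + phi)) = 0.
Proof.
intros H; unfold mean2.
destruct (Z.eq_dec j2 0) as [->|E2].
- rewrite (RInt_ext _ (fun x => scal (2 * PI) (cos (IZR j1 * x + phi)))).
  + etransitivity; [apply f_equal, (RInt_scal (V := R_CompleteNormedModule) (fun x => cos (IZR j1 * x + phi)) 0 (2 * PI) (2 * PI))|].
    2: rewrite RInt_cos_period; [unfold scal; simpl; unfold mult; simpl; ring|congruence].
    apply ex_RInt_cont, (cont2_x (fun x y => cos (IZR j1 * x + y))).
    apply (cont2_comp1 cos); [apply continuity_cos|].
    apply cont2_plus; [apply cont2_mult; auto using cont2_const, cont2_fst|apply cont2_snd].
  + intros x _.
    rewrite (RInt_ext _ (fun _ => cos (IZR j1 * x + phi))).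
    * rewrite RInt_const; unfold scal; simpl; unfold mult; simpl; ring.
    * intros y _; f_equal; ring.
- rewrite (RInt_ext _ (fun _ => 0)).
  + rewrite RInt_const; unfold scal; simpl; unfold mult; simpl; ring.
  + intros x _.
    rewrite (RInt_ext _ (fun y => cos (IZR j2 * y + (IZR j1 * x + phi)))).
    * apply RInt_cos_period; auto.
    * intros y _; f_equal; ring.
Qed.

Lemma mean2C_char2 j1 j2 : mean2C (char2 j1 j2) = if Z.eq_dec j1 0 then if Z.eq_dec j2 0 then RtoC 1 else RtoC 0 else RtoC 0.
Proof.
assert (G : (j1, j2) <> (0, 0)%Z -> mean2C (char2 j1 j2) = RtoC 0).
{ intros H; apply C_ext; unfold mean2C, char2; simpl.
  - rewrite <- (mean2_cos j1 j2 0 H); f_equal; apply fun2_ext; intros; now rewrite Rplus_0_r.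
  - rewrite <- (mean2_cos j1 j2 (- (PI / 2)) H); f_equal; apply fun2_ext; intros.
    rewrite cos_plus, cos_neg, sin_neg, cos_PI2, sin_PI2; ring. }
destruct (Z.eq_dec j1 0) as [->|]; [|apply G; congruence].
destruct (Z.eq_dec j2 0) as [->|]; [|apply G; congruence].
replace (char2 0 0) with (fun _ _ : R => RtoC 1).
- unfold mean2C; simpl; rewrite !mean2_const; reflexivity.
- apply fun2_ext; intros; now rewrite char2_0.
Qed.

Lemma ccoef_one m1 m2 : ccoef (fun _ _ => RtoC 1) m1 m2 =
  if Z.eq_dec m1 0 then if Z.eq_dec m2 0 then RtoC 1 else RtoC 0 else RtoC 0.
Proof.
unfold ccoef.
replace (fun x y => RtoC 1 * char2 (- m1) (- m2) x y)%C with (char2 (- m1) (- m2)).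
- rewrite mean2C_char2.
  destruct (Z.eq_dec m1 0), (Z.eq_dec (- m1) 0), (Z.eq_dec m2 0), (Z.eq_dec (- m2) 0); auto; lia.
- apply fun2_ext; intros; ring.
Qed.

(** This is the product formula with [f = 1]: the convolution reduces to one term as soon as the
    square contains [(m1, m2)]. *)
Lemma ccoef_series M a m1 m2 : qdecay M a -> ccoef (fourier_series a) m1 m2 = a m1 m2.
Proof.
intros H.
replace (fourier_series a) with (fun x y => fourier_series a x y * RtoC 1)%C
  by (apply fun2_ext; intros; ring).
apply (ccoef_series_mult M _ _ 1 _ _ _ (Z.to_nat (Z.max (Z.abs m1) (Z.abs m2)))); auto.
- apply ccont_const.
- intros; rewrite Cmod_1; lra.
- intros N HN; rewrite (bsum_delta m1 m2); try lia.
  + rewrite ccoef_one, !Z.sub_diag; simpl; ring.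
  + intros j1 j2 E; rewrite ccoef_one.
    destruct (Z.eq_dec (m1 - j1) 0), (Z.eq_dec (m2 - j2) 0); unfold zero; simpl; try ring.
    destruct E; f_equal; lia.
Qed.

Lemma fcoef_ccoef u m1 m2 : fcoef u m1 m2 = ccoef (fun x y => RtoC (u x y)) m1 m2.
Proof. reflexivity. Qed.

Lemma fcoef_rser M a : qdecay M a -> herm a -> fcoef (rser a) = a.
Proof.
intros H Ha; apply fun2_ext; intros m1 m2; rewrite fcoef_ccoef.
rewrite <- (ccoef_series M a m1 m2 H); f_equal.
apply fun2_ext; intros; symmetry; apply series_herm; auto.
Qed.

Lemma cont2_rser M a : qdecay M a -> cont2 (rser a).
Proof. intros H; apply (ccont_series M a H). Qed.

Lemma torus_fun_rser M a : qdecay M a -> torus_fun (rser a).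
Proof.
intros H x y; split; [|split; [|apply (cont2_rser M a H)]]; unfold rser, fourier_series.
- f_equal; f_equal; apply fun2_ext; intros; f_equal.
  rewrite <- (char2_period x0 y0 1 0 x y); f_equal; ring.
- f_equal; f_equal; apply fun2_ext; intros; f_equal.
  rewrite <- (char2_period x0 y0 0 1 x y); f_equal; ring.
Qed.

Lemma summable2_qdecay M a : qdecay M a -> summable2 a.
Proof.
intros H; exists (M * 25); intros N.
eapply Rle_trans; [apply (bsum_le_scal _ (fun j1 j2 => / wt j1 j2) M N H)|].
apply Rmult_le_compat_l; [apply (qdecay_ge_0 M a H)|apply wsum_le].
Qed.

Lemma torus_abs_rser M a : qdecay M a -> herm a -> torus_abs (rser a).
Proof.
intros H Ha; split; [apply (torus_fun_rser M a H)|].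
rewrite (fcoef_rser M a) by auto; apply (summable2_qdecay M a H).
Qed.

(** * Fourier multipliers and rapidly decreasing coefficients *)

Definition hmul (k : R) (a : Z -> Z -> C) (j1 j2 : Z) : C :=
  (- Ci * RtoC (sign (IZR j1 + IZR j2 * k)) * a j1 j2)%C.

Lemma torus_H_rser k M a : qdecay M a -> herm a -> torus_H k (rser a) = rser (hmul k a).
Proof.
intros H Ha; apply fun2_ext; intros x y; unfold torus_H.
rewrite (fcoef_rser M a); auto.
Qed.

Lemma mean2_rser M a : qdecay M a -> herm a -> mean2 (rser a) = Re (a 0 0)%Z.
Proof.
intros H Ha; replace (a 0%Z 0%Z) with (fcoef (rser a) 0 0) by now rewrite (fcoef_rser M).
change (mean2 (rser a) = mean2 (fun x y => Re (RtoC (rser a x y) * char2 0 0 x y)%C)).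
f_equal; apply fun2_ext; intros x y.
rewrite char2_0; simpl; ring.
Qed.

(** Unlike [qdecay], this condition is stable under multipliers of polynomial growth, hence under
    any number of derivatives. *)
Definition rapid (a : Z -> Z -> C) : Prop :=
  forall p : nat, exists M, forall j1 j2, Cmod (a j1 j2) * wt j1 j2 ^ p <= M.

Lemma rapid_qdecay a : rapid a -> exists M, qdecay M a.
Proof.
intros H; destruct (H 1%nat) as [M HM]; exists M; intros j1 j2.
assert (W := wt_ge_1 j1 j2).
apply Rmult_le_reg_r with (wt j1 j2); [lra|].
rewrite Rmult_assoc, Rinv_l by lra; specialize (HM j1 j2); simpl in HM; lra.
Qed.

(** A multiplier bounded by the weight costs one power of the weight, which is paid by the estimate
    for [S p]. *)
Lemma rapid_mul (mu : Z -> Z -> C) K a : (forall j1 j2, Cmod (mu j1 j2) <= K * wt j1 j2) ->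
  rapid a -> rapid (fun j1 j2 => mu j1 j2 * a j1 j2)%C.
Proof.
intros Hm H p; destruct (H (S p)) as [M HM].
assert (HK : 0 <= K).
{ generalize (Hm 0%Z 0%Z) (Cmod_ge_0 (mu 0%Z 0%Z)) (wt_ge_1 0 0); intros.
  destruct (Rle_lt_dec 0 K); auto; nra. }
exists (K * M); intros j1 j2.
assert (W := wt_ge_1 j1 j2).
rewrite Cmod_mult.
apply Rle_trans with (K * wt j1 j2 * Cmod (a j1 j2) * wt j1 j2 ^ p).
- apply Rmult_le_compat_r; [apply pow_le; lra|].
  apply Rmult_le_compat_r; auto using Cmod_ge_0.
- specialize (HM j1 j2); simpl in HM.
  replace (K * wt j1 j2 * Cmod (a j1 j2) * wt j1 j2 ^ p) with
   (K * (Cmod (a j1 j2) * (wt j1 j2 * wt j1 j2 ^ p))) by ring.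
  apply Rmult_le_compat_l; auto.
Qed.

Lemma rapid_mul_bdd (mu : Z -> Z -> C) K a : (forall j1 j2, Cmod (mu j1 j2) <= K) ->
  rapid a -> rapid (fun j1 j2 => mu j1 j2 * a j1 j2)%C.
Proof.
intros Hm; apply (rapid_mul _ K); intros j1 j2.
eapply Rle_trans; [apply Hm|].
assert (0 <= K) by (eapply Rle_trans; [apply Cmod_ge_0|apply (Hm 0 0)%Z]).
generalize (wt_ge_1 j1 j2); nra.
Qed.

Lemma Rabs_j1_le_wt j1 j2 : Rabs (IZR j1) <= wt j1 j2.
Proof.
unfold wt; apply Rabs_le; generalize (pow2_ge_0 (IZR j1)) (pow2_ge_0 (IZR j2)).
intros; assert (1 + IZR j1 ^ 2 <= (1 + IZR j1 ^ 2) * (1 + IZR j2 ^ 2)) by nra.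
generalize (pow2_ge_0 (IZR j1 - 1)) (pow2_ge_0 (IZR j1 + 1)); nra.
Qed.

Lemma Rabs_j2_le_wt j1 j2 : Rabs (IZR j2) <= wt j1 j2.
Proof. replace (wt j1 j2) with (wt j2 j1) by (unfold wt; ring); apply Rabs_j1_le_wt. Qed.

Definition idx1 (a : Z -> Z -> C) (j1 j2 : Z) : C := (Ci * RtoC (IZR j1) * a j1 j2)%C.
Definition idx2 (a : Z -> Z -> C) (j1 j2 : Z) : C := (Ci * RtoC (IZR j2) * a j1 j2)%C.
Definition dmul (k : R) (a : Z -> Z -> C) (j1 j2 : Z) : C :=
  (Ci * RtoC (IZR j1 + IZR j2 * k) * a j1 j2)%C.

Lemma rapid_idx1 a : rapid a -> rapid (idx1 a).
Proof.
apply (rapid_mul _ 1); intros j1 j2.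
rewrite Cmod_mult, Cmod_Ci, Cmod_R, !Rmult_1_l; apply Rabs_j1_le_wt.
Qed.

Lemma rapid_idx2 a : rapid a -> rapid (idx2 a).
Proof.
apply (rapid_mul _ 1); intros j1 j2.
rewrite Cmod_mult, Cmod_Ci, Cmod_R, !Rmult_1_l; apply Rabs_j2_le_wt.
Qed.

Lemma Rabs_l_le_wt k j1 j2 : Rabs (IZR j1 + IZR j2 * k) <= (1 + Rabs k) * wt j1 j2.
Proof.
eapply Rle_trans; [apply Rabs_triang|]; rewrite Rabs_mult.
generalize (Rabs_j1_le_wt j1 j2) (Rabs_j2_le_wt j1 j2) (Rabs_pos k); nra.
Qed.

Lemma rapid_dmul k a : rapid a -> rapid (dmul k a).
Proof.
apply (rapid_mul _ (1 + Rabs k)); intros j1 j2.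
rewrite Cmod_mult, Cmod_Ci, Cmod_R, !Rmult_1_l; apply Rabs_l_le_wt.
Qed.

Lemma Rabs_sign_le x : Rabs (sign x) <= 1.
Proof.
destruct (total_order_T x 0) as [[H|H]|H].
- rewrite sign_eq_m1 by auto; unfold Rabs; destruct (Rcase_abs _); lra.
- rewrite H, sign_0, Rabs_R0; lra.
- rewrite sign_eq_1 by auto; rewrite Rabs_R1; lra.
Qed.

Lemma Cmod_hfac_le k j1 j2 : Cmod (- Ci * RtoC (sign (IZR j1 + IZR j2 * k)))%C <= 1.
Proof.
rewrite Cmod_mult, Cmod_opp, Cmod_Ci, Cmod_R, Rmult_1_l; apply Rabs_sign_le.
Qed.

Lemma rapid_hmul k a : rapid a -> rapid (hmul k a).
Proof. apply (rapid_mul_bdd _ 1); intros; apply Cmod_hfac_le. Qed.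

Lemma qdecay_hmul k M a : qdecay M a -> qdecay M (hmul k a).
Proof.
intros H j1 j2; unfold hmul; rewrite Cmod_mult; eapply Rle_trans; [|apply H].
generalize (Cmod_hfac_le k j1 j2) (Cmod_ge_0 (a j1 j2)); nra.
Qed.

Lemma herm_dmul k a : herm a -> herm (dmul k a).
Proof. intros H j1 j2; unfold dmul; rewrite H, !opp_IZR; apply C_ext; simpl; ring. Qed.
Lemma herm_hmul k a : herm a -> herm (hmul k a).
Proof.
intros H j1 j2; unfold hmul; rewrite H, !opp_IZR.
replace (- IZR j1 + - IZR j2 * k) with (- (IZR j1 + IZR j2 * k)) by ring.
rewrite sign_opp; apply C_ext; simpl; ring.
Qed.

(** * Regularity, translations and restrictions to lines *)

Lemma derivable_zsum (F F' : Z -> R -> R) N s :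
  (forall j, derivable_pt_lim (F j) s (F' j s)) ->
  derivable_pt_lim (fun s => zsum (fun j => F j s) N) s (zsum (fun j => F' j s) N).
Proof.
intros H; apply is_derive_Reals; induction N.
- rewrite zsum_0; apply (is_derive_ext (F 0%Z)); [intros; now rewrite zsum_0|].
  apply is_derive_Reals, H.
- rewrite zsum_S.
  apply (is_derive_ext (fun s => plus (zsum (fun j => F j s) N)
    (plus (F (Z.of_nat (S N)) s) (F (- Z.of_nat (S N))%Z s)))); [intros; now rewrite zsum_S|].
  apply (is_derive_plus (V := R_NormedModule)); [exact IHN|].
  apply (is_derive_plus (V := R_NormedModule)); apply is_derive_Reals, H.
Qed.

Lemma derivable_Re_char2 (c : C) j1 j2 x y p q s :
  derivable_pt_lim (fun s => Re (c * char2 j1 j2 (x + p * s) (y + q * s))%C) s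
    (Re (Ci * RtoC (IZR j1 * p + IZR j2 * q) * c * char2 j1 j2 (x + p * s) (y + q * s))%C).
Proof.
apply is_derive_Reals; unfold char2; simpl.
auto_derive; auto; ring.
Qed.

(** Termwise differentiation is legitimate because the differentiated partial sums converge
    uniformly along the line, the truncation error being independent of the point. *)
Lemma series_derive_dir Ma M a p q x y s :
  qdecay Ma a ->
  qdecay M (fun j1 j2 => Ci * RtoC (IZR j1 * p + IZR j2 * q) * a j1 j2)%C ->
  derivable_pt_lim (fun s => rser a (x + p * s) (y + q * s)) s
    (rser (fun j1 j2 => Ci * RtoC (IZR j1 * p + IZR j2 * q) * a j1 j2)%C (x + p * s) (y + q * s)).
Proof.
intros Ha Hb; set (b := fun j1 j2 => _) in *.
apply (Ranalysis5.derivable_pt_lim_CVU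
  (fun N s => Re (fpart a N (x + p * s) (y + q * s)))
  (fun N s => Re (fpart b N (x + p * s) (y + q * s)))
  (fun s => rser a (x + p * s) (y + q * s))
  (fun s => rser b (x + p * s) (y + q * s)) s s (mkposreal 1 Rlt_0_1)).
- unfold Boule; simpl; rewrite Rminus_diag, Rabs_R0; lra.
- intros t N _; unfold fpart.
  assert (E : forall c s, Re (bsum (fun j1 j2 => c j1 j2 * char2 j1 j2 (x + p * s) (y + q * s))%C N)
     = bsum (fun j1 j2 => Re (c j1 j2 * char2 j1 j2 (x + p * s) (y + q * s))%C) N).
  { intros c s'; apply (bsum_morph (G := C_AbelianMonoid) (H := R_AbelianMonoid) Re), Re_plus. }
  rewrite E; apply is_derive_Reals.
  eapply is_derive_ext; [intros; symmetry; apply E|]; apply is_derive_Reals.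
  apply (derivable_zsum (fun j1 s => zsum (fun j2 => Re (a j1 j2 * char2 j1 j2 (x + p * s) (y + q * s))%C) N)
    (fun j1 s => zsum (fun j2 => Re (b j1 j2 * char2 j1 j2 (x + p * s) (y + q * s))%C) N)).
  intros j1; apply (derivable_zsum (fun j2 s => Re (a j1 j2 * char2 j1 j2 (x + p * s) (y + q * s))%C)
    (fun j2 s => Re (b j1 j2 * char2 j1 j2 (x + p * s) (y + q * s))%C)).
  intros j2; apply derivable_Re_char2.
- intros t _.
  apply is_lim_seq_Reals, (Csum2_spec _ _ (qdecay_char2 Ma a (x + p * t) (y + q * t) Ha)).
- intros e He.
  assert (T : is_lim_seq (fun N => 2 * M * wtail N) 0).
  { replace (Finite 0) with (Finite (2 * M * 0)) by (f_equal; ring).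
    apply is_lim_seq_mult'; [apply is_lim_seq_const|apply wtail_lim]. }
  apply is_lim_seq_spec in T; destruct (T (mkposreal e He)) as [N HN].
  exists N; intros n t Hn _.
  specialize (HN n Hn); simpl in HN; rewrite Rminus_0_r in HN.
  eapply Rle_lt_trans; [|eapply Rle_lt_trans; [apply Rle_abs|exact HN]].
  eapply Rle_trans; [|apply (fpart_err M b n (x + p * t) (y + q * t) Hb)].
  apply (re_le_Cmod (_ - _)%C).
- intros t _; apply (cont2_line (rser b)), (cont2_rser M); auto.
Qed.

Lemma series_d1 a (x y : R) : rapid a -> is_derive (fun x => rser a x y) x (rser (idx1 a) x y).
Proof.
intros H.
destruct (rapid_qdecay a H) as [Ma HMa].
destruct (rapid_qdecay _ (rapid_idx1 a H)) as [M HM].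
assert (E : idx1 a = (fun j1 j2 => Ci * RtoC (IZR j1 * 1 + IZR j2 * 0) * a j1 j2)%C).
{ apply fun2_ext; intros; unfold idx1; now rewrite Rmult_0_r, Rplus_0_r, Rmult_1_r. }
rewrite E in HM |- *.
assert (K := series_derive_dir Ma M a 1 0 0 y x HMa HM).
replace (0 + 1 * x) with x in K by ring; replace (y + 0 * x) with y in K by ring.
apply is_derive_Reals in K.
assert (X : forall t : R, rser a (0 + 1 * t) (y + 0 * t) = rser a t y) by (intros; f_equal; ring).
apply (is_derive_ext _ _ _ _ X K).
Qed.

Lemma series_d2 a (x y : R) : rapid a -> is_derive (fun y => rser a x y) y (rser (idx2 a) x y).
Proof.
intros H.
destruct (rapid_qdecay a H) as [Ma HMa].
destruct (rapid_qdecay _ (rapid_idx2 a H)) as [M HM].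
assert (E : idx2 a = (fun j1 j2 => Ci * RtoC (IZR j1 * 0 + IZR j2 * 1) * a j1 j2)%C).
{ apply fun2_ext; intros; unfold idx2; now rewrite Rmult_0_r, Rplus_0_l, Rmult_1_r. }
rewrite E in HM |- *.
assert (K := series_derive_dir Ma M a 0 1 x 0 y HMa HM).
replace (x + 0 * y) with x in K by ring; replace (0 + 1 * y) with y in K by ring.
apply is_derive_Reals in K.
assert (X : forall t : R, rser a (x + 0 * t) (0 + 1 * t) = rser a x t) by (intros; f_equal; ring).
apply (is_derive_ext _ _ _ _ X K).
Qed.

Lemma d1_rser a : rapid a -> d1 (rser a) = rser (idx1 a).
Proof. intros H; apply fun2_ext; intros x y; apply is_derive_unique, series_d1, H. Qed.

Lemma d2_rser a : rapid a -> d2 (rser a) = rser (idx2 a).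
Proof. intros H; apply fun2_ext; intros x y; apply is_derive_unique, series_d2, H. Qed.

Lemma rser_lin a b (r s : R) x y : rapid a -> rapid b ->
  rser (fun j1 j2 => RtoC r * a j1 j2 + RtoC s * b j1 j2)%C x y = r * rser a x y + s * rser b x y.
Proof.
intros Ha Hb.
destruct (rapid_qdecay a Ha) as [Ma HMa]; destruct (rapid_qdecay b Hb) as [Mb HMb].
unfold rser; rewrite (series_lin Ma Mb) by auto; simpl; ring.
Qed.

Lemma torus_D_rser k a : rapid a -> torus_D k (rser a) = rser (dmul k a).
Proof.
intros H; apply fun2_ext; intros x y; unfold torus_D.
rewrite d1_rser, d2_rser by auto.
replace (dmul k a) with (fun j1 j2 => RtoC 1 * idx1 a j1 j2 + RtoC k * idx2 a j1 j2)%C.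
- rewrite rser_lin by auto using rapid_idx1, rapid_idx2; ring.
- apply fun2_ext; intros; unfold idx1, idx2, dmul; apply C_ext; simpl; ring.
Qed.

Lemma torus_fun_rapid a : rapid a -> torus_fun (rser a).
Proof. intros H; destruct (rapid_qdecay a H) as [M HM]; apply (torus_fun_rser M); auto. Qed.

Lemma torus_Cn_rser n a : rapid a -> torus_Cn n (rser a).
Proof.
revert a; induction n; intros a H; (split; [now apply torus_fun_rapid|]); auto.
split; [|rewrite d1_rser, d2_rser by auto; split; apply IHn; auto using rapid_idx1, rapid_idx2].
intros x y; split; eexists; [apply series_d1|apply series_d2]; auto.
Qed.

Lemma torus_Cn_fun n u : torus_Cn n u -> torus_fun u.
Proof. destruct n; intros [H _]; exact H. Qed.

Lemma torus_fun_cont2 u : torus_fun u -> cont2 u.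
Proof. intros H x y; apply (H x y). Qed.

Lemma torus_Cn_le n u : torus_Cn (S n) u -> torus_Cn n u.
Proof.
revert u; induction n; intros u [H [H1 [H2 H3]]]; split; auto.
Qed.

Lemma torus_fun_const c : torus_fun (fun _ _ => c).
Proof. intros x y; repeat split; apply continuity_2d_pt_const. Qed.

Lemma torus_fun_plus u v : torus_fun u -> torus_fun v -> torus_fun (fun x y => u x y + v x y).
Proof.
intros Hu Hv x y; destruct (Hu x y) as [A1 [A2 A3]]; destruct (Hv x y) as [B1 [B2 B3]].
rewrite A1, A2, B1, B2; repeat split; apply continuity_2d_pt_plus; auto.
Qed.

Lemma torus_fun_mult u v : torus_fun u -> torus_fun v -> torus_fun (fun x y => u x y * v x y).
Proof.
intros Hu Hv x y; destruct (Hu x y) as [A1 [A2 A3]]; destruct (Hv x y) as [B1 [B2 B3]].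
rewrite A1, A2, B1, B2; repeat split; apply continuity_2d_pt_mult; auto.
Qed.

Lemma torus_fun_inv u : torus_fun u -> (forall x y, u x y <> 0) -> torus_fun (fun x y => / u x y).
Proof.
intros Hu Hn x y; destruct (Hu x y) as [A1 [A2 A3]].
rewrite A1, A2; repeat split; apply continuity_2d_pt_inv; auto.
Qed.

Lemma torus_Cn_const n c : torus_Cn n (fun _ _ => c).
Proof.
revert c; induction n; intros c; (split; [apply torus_fun_const|auto]).
assert (E1 : d1 (fun _ _ => c) = fun _ _ => 0) by (apply fun2_ext; intros; apply (Derive_const c)).
assert (E2 : d2 (fun _ _ => c) = fun _ _ => 0) by (apply fun2_ext; intros; apply (Derive_const c)).
rewrite E1, E2; repeat split; auto; apply (ex_derive_const (V := R_NormedModule)).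
Qed.

Lemma torus_Cn_plus n u v : torus_Cn n u -> torus_Cn n v -> torus_Cn n (fun x y => u x y + v x y).
Proof.
revert u v; induction n; intros u v [Hu Hu'] [Hv Hv']; (split; [apply torus_fun_plus; auto|auto]).
destruct Hu' as [Du [Hu1 Hu2]]; destruct Hv' as [Dv [Hv1 Hv2]].
assert (E1 : d1 (fun x y => u x y + v x y) = fun x y => d1 u x y + d1 v x y).
{ apply fun2_ext; intros x y; apply (Derive_plus (fun x => u x y) (fun x => v x y));
  [apply (Du x y)|apply (Dv x y)]. }
assert (E2 : d2 (fun x y => u x y + v x y) = fun x y => d2 u x y + d2 v x y).
{ apply fun2_ext; intros x y; apply (Derive_plus (fun y => u x y) (fun y => v x y));
  [apply (Du x y)|apply (Dv x y)]. }
rewrite E1, E2; split; auto.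
intros x y; destruct (Du x y), (Dv x y); split;
  apply (ex_derive_plus (V := R_NormedModule)); auto.
Qed.

Lemma torus_Cn_mult n u v : torus_Cn n u -> torus_Cn n v -> torus_Cn n (fun x y => u x y * v x y).
Proof.
revert u v; induction n; intros u v Hu0 Hv0;
  assert (Hu1 := Hu0); assert (Hv1 := Hv0); destruct Hu0 as [Hu Hu']; destruct Hv0 as [Hv Hv'];
  (split; [apply torus_fun_mult; auto|auto]).
apply torus_Cn_le in Hu1; apply torus_Cn_le in Hv1.
destruct Hu' as [Du [Hdu1 Hdu2]]; destruct Hv' as [Dv [Hdv1 Hdv2]].
assert (E1 : d1 (fun x y => u x y * v x y) = fun x y => d1 u x y * v x y + u x y * d1 v x y).
{ apply fun2_ext; intros x y; apply (Derive_mult (fun x => u x y) (fun x => v x y));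
  [apply (Du x y)|apply (Dv x y)]. }
assert (E2 : d2 (fun x y => u x y * v x y) = fun x y => d2 u x y * v x y + u x y * d2 v x y).
{ apply fun2_ext; intros x y; apply (Derive_mult (fun y => u x y) (fun y => v x y));
  [apply (Du x y)|apply (Dv x y)]. }
rewrite E1, E2; split.
- intros x y; destruct (Du x y), (Dv x y); split; apply ex_derive_mult; auto.
- split; apply torus_Cn_plus; auto.
Qed.

Lemma torus_Cn_scal n c u : torus_Cn n u -> torus_Cn n (fun x y => c * u x y).
Proof. apply (torus_Cn_mult n (fun _ _ => c)), torus_Cn_const. Qed.

Lemma torus_Cn_inv n u : torus_Cn n u -> (forall x y, u x y <> 0) -> torus_Cn n (fun x y => / u x y).
Proof.
revert u; induction n; intros u Hu0 Hn; assert (Hu1 := Hu0); destruct Hu0 as [Hu Hu'];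
  (split; [apply torus_fun_inv; auto|auto]).
apply torus_Cn_le in Hu1.
destruct Hu' as [Du [Hdu1 Hdu2]].
assert (E1 : d1 (fun x y => / u x y) = fun x y => -1 * (d1 u x y * (/ u x y * / u x y))).
{ apply fun2_ext; intros x y; unfold d1.
  rewrite (Derive_inv (fun x => u x y)); [field; auto|apply (Du x y)|auto]. }
assert (E2 : d2 (fun x y => / u x y) = fun x y => -1 * (d2 u x y * (/ u x y * / u x y))).
{ apply fun2_ext; intros x y; unfold d2.
  rewrite (Derive_inv (fun y => u x y)); [field; auto|apply (Du x y)|auto]. }
rewrite E1, E2; split.
- intros x y; destruct (Du x y); split; apply ex_derive_inv; auto.
- split; apply torus_Cn_scal; repeat apply torus_Cn_mult; auto.
Qed.

(** * Translations of torus functions and derivatives along lines *)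

Definition tshift (s r : R) (u : R -> R -> R) (x y : R) : R := u (x - s) (y - r).

Lemma torus_fun_shift s r u : torus_fun u -> torus_fun (tshift s r u).
Proof.
intros Hu x y; unfold tshift; destruct (Hu (x - s) (y - r)) as [A1 [A2 A3]].
split; [|split].
- rewrite <- A1; f_equal; ring.
- rewrite <- A2; f_equal; ring.
- intros e; destruct (A3 e) as [d Hd]; exists d; intros a b Ha Hb; apply Hd.
  + replace (a - s - (x - s)) with (a - x) by ring; auto.
  + replace (b - r - (y - r)) with (b - y) by ring; auto.
Qed.

Lemma is_derive_shift (f : R -> R) (s x l : R) : is_derive f (x - s) l -> is_derive (fun x => f (x - s)) x l.
Proof.
intros H; replace l with (scal 1 l) by (unfold scal; simpl; unfold mult; simpl; ring).
apply (is_derive_comp f (fun x => x - s)); auto.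
auto_derive; auto; ring.
Qed.

Lemma Derive_shift (f : R -> R) (s x : R) : Derive (fun x => f (x - s)) x = Derive f (x - s).
Proof.
unfold Derive; f_equal; apply Lim_ext; intros h.
now replace (x + h - s) with (x - s + h) by ring.
Qed.

Lemma d1_shift s r u : d1 (tshift s r u) = tshift s r (d1 u).
Proof. apply fun2_ext; intros x y; apply (Derive_shift (fun x => u x (y - r))). Qed.

Lemma d2_shift s r u : d2 (tshift s r u) = tshift s r (d2 u).
Proof. apply fun2_ext; intros x y; apply (Derive_shift (fun y => u (x - s) y)). Qed.

Lemma torus_D_shift k s r u : torus_D k (tshift s r u) = tshift s r (torus_D k u).
Proof. apply fun2_ext; intros x y; unfold torus_D; rewrite d1_shift, d2_shift; reflexivity. Qed.

Lemma torus_Cn_shift n s r u : torus_Cn n u -> torus_Cn n (tshift s r u).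
Proof.
revert u; induction n; intros u [Hu Hu']; (split; [apply torus_fun_shift; auto|auto]).
destruct Hu' as [Du [H1 H2]]; rewrite d1_shift, d2_shift; split; auto.
intros x y; destruct (Du (x - s) (y - r)) as [[l1 D1] [l2 D2]]; split.
- exists l1; apply (is_derive_shift (fun x => u x (y - r))), D1.
- exists l2; apply (is_derive_shift (fun y => u (x - s) y)), D2.
Qed.

Lemma rser_shift s r a : tshift s r (rser a) = rser (fun j1 j2 => a j1 j2 * char2 j1 j2 (- s) (- r))%C.
Proof.
apply fun2_ext; intros x y; unfold tshift, rser.
rewrite <- series_shift; reflexivity.
Qed.

Lemma herm_shift s r a : herm a -> herm (fun j1 j2 => a j1 j2 * char2 j1 j2 s r)%C.
Proof.
intros H j1 j2; rewrite H, char2_conj; apply C_ext; simpl; ring.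
Qed.

Lemma torus_H_shift k M a s r : qdecay M a -> herm a ->
  torus_H k (tshift s r (rser a)) = tshift s r (torus_H k (rser a)).
Proof.
intros H Ha; rewrite rser_shift, !(torus_H_rser k M), rser_shift;
  auto using qdecay_char2, herm_shift.
f_equal; apply fun2_ext; intros; unfold hmul; ring.
Qed.

Lemma torus_abs_shift M a s r : qdecay M a -> herm a -> torus_abs (tshift s r (rser a)).
Proof.
intros H Ha; rewrite rser_shift; apply (torus_abs_rser M); auto using qdecay_char2, herm_shift.
Qed.

Lemma mean2_shift M a s r : qdecay M a -> herm a -> mean2 (tshift s r (rser a)) = Re (a 0 0)%Z.
Proof.
intros H Ha; rewrite rser_shift, (mean2_rser M); auto using qdecay_char2, herm_shift.
rewrite char2_0; f_equal; ring.
Qed.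

(** Existence of both partial derivatives with [d1 u] continuous makes [u] differentiable as a
    function of two variables, and the chain rule applies in the direction [(p, p k)]. *)
Lemma torus_Cn_line k u (x y p : R) : torus_Cn 1 u ->
  is_derive (fun s => u (x + p * s) (y + p * k * s)) 0 (p * torus_D k u x y).
Proof.
intros [Hu [Du [H1 H2]]].
assert (FD : differentiable_pt_lim u x y (d1 u x y) (d2 u x y)).
{ apply filterdiff_differentiable_pt_lim.
  apply (is_derive_filterdiff u x y (d1 u) (d2 u x y)).
  - exists (mkposreal 1 Rlt_0_1); intros z _; apply Derive_correct, (Du (fst z) (snd z)).
  - apply Derive_correct, (Du x y).
  - apply (proj1 (continuity_2d_pt_filterlim (d1 u) x y)), (torus_fun_cont2 (d1 u)), (proj1 H1). }
apply is_derive_Reals.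
replace (p * torus_D k u x y) with (d1 u x y * p + d2 u x y * (p * k)) by (unfold torus_D; ring).
apply (derivable_pt_lim_comp_2d u (fun s => x + p * s) (fun s => y + p * k * s)).
- rewrite !Rmult_0_r, !Rplus_0_r; auto.
- apply is_derive_Reals; auto_derive; auto; ring.
- apply is_derive_Reals; auto_derive; auto; ring.
Qed.

Lemma torus_D_line k theta u (a : R) : torus_Cn 1 u ->
  is_derive (fun a => u a (theta + k * a)) a (torus_D k u a (theta + k * a)).
Proof.
intros H.
generalize (torus_Cn_line k u a (theta + k * a) 1 H); rewrite !Rmult_1_l; intros K.
replace 0 with (a - a) in K by ring.
generalize (is_derive_shift _ a a _ K).
assert (X : forall t : R, u (a + 1 * (t - a)) (theta + k * a + k * (t - a)) = u t (theta + k * t))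
  by (intros; f_equal; ring).
apply is_derive_ext, X.
Qed.

(** With [n = max (|j1|, |j2|)] the weight is at most [(1 + n) ^ 4], and [1 + x <= exp x] at
    [x = c n / q], raised to the power [q], bounds [(1 + n) ^ q] by a multiple of [exp (c n)]. *)
Lemma exp_decay_rapid (a : Z -> Z -> C) M c : 0 < c ->
  (forall j1 j2, Cmod (a j1 j2) <= M * exp (- (c * IZR (Z.max (Z.abs j1) (Z.abs j2))))) -> rapid a.
Proof.
intros Hc H p.
(* The exponent [4 p] accounts for [wt ^ p]; the [+ 1] makes [q] positive when [p = 0]. *)
set (q := (4 * p + 1)%nat).
assert (Hq : 0 < INR q) by (apply lt_0_INR; unfold q; lia).
(* Both bounds on [d] together give [d (1 + n) <= 1 + c n / q]. *)
set (d := Rmin 1 (c / INR q)).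
assert (Hd : 0 < d) by (apply Rmin_pos; [lra|apply Rdiv_lt_0_compat; auto]).
assert (HM : 0 <= M).
{ generalize (H 0%Z 0%Z) (Cmod_ge_0 (a 0%Z 0%Z)); simpl; rewrite Rmult_0_r, Ropp_0, exp_0; lra. }
exists (M / d ^ q); intros j1 j2; specialize (H j1 j2).
set (n := IZR (Z.max (Z.abs j1) (Z.abs j2))) in *.
assert (N1 : Rabs (IZR j1) <= n) by (rewrite <- abs_IZR; apply IZR_le; lia).
assert (N2 : Rabs (IZR j2) <= n) by (rewrite <- abs_IZR; apply IZR_le; lia).
assert (N0 : 0 <= n) by (eapply Rle_trans; [apply Rabs_pos|exact N1]).
assert (W : wt j1 j2 <= (1 + n) ^ 4).
{ unfold wt; rewrite <- (pow2_abs (IZR j1)), <- (pow2_abs (IZR j2)).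
  replace ((1 + n) ^ 4) with ((1 + n) ^ 2 * (1 + n) ^ 2) by ring.
  generalize (Rabs_pos (IZR j1)) (Rabs_pos (IZR j2)); intros.
  apply Rmult_le_compat; nra. }
assert (E : (d * (1 + n)) ^ q <= exp (c * n)).
{ replace (c * n) with (INR q * (c * n / INR q)) by (field; lra).
  replace (exp (INR q * (c * n / INR q))) with (exp (c * n / INR q) ^ q).
  - apply pow_incr; split; [apply Rmult_le_pos; lra|].
    eapply Rle_trans; [|apply exp_ineq1_le].
    assert (d <= 1) by apply Rmin_l.
    assert (d <= c / INR q) by apply Rmin_r.
    replace (c * n / INR q) with (c / INR q * n) by (field; lra); nra.
  - rewrite <- Rpower_pow by apply exp_pos; unfold Rpower; now rewrite ln_exp. }
rewrite Rpow_mult_distr in E.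
assert (Dq : 0 < d ^ q) by (apply pow_lt; auto).
assert (X : 0 < exp (c * n)) by apply exp_pos.
apply Rle_trans with (M * exp (- (c * n)) * (1 + n) ^ q).
- apply Rmult_le_compat; auto using Cmod_ge_0.
  + apply pow_le; generalize (wt_ge_1 j1 j2); lra.
  + apply Rle_trans with (((1 + n) ^ 4) ^ p).
    * apply pow_incr; split; auto; generalize (wt_ge_1 j1 j2); lra.
    * rewrite <- pow_mult; apply Rle_pow; [lra|unfold q; lia].
- rewrite exp_Ropp; unfold Rdiv; rewrite Rmult_assoc; apply Rmult_le_compat_l; auto.
  apply Rmult_le_reg_l with (exp (c * n)); auto.
  rewrite <- Rmult_assoc, Rinv_r, Rmult_1_l by lra.
  apply Rmult_le_reg_r with (d ^ q); auto.
  rewrite Rmult_assoc, Rinv_l by lra; lra.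
Qed.

(** * Uniqueness of Fourier coefficients *)

(* Coquelicot types equations between integrals in the carrier of a normed module, which
   [ring] does not recognize as [R]. *)
Ltac real_eq := match goal with |- @eq _ ?a ?b => change (@eq R a b) end.

(** Vanishing of all Fourier coefficients over one period in real form: the arbitrary phase covers
    cosines and sines at once. *)
Definition zero_cos (v : R -> R) : Prop :=
  forall (n : Z) phi, RInt (fun x => v x * cos (IZR n * x + phi)) 0 (2 * PI) = 0.

Lemma continuity_cos_affine a b : continuity (fun x => cos (a * x + b)).
Proof. intros x; apply derivable_continuous_pt; reg. Qed.

Lemma continuity_vcos v a b : continuity v -> continuity (fun x => v x * cos (a * x + b)).
Proof. intros H x; apply continuity_pt_mult; [apply H|apply continuity_cos_affine]. Qed.

(** Product-to-sum formulas convert the factor [cos (x - x0)] into the frequencies [n + 1] and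
    [n - 1] with shifted phases, all of which are annihilated by assumption. *)
Lemma zero_cos_mul v x0 : continuity v -> zero_cos v ->
  zero_cos (fun x => v x * (1 + cos (x - x0))).
Proof.
intros Hv H n phi.
assert (E : forall m p, ex_RInt (fun x => v x * cos (IZR m * x + p)) 0 (2 * PI)).
{ intros; apply ex_RInt_cont, continuity_vcos; auto. }
rewrite (RInt_ext _ (fun x => plus (v x * cos (IZR n * x + phi))
   (plus (scal (/ 2) (v x * cos (IZR (n + 1) * x + (phi - x0))))
         (scal (/ 2) (v x * cos (IZR (n - 1) * x + (phi + x0))))))).
- rewrite (RInt_plus (V := R_CompleteNormedModule)).
  2: apply E.
  2: apply (ex_RInt_plus (V := R_NormedModule)); apply (ex_RInt_scal (V := R_NormedModule)), E.
  rewrite (RInt_plus (V := R_CompleteNormedModule)).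
  2, 3: apply (ex_RInt_scal (V := R_NormedModule)), E.
  rewrite !(RInt_scal (V := R_CompleteNormedModule)) by apply E.
  rewrite !H; unfold plus, scal; simpl; unfold mult; simpl; ring.
- intros x _; unfold plus, scal; simpl; unfold mult; simpl.
  rewrite plus_IZR, minus_IZR.
  replace ((IZR n + 1) * x + (phi - x0)) with ((IZR n * x + phi) + (x - x0)) by ring.
  replace ((IZR n - 1) * x + (phi + x0)) with ((IZR n * x + phi) - (x - x0)) by ring.
  generalize (IZR n * x + phi) (x - x0); intros p q.
  rewrite cos_plus, cos_minus; field.
Qed.

Lemma zero_cos_pow v x0 N : continuity v -> zero_cos v ->
  RInt (fun x => v x * (1 + cos (x - x0)) ^ N) 0 (2 * PI) = 0.
Proof.
intros Hv H.
assert (K : continuity (fun x => v x * (1 + cos (x - x0)) ^ N) /\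
            zero_cos (fun x => v x * (1 + cos (x - x0)) ^ N)).
{ induction N as [|N [I1 I2]].
  - replace (fun x => v x * (1 + cos (x - x0)) ^ 0) with v; auto.
    apply functional_extensionality; intros; simpl; ring.
  - replace (fun x => v x * (1 + cos (x - x0)) ^ S N) with
      (fun x => v x * (1 + cos (x - x0)) ^ N * (1 + cos (x - x0))).
    + split; [|apply zero_cos_mul; auto].
      intros x; apply (continuity_pt_mult (fun x => v x * (1 + cos (x - x0)) ^ N)); auto.
      apply derivable_continuous_pt; reg.
    + apply functional_extensionality; intros; simpl; ring. }
destruct K as [_ K]; etransitivity; [|exact (K 0%Z 0)].
apply RInt_ext; intros x _; rewrite Rmult_0_l, Rplus_0_r, cos_0; real_eq; ring.
Qed.

(** The bounds on [x0] also keep [|x - x0|] below [2 PI - d], so the two points are at distance at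
    least [d] on the circle, not just on the interval. *)
Lemma cos_far x x0 d : 0 < d <= 1 -> d <= x0 <= 2 * PI - d -> 0 <= x <= 2 * PI ->
  d <= Rabs (x - x0) -> cos (x - x0) <= cos d.
Proof.
intros Hd H0 Hx H.
assert (P := PI_RGT_0); assert (P2 := PI2_1).
assert (K : Rabs (x - x0) <= 2 * PI - d) by (apply Rabs_le; lra).
replace (cos (x - x0)) with (cos (Rabs (x - x0))).
2: { unfold Rabs; destruct (Rcase_abs (x - x0)); auto; apply cos_neg. }
set (t := Rabs (x - x0)) in *.
destruct (Rle_lt_dec t PI).
- apply cos_decr_1; lra.
- replace (cos t) with (cos (2 * PI - t)).
  + apply cos_decr_1; lra.
  + rewrite cos_minus, cos_2PI, sin_2PI; ring.
Qed.

(* Testing against [(1 + cos (x - x0)) ^ N], which concentrates at [x0] as [N] grows. *)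
Lemma zero_cos_nonpos v x0 : continuity v -> zero_cos v -> 0 < x0 < 2 * PI -> v x0 <= 0.
Proof.
intros Hv H Hx0; apply Rnot_lt_le; intros Hp.
set (m := v x0 / 2).
destruct (Hv x0 m) as [d' [Hd' Hc]]; [unfold m; lra|].
set (d := Rmin (Rmin (d' / 2) 1) (Rmin (x0 / 2) ((2 * PI - x0) / 2))).
assert (D0 : 0 < d) by (repeat apply Rmin_pos; lra).
assert (D1 : d <= d' / 2) by (eapply Rle_trans; [apply Rmin_l|apply Rmin_l]).
assert (D2 : d <= 1) by (eapply Rle_trans; [apply Rmin_l|apply Rmin_r]).
assert (D3 : d <= x0 / 2) by (eapply Rle_trans; [apply Rmin_r|apply Rmin_l]).
assert (D4 : d <= (2 * PI - x0) / 2) by (eapply Rle_trans; [apply Rmin_r|apply Rmin_r]).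
clearbody d.
assert (P := PI_RGT_0); assert (P2 := PI2_1).
assert (Hm : forall x, Rabs (x - x0) <= d -> m <= v x).
{ intros x Hx; destruct (Req_dec x x0) as [->|E]; [unfold m; lra|].
  assert (K : Rabs (v x - v x0) < m).
  { apply (Hc x); split; [split; [exact I|auto]|]; simpl; unfold R_dist; lra. }
  apply Rabs_def2 in K; unfold m in *; lra. }
assert (M0 : 0 < m) by (unfold m; lra).
set (c1 := 1 + cos d); set (c2 := 1 + cos (d / 2)).
assert (C1 : 0 < c1) by (unfold c1; generalize (cos_gt_0 d); lra).
assert (C12 : c1 < c2) by (unfold c1, c2; assert (cos d < cos (d / 2)) by (apply cos_decreasing_1; lra); lra).
set (a := x0 - d / 2); set (b := x0 + d / 2).
set (q N := fun x => v x * (1 + cos (x - x0)) ^ N).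
assert (Cq : forall N, continuity (q N)).
{ intros N x; apply (continuity_pt_mult v); [apply Hv|]. apply derivable_continuous_pt; reg. }
assert (Pp : forall x, 0 <= 1 + cos (x - x0)) by (intros x; generalize (COS_bound (x - x0)); lra).
assert (Ca : continuity (fun x => Rabs (v x))).
{ intros x; apply (continuity_pt_comp v Rabs); [apply Hv|apply Rcontinuity_abs]. }
(* Within [d] of [x0] the integrand is nonnegative; farther away the kernel is at most [c1 ^ N]. *)
assert (Low : forall N x, 0 <= x <= 2 * PI -> - c1 ^ N * Rabs (v x) <= q N x).
{ intros N x Hx; unfold q.
  assert (C1N : 0 < c1 ^ N) by (apply pow_lt; auto).
  assert (PN : 0 <= (1 + cos (x - x0)) ^ N) by (apply pow_le; auto).
  destruct (Rle_lt_dec (Rabs (x - x0)) d) as [L|L].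
  - assert (0 <= v x) by (generalize (Hm x L); lra).
    generalize (Rabs_pos (v x)); intros; nra.
  - assert ((1 + cos (x - x0)) ^ N <= c1 ^ N).
    { apply pow_incr; split; auto; unfold c1.
      generalize (cos_far x x0 d); lra. }
    assert (- Rabs (v x) <= v x) by (generalize (Rabs_maj2 (v x)); lra).
    generalize (Rabs_pos (v x)); intros; nra. }
set (A := RInt (fun x => Rabs (v x)) 0 a + RInt (fun x => Rabs (v x)) b (2 * PI)).
(* The integral over the middle interval, of length [d], is at least [d m c2 ^ N], while the outer
   two are at least [- c1 ^ N A] in total; their sum is zero. *)
assert (Main : forall N, d * m * c2 ^ N <= c1 ^ N * A).
{ intros N.
  assert (Z := zero_cos_pow v x0 N Hv H); fold (q N) in Z.
  rewrite <- (RInt_Chasles (V := R_CompleteNormedModule) (q N) 0 a (2 * PI)) in Z by (apply ex_RInt_cont; auto).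
  rewrite <- (RInt_Chasles (V := R_CompleteNormedModule) (q N) a b (2 * PI)) in Z by (apply ex_RInt_cont; auto).
  assert (Side : forall u w, 0 <= u -> u <= w -> w <= 2 * PI ->
     - c1 ^ N * RInt (fun x => Rabs (v x)) u w <= RInt (q N) u w).
  { intros u w U1 U2 U3.
    change (- c1 ^ N * RInt (fun x => Rabs (v x)) u w) with
      (scal (- c1 ^ N) (RInt (fun x => Rabs (v x)) u w)).
    rewrite <- (RInt_scal (V := R_CompleteNormedModule)) by (apply ex_RInt_cont; auto).
    apply RInt_le; auto.
    - apply (ex_RInt_scal (V := R_NormedModule)), ex_RInt_cont; auto.
    - apply ex_RInt_cont; auto.
    - intros x Hx; apply Low; lra. }
  assert (S1 := Side 0 a); assert (S3 := Side b (2 * PI)).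
  assert (S2 : RInt (fun _ => m * c2 ^ N) a b <= RInt (q N) a b).
  { apply RInt_le.
    - unfold a, b; lra.
    - apply (ex_RInt_const (V := R_NormedModule)).
    - apply ex_RInt_cont; auto.
    - intros x Hx; unfold q.
      assert (X : Rabs (x - x0) <= d / 2) by (apply Rabs_le; unfold a, b in Hx; lra).
      apply Rmult_le_compat; try lra.
      + apply pow_le; unfold c2; generalize (cos_gt_0 (d / 2)); lra.
      + apply Hm; lra.
      + apply pow_incr; split; [unfold c2; generalize (cos_gt_0 (d / 2)); lra|].
        unfold c2; apply Rplus_le_compat_l.
        replace (cos (x - x0)) with (cos (Rabs (x - x0))).
        * apply cos_decr_1; generalize (Rabs_pos (x - x0)); lra.
        * unfold Rabs; destruct (Rcase_abs (x - x0)); auto; apply cos_neg. }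
  rewrite RInt_const in S2; unfold scal in S2; simpl in S2; unfold mult in S2; simpl in S2.
  unfold plus in Z; simpl in Z.
  unfold a, b in S1, S3; specialize (S1 ltac:(lra) ltac:(lra) ltac:(lra)).
  specialize (S3 ltac:(lra) ltac:(lra) ltac:(lra)).
  fold a in S1; fold b in S3.
  replace (b - a) with d in S2 by (unfold a, b; field).
  unfold A; nra. }
(* Bernoulli's inequality for [(c2 / c1) ^ N = (1 + e) ^ N] contradicts the bound by [A] once [N] is
   large. *)
set (e := c2 / c1 - 1).
assert (He : 0 < e).
{ unfold e; assert (1 < c2 / c1); [|lra].
  apply Rmult_lt_reg_r with c1; auto; unfold Rdiv; rewrite Rmult_assoc, Rinv_l by lra; lra. }
destruct (INR_unbounded (A / (d * m * e))) as [N HN].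
assert (DM : 0 < d * m) by (apply Rmult_lt_0_compat; lra).
specialize (Main N).
replace (c2 ^ N) with (c1 ^ N * (1 + e) ^ N) in Main.
2: { rewrite <- Rpow_mult_distr; f_equal; unfold e; field; lra. }
assert (B := poly N e He).
assert (C1N : 0 < c1 ^ N) by (apply pow_lt; auto).
assert (L : d * m * (1 + e) ^ N <= A).
{ apply Rmult_le_reg_l with (c1 ^ N); auto; lra. }
assert (L2 : A < d * m * e * INR N).
{ apply Rmult_lt_reg_r with (/ (d * m * e)).
  - apply Rinv_0_lt_compat, Rmult_lt_0_compat; lra.
  - unfold Rdiv in HN; replace (d * m * e * INR N * / (d * m * e)) with (INR N); [lra|].
    field; repeat split; lra. }
nra.
Qed.

Lemma zero_cos_eq_0 v x0 : continuity v -> zero_cos v -> 0 < x0 < 2 * PI -> v x0 = 0.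
Proof.
intros Hv H Hx; apply Rle_antisym; [apply (zero_cos_nonpos v); auto|].
apply Ropp_le_cancel; rewrite Ropp_0.
apply (zero_cos_nonpos (fun x => - v x)); auto.
- intros x; apply continuity_pt_opp, Hv.
- intros n phi; rewrite (RInt_ext _ (fun x => opp (v x * cos (IZR n * x + phi)))).
  + rewrite (RInt_opp (V := R_CompleteNormedModule)) by (apply ex_RInt_cont, continuity_vcos; auto).
    rewrite H; unfold opp; simpl; ring.
  + intros x _; unfold opp; simpl; ring.
Qed.

Lemma period_reduce x : exists n : Z, 0 <= x + IZR n * (2 * PI) < 2 * PI.
Proof.
assert (P := two_PI_pos).
exists (- Int_part (x / (2 * PI)))%Z.
destruct (base_Int_part (x / (2 * PI))) as [H1 H2].
rewrite opp_IZR; set (n := IZR (Int_part _)) in *.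
assert (E : x / (2 * PI) * (2 * PI) = x) by (field; lra).
split; nra.
Qed.

Lemma torus_fun_period u (n1 n2 : Z) x y : torus_fun u ->
  u (x + IZR n1 * (2 * PI)) (y + IZR n2 * (2 * PI)) = u x y.
Proof.
intros H.
rewrite (periodic_Z (fun x => u x (y + IZR n2 * (2 * PI)))) by (intros t; apply H).
apply (periodic_Z (fun y => u x y)); intros t; apply H.
Qed.

(** The one-variable result is used twice. For a fixed frequency in [y] the inner integral is a
    function of [x] with vanishing coefficients, since a product of two cosines is half a sum of
    characters of the torus; once it vanishes, so do the coefficients of [y |-> v x y]. *)
Lemma mean2_zero_eq_0 v : torus_fun v ->
  (forall j1 j2 phi, mean2 (fun x y => v x y * cos (IZR j1 * x + IZR j2 * y + phi)) = 0) ->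
  forall x y, v x y = 0.
Proof.
intros Hv H.
assert (Cv := torus_fun_cont2 v Hv); assert (P := two_PI_pos).
assert (Cc : forall a b c, cont2 (fun x y => cos (a * x + b * y + c))).
{ intros; apply (cont2_comp1 cos); [apply continuity_cos|].
  apply cont2_plus; [apply cont2_lin|apply cont2_const]. }
assert (I : forall n psi x, 0 < x < 2 * PI ->
  RInt (fun y => v x y * cos (IZR n * y + psi)) 0 (2 * PI) = 0).
{ intros n psi x0 Hx0.
  apply (zero_cos_eq_0 (fun x => RInt (fun y => v x y * cos (IZR n * y + psi)) 0 (2 * PI))); [| |exact Hx0].
  - apply (RInt_param_continuity (fun x y => v x y * cos (IZR n * y + psi))); [lra|].
    apply cont2_mult; auto.
    replace (fun x y : R => cos (IZR n * y + psi)) with (fun x y => cos (0 * x + IZR n * y + psi)); auto.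
    apply fun2_ext; intros; f_equal; ring.
  - intros m phi.
    assert (E : mean2 (fun x y => / 2 * (v x y * cos (IZR m * x + IZR n * y + (phi + psi))) +
                                  / 2 * (v x y * cos (IZR m * x + IZR (- n) * y + (phi - psi)))) = 0).
    { rewrite mean2_plus by (repeat apply cont2_mult; auto using cont2_const).
      rewrite !mean2_scal by (repeat apply cont2_mult; auto using cont2_const).
      rewrite !H; ring. }
    unfold mean2 in E.
    apply Rmult_integral in E; destruct E as [E|E].
    { exfalso; revert E; apply Rinv_neq_0_compat, pow_nonzero; lra. }
    etransitivity; [|exact E]; apply RInt_ext; intros x _.
    rewrite Rmult_comm.
    change (scal (cos (IZR m * x + phi)) (RInt (fun y => v x y * cos (IZR n * y + psi)) 0 (2 * PI)) =
      RInt (fun y => / 2 * (v x y * cos (IZR m * x + IZR n * y + (phi + psi))) +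
         / 2 * (v x y * cos (IZR m * x + IZR (- n) * y + (phi - psi)))) 0 (2 * PI)).
    rewrite <- (RInt_scal (V := R_CompleteNormedModule)).
    + apply RInt_ext; intros y _; unfold scal; simpl; unfold mult; simpl; rewrite opp_IZR.
      replace (IZR m * x + IZR n * y + (phi + psi)) with ((IZR m * x + phi) + (IZR n * y + psi)) by ring.
      replace (IZR m * x + - IZR n * y + (phi - psi)) with ((IZR m * x + phi) - (IZR n * y + psi)) by ring.
      generalize (IZR m * x + phi) (IZR n * y + psi); intros p q.
      rewrite cos_plus, cos_minus; field.
    + apply ex_RInt_cont, continuity_vcos, cont2_y; auto. }
assert (J : forall x y, 0 < x < 2 * PI -> 0 < y < 2 * PI -> v x y = 0).
{ intros x y Hx Hy; apply (zero_cos_eq_0 (fun y => v x y)); auto.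
  - apply cont2_y; auto.
  - intros n psi; apply I; auto. }
intros x y.
destruct (period_reduce x) as [n Hn]; destruct (period_reduce y) as [m Hm].
rewrite <- (torus_fun_period v n m x y Hv).
set (x' := x + _) in *; set (y' := y + _) in *.
(* The reduced point may lie on an edge [x' = 0] or [y' = 0], which [J] does not reach. A
   displacement by [s] in both variables enters the open square, while continuity would keep [v]
   nonzero there. *)
destruct (Req_dec (v x' y') 0) as [E|E]; auto; exfalso.
destruct (Cv x' y' (mkposreal _ (Rabs_pos_lt _ E))) as [d Hd]; simpl in Hd.
set (s := Rmin (d / 2) (Rmin ((2 * PI - x') / 2) ((2 * PI - y') / 2))).
assert (D := cond_pos d).
assert (S0 : 0 < s) by (repeat apply Rmin_pos; lra).
assert (S1 : s <= d / 2) by apply Rmin_l.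
assert (S2 : s <= (2 * PI - x') / 2) by (eapply Rle_trans; [apply Rmin_r|apply Rmin_l]).
assert (S3 : s <= (2 * PI - y') / 2) by (eapply Rle_trans; [apply Rmin_r|apply Rmin_r]).
assert (K := Hd (x' + s) (y' + s)).
rewrite J in K by lra.
replace (x' + s - x') with s in K by ring; replace (y' + s - y') with s in K by ring.
rewrite (Rabs_pos_eq s) in K by lra.
rewrite Rminus_0_l, Rabs_Ropp in K; lra.
Qed.

(** * Fourier inversion *)

Lemma cont2_Re_char2 j1 j2 : cont2 (fun x y => Re (char2 j1 j2 x y)).
Proof. apply ccont_char2. Qed.
Lemma cont2_Im_char2 j1 j2 : cont2 (fun x y => Im (char2 j1 j2 x y)).
Proof. apply ccont_char2. Qed.

Lemma Re_fcoef u j1 j2 : Re (fcoef u j1 j2) = mean2 (fun x y => u x y * Re (char2 (- j1) (- j2) x y)).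
Proof. unfold fcoef, mean2C; simpl; f_equal; apply fun2_ext; intros; ring. Qed.

Lemma Im_fcoef u j1 j2 : Im (fcoef u j1 j2) = mean2 (fun x y => u x y * Im (char2 (- j1) (- j2) x y)).
Proof. unfold fcoef, mean2C; simpl; f_equal; apply fun2_ext; intros; ring. Qed.

Lemma herm_fcoef u : cont2 u -> herm (fcoef u).
Proof.
intros Hu j1 j2; apply C_ext.
- change (Re (fcoef u (- j1) (- j2)) = Re (fcoef u j1 j2)).
  rewrite !Re_fcoef; f_equal; apply fun2_ext; intros; now rewrite char2_conj.
- change (Im (fcoef u (- j1) (- j2)) = - Im (fcoef u j1 j2)).
  rewrite !Im_fcoef.
  replace (- mean2 (fun x y => u x y * Im (char2 (- j1) (- j2) x y)))
    with (-1 * mean2 (fun x y => u x y * Im (char2 (- j1) (- j2) x y))) by ring.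
  rewrite <- mean2_scal by (apply cont2_mult; auto using cont2_Im_char2).
  f_equal; apply fun2_ext; intros; rewrite char2_conj; simpl; ring.
Qed.

Lemma Cmod_fcoef_le u j1 j2 : cont2 u ->
  Cmod (fcoef u j1 j2) <= 2 * mean2 (fun x y => Rabs (u x y)).
Proof.
intros Hu; apply mean2C_dom.
- apply ccont_mult; auto using ccont_RtoC, ccont_char2.
- apply cont2_abs; auto.
- intros x y; rewrite Cmod_mult, Cmod_char2, Cmod_R; lra.
Qed.

Lemma mean2_d2_zero w : cont2 (d2 w) -> (forall x y, ex_derive (fun y => w x y) y) ->
  (forall x y, w x (y + 2 * PI) = w x y) -> mean2 (d2 w) = 0.
Proof.
intros Hc Hd Hp; unfold mean2.
rewrite (RInt_ext _ (fun _ => 0)).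
- rewrite RInt_const; unfold scal; simpl; unfold mult; simpl; ring.
- intros x _.
  rewrite (RInt_Derive (fun y => w x y)).
  + rewrite <- (Hp x 0), Rplus_0_l; real_eq; ring.
  + intros; apply Hd.
  + intros y _; apply (proj1 (continuity_pt_filterlim (fun y => d2 w x y) y)), cont2_y; auto.
Qed.

(** Differentiation under the inner integral sign makes the outer integrand a derivative in [x], so
    the order of integration fixed in [mean2] is respected. *)
Lemma mean2_d1_zero w : cont2 w -> cont2 (d1 w) -> (forall x y, ex_derive (fun x => w x y) x) ->
  (forall x y, w (x + 2 * PI) y = w x y) -> mean2 (d1 w) = 0.
Proof.
intros Hw Hc Hd Hp; unfold mean2.
assert (P := two_PI_pos).
assert (D : forall x, is_derive (fun x => RInt (fun y => w x y) 0 (2 * PI)) x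
   (RInt (fun y => d1 w x y) 0 (2 * PI))).
{ intros x; apply (is_derive_RInt_param w 0 (2 * PI) x).
  - exists (mkposreal 1 Rlt_0_1); intros z _ t _; apply Hd.
  - intros t _; apply Hc.
  - exists (mkposreal 1 Rlt_0_1); intros z _; apply ex_RInt_cont, cont2_y; auto. }
assert (E : is_RInt (fun x => RInt (fun y => d1 w x y) 0 (2 * PI)) 0 (2 * PI)
  (minus (RInt (fun y => w (2 * PI) y) 0 (2 * PI)) (RInt (fun y => w 0 y) 0 (2 * PI)))).
{ apply (is_RInt_derive (V := R_CompleteNormedModule)
    (fun x => RInt (fun y => w x y) 0 (2 * PI))).
  - intros x _; apply D.
  - intros x _; apply (proj1 (continuity_pt_filterlim (fun x => RInt (fun y => d1 w x y) 0 (2 * PI)) x)).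
    apply RInt_param_continuity; auto; lra. }
apply is_RInt_unique in E; rewrite E.
replace (fun y => w (2 * PI) y) with (fun y => w 0 y).
- unfold minus, plus, opp; simpl; ring.
- apply functional_extensionality; intros y; rewrite <- (Hp 0 y); f_equal; ring.
Qed.

Lemma Re_char2_d1 j1 j2 (x y : R) :
  is_derive (fun x => Re (char2 (- j1) (- j2) x y)) x (IZR j1 * Im (char2 (- j1) (- j2) x y)).
Proof. unfold char2; simpl; rewrite !opp_IZR; auto_derive; auto; ring. Qed.
Lemma Im_char2_d1 j1 j2 (x y : R) :
  is_derive (fun x => Im (char2 (- j1) (- j2) x y)) x (- IZR j1 * Re (char2 (- j1) (- j2) x y)).
Proof. unfold char2; simpl; rewrite !opp_IZR; auto_derive; auto; ring. Qed.
Lemma Re_char2_d2 j1 j2 (x y : R) :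
  is_derive (fun y => Re (char2 (- j1) (- j2) x y)) y (IZR j2 * Im (char2 (- j1) (- j2) x y)).
Proof. unfold char2; simpl; rewrite !opp_IZR; auto_derive; auto; ring. Qed.
Lemma Im_char2_d2 j1 j2 (x y : R) :
  is_derive (fun y => Im (char2 (- j1) (- j2) x y)) y (- IZR j2 * Re (char2 (- j1) (- j2) x y)).
Proof. unfold char2; simpl; rewrite !opp_IZR; auto_derive; auto; ring. Qed.

Lemma char2_period1 j1 j2 x y : char2 j1 j2 (x + 2 * PI) y = char2 j1 j2 x y.
Proof. rewrite <- (char2_period j1 j2 1 0 x y); f_equal; ring. Qed.
Lemma char2_period2 j1 j2 x y : char2 j1 j2 x (y + 2 * PI) = char2 j1 j2 x y.
Proof. rewrite <- (char2_period j1 j2 0 1 x y); f_equal; ring. Qed.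

(** The derivative of [v] is given as [r * v'] because differentiation exchanges the real and
    imaginary parts of a character up to a factor. *)
Lemma ibp1 u v v' r : torus_Cn 1 u -> cont2 v -> cont2 v' ->
  (forall x y : R, is_derive (fun x => v x y) x (r * v' x y)) ->
  (forall x y, v (x + 2 * PI) y = v x y) ->
  mean2 (fun x y => d1 u x y * v x y) = - r * mean2 (fun x y => u x y * v' x y).
Proof.
intros [Hu [Du [H1 _]]] Hv Hv' D Pv.
assert (Cu := torus_fun_cont2 u Hu); assert (Cd := torus_fun_cont2 _ (proj1 H1)).
assert (E : d1 (fun x y => u x y * v x y) = fun x y => d1 u x y * v x y + r * (u x y * v' x y)).
{ apply fun2_ext; intros x y; unfold d1.
  rewrite (Derive_mult (fun x => u x y) (fun x => v x y)); [|apply (Du x y)|eexists; apply D].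
  replace (Derive (fun x => v x y) x) with (r * v' x y) by (symmetry; apply is_derive_unique, D); ring. }
assert (Z : mean2 (d1 (fun x y => u x y * v x y)) = 0).
{ apply mean2_d1_zero.
  - apply cont2_mult; auto.
  - rewrite E; apply cont2_plus; repeat apply cont2_mult; auto using cont2_const.
  - intros x y; apply ex_derive_mult; [apply (Du x y)|eexists; apply D].
  - intros x y; rewrite Pv; f_equal; apply Hu. }
rewrite E, mean2_plus, mean2_scal in Z; repeat apply cont2_mult; auto using cont2_const; lra.
Qed.

Lemma ibp2 u v v' r : torus_Cn 1 u -> cont2 v -> cont2 v' ->
  (forall x y : R, is_derive (fun y => v x y) y (r * v' x y)) ->
  (forall x y, v x (y + 2 * PI) = v x y) ->
  mean2 (fun x y => d2 u x y * v x y) = - r * mean2 (fun x y => u x y * v' x y).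
Proof.
intros [Hu [Du [_ H1]]] Hv Hv' D Pv.
assert (Cu := torus_fun_cont2 u Hu); assert (Cd := torus_fun_cont2 _ (proj1 H1)).
assert (E : d2 (fun x y => u x y * v x y) = fun x y => d2 u x y * v x y + r * (u x y * v' x y)).
{ apply fun2_ext; intros x y; unfold d2.
  rewrite (Derive_mult (fun y => u x y) (fun y => v x y)); [|apply (Du x y)|eexists; apply D].
  replace (Derive (fun y => v x y) y) with (r * v' x y) by (symmetry; apply is_derive_unique, D); ring. }
assert (Z : mean2 (d2 (fun x y => u x y * v x y)) = 0).
{ apply mean2_d2_zero.
  - rewrite E; apply cont2_plus; repeat apply cont2_mult; auto using cont2_const.
  - intros x y; apply ex_derive_mult; [apply (Du x y)|eexists; apply D].
  - intros x y; rewrite Pv; f_equal; apply Hu. }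
rewrite E, mean2_plus, mean2_scal in Z; repeat apply cont2_mult; auto using cont2_const; lra.
Qed.

Lemma fcoef_d1 u j1 j2 : torus_Cn 1 u -> fcoef (d1 u) j1 j2 = (Ci * RtoC (IZR j1) * fcoef u j1 j2)%C.
Proof.
intros Hu; apply C_ext.
- rewrite Re_fcoef, (ibp1 u _ (fun x y => Im (char2 (- j1) (- j2) x y)) (IZR j1)), <- Im_fcoef;
    auto using cont2_Re_char2, cont2_Im_char2, Re_char2_d1.
  + simpl; ring.
  + intros; now rewrite char2_period1.
- rewrite Im_fcoef, (ibp1 u _ (fun x y => Re (char2 (- j1) (- j2) x y)) (- IZR j1)), <- Re_fcoef;
    auto using cont2_Re_char2, cont2_Im_char2, Im_char2_d1.
  + simpl; ring.
  + intros; now rewrite char2_period1.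
Qed.

Lemma fcoef_d2 u j1 j2 : torus_Cn 1 u -> fcoef (d2 u) j1 j2 = (Ci * RtoC (IZR j2) * fcoef u j1 j2)%C.
Proof.
intros Hu; apply C_ext.
- rewrite Re_fcoef, (ibp2 u _ (fun x y => Im (char2 (- j1) (- j2) x y)) (IZR j2)), <- Im_fcoef;
    auto using cont2_Re_char2, cont2_Im_char2, Re_char2_d2.
  + simpl; ring.
  + intros; now rewrite char2_period2.
- rewrite Im_fcoef, (ibp2 u _ (fun x y => Re (char2 (- j1) (- j2) x y)) (- IZR j2)), <- Re_fcoef;
    auto using cont2_Re_char2, cont2_Im_char2, Im_char2_d2.
  + simpl; ring.
  + intros; now rewrite char2_period2.
Qed.

(** The weight expands to [1 + j1^2 + j2^2 + j1^2 j2^2]. Each of these times the coefficient is, in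
    modulus, a coefficient of [u], of a pure second derivative, or of the fourth derivative taken
    twice in each variable; hence four derivatives. *)
Lemma qdecay_fcoef u : torus_Cn 4 u -> exists M, qdecay M (fcoef u).
Proof.
intros Hu.
assert (Hu3 := torus_Cn_le _ _ Hu); assert (Hu2 := torus_Cn_le _ _ Hu3); assert (Hu1 := torus_Cn_le _ _ Hu2).
assert (N1 : forall n w, torus_Cn (S n) w -> torus_Cn n (d1 w)) by (intros n w H; apply H).
assert (N2 : forall n w, torus_Cn (S n) w -> torus_Cn n (d2 w)) by (intros n w H; apply H).
assert (C : forall n w, torus_Cn n w -> cont2 w) by (intros n w H; apply torus_fun_cont2, (torus_Cn_fun n), H).
assert (Up : forall n w, torus_Cn (S n) w -> torus_Cn 1 w).
{ induction n; intros w H; auto; apply IHn, torus_Cn_le, H. }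
assert (E11 : forall j1 j2, IZR j1 ^ 2 * Cmod (fcoef u j1 j2) = Cmod (fcoef (d1 (d1 u)) j1 j2)).
{ intros; rewrite !fcoef_d1 by eauto.
  rewrite !Cmod_mult, Cmod_Ci, Cmod_R, <- pow2_abs; ring. }
assert (E22 : forall w j1 j2, torus_Cn 2 w -> IZR j2 ^ 2 * Cmod (fcoef w j1 j2) = Cmod (fcoef (d2 (d2 w)) j1 j2)).
{ intros; rewrite !fcoef_d2 by eauto.
  rewrite !Cmod_mult, Cmod_Ci, Cmod_R, <- pow2_abs; ring. }
set (B w := 2 * mean2 (fun x y => Rabs (w x y))).
exists (B u + B (d1 (d1 u)) + B (d2 (d2 u)) + B (d2 (d2 (d1 (d1 u))))).
intros j1 j2.
assert (W := wt_ge_1 j1 j2).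
apply Rmult_le_reg_r with (wt j1 j2); [lra|].
rewrite Rmult_assoc, Rinv_l, Rmult_1_r by lra.
replace (Cmod (fcoef u j1 j2) * wt j1 j2) with
  (Cmod (fcoef u j1 j2) + IZR j1 ^ 2 * Cmod (fcoef u j1 j2) + IZR j2 ^ 2 * Cmod (fcoef u j1 j2)
   + IZR j2 ^ 2 * (IZR j1 ^ 2 * Cmod (fcoef u j1 j2))) by (unfold wt; ring).
rewrite E11, !E22 by auto.
repeat apply Rplus_le_compat; apply Cmod_fcoef_le; eauto 6.
Qed.

(** The sum of the series is a continuous torus function with the same coefficients as [u], so
    uniqueness applies to the difference. *)
Lemma fourier_inversion u : torus_Cn 4 u -> u = rser (fcoef u).
Proof.
intros Hu; destruct (qdecay_fcoef u Hu) as [M HM].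
assert (Tu := torus_Cn_fun _ _ Hu); assert (Cu := torus_fun_cont2 u Tu).
set (a := fcoef u) in *.
assert (Ha : herm a) by (apply herm_fcoef; auto).
assert (Ta := torus_fun_rser M a HM); assert (Ca := torus_fun_cont2 _ Ta).
set (v := fun x y => u x y + -1 * rser a x y).
assert (Tv : torus_fun v) by (apply torus_fun_plus, torus_fun_mult; auto using torus_fun_const).
assert (Cv := torus_fun_cont2 _ Tv).
assert (Z : forall j1 j2, fcoef v j1 j2 = RtoC 0).
{ intros j1 j2.
  assert (E : fcoef u j1 j2 = fcoef (rser a) j1 j2) by now rewrite (fcoef_rser M a).
  assert (R0 := f_equal Re E); assert (I0 := f_equal Im E); rewrite !Re_fcoef in R0; rewrite !Im_fcoef in I0.
  apply C_ext; rewrite ?Re_fcoef, ?Im_fcoef; unfold v.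
  - change (Re (RtoC 0)) with 0.
    rewrite <- (Rminus_diag (mean2 (fun x y => u x y * Re (char2 (- j1) (- j2) x y)))).
    rewrite R0 at 2; rewrite <- mean2_minus by (apply cont2_mult; auto using cont2_Re_char2).
    f_equal; apply fun2_ext; intros; ring.
  - change (Im (RtoC 0)) with 0.
    rewrite <- (Rminus_diag (mean2 (fun x y => u x y * Im (char2 (- j1) (- j2) x y)))).
    rewrite I0 at 2; rewrite <- mean2_minus by (apply cont2_mult; auto using cont2_Im_char2).
    f_equal; apply fun2_ext; intros; ring. }
assert (V : forall x y, v x y = 0).
{ apply mean2_zero_eq_0; auto.
  intros j1 j2 phi.
  assert (E := Z (- j1)%Z (- j2)%Z).
  assert (R0 := f_equal Re E); assert (I0 := f_equal Im E); rewrite Re_fcoef in R0; rewrite Im_fcoef in I0.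
  rewrite !Z.opp_involutive in R0, I0.
  replace (fun x y => v x y * cos (IZR j1 * x + IZR j2 * y + phi)) with
    (fun x y => cos phi * (v x y * Re (char2 j1 j2 x y)) + - sin phi * (v x y * Im (char2 j1 j2 x y))).
  - rewrite mean2_plus, !mean2_scal, R0, I0; [simpl; ring|..];
      repeat apply cont2_mult; auto using cont2_const, cont2_Re_char2, cont2_Im_char2.
  - apply fun2_ext; intros x y; unfold char2; simpl.
    generalize (IZR j1 * x + IZR j2 * y); intros z; rewrite cos_plus; ring. }
apply fun2_ext; intros x y; generalize (V x y); unfold v; lra.
Qed.

(** * Functions without positive frequencies *)

Lemma Rabs_sin_le t : Rabs (sin t) <= Rabs t.
Proof.
assert (G : forall t, 0 < t -> Rabs (sin t) <= t).
{ intros u Hu; destruct (Rle_lt_dec u 1).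
  - assert (P := PI2_1).
    rewrite Rabs_pos_eq; [left; apply sin_lt_x; auto|apply sin_ge_0; lra].
  - generalize (SIN_bound u); intros; apply Rabs_le; lra. }
destruct (total_order_T t 0) as [[H| ->]|H].
- rewrite <- (Rabs_Ropp t), <- (Rabs_Ropp (sin t)), <- sin_neg, (Rabs_pos_eq (- t)) by lra.
  apply G; lra.
- rewrite sin_0; lra.
- rewrite (Rabs_pos_eq t) by lra; auto.
Qed.

Lemma one_minus_cos_le t : 0 <= 1 - cos t <= t ^ 2 / 2.
Proof.
replace t with (2 * (t / 2)) at 1 2 by field; rewrite cos_2a_sin.
assert (H := Rabs_sin_le (t / 2)).
assert (H2 : sin (t / 2) ^ 2 <= (t / 2) ^ 2).
{ rewrite <- (pow2_abs (sin _)), <- (pow2_abs (t / 2)); apply pow_incr; split; auto using Rabs_pos. }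
generalize (pow2_ge_0 (sin (t / 2))); nra.
Qed.

Lemma Rabs_sin_sub_le t : Rabs (sin t - t) <= t ^ 2.
Proof.
destruct (MVT_gen (fun u => sin u - u) 0 t (fun u => cos u - 1)) as [c [Hc E]].
- intros x _; auto_derive; auto; ring.
- intros x _; apply derivable_continuous_pt; reg.
- rewrite sin_0, !Rminus_0_r in E; rewrite E, Rabs_mult.
  assert (A : Rabs c <= Rabs t).
  { revert Hc; unfold Rmin, Rmax, Rabs; destruct (Rle_dec 0 t), (Rcase_abs c), (Rcase_abs t); lra. }
  assert (B : Rabs (cos c - 1) <= Rabs c).
  { destruct (Rle_lt_dec (Rabs c) 2) as [L|L].
    - generalize (one_minus_cos_le c) (Rabs_pos c); rewrite <- (pow2_abs c); intros.
      rewrite Rabs_minus_sym, Rabs_pos_eq; nra.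
    - generalize (COS_bound c); intros; apply Rabs_le; lra. }
  rewrite <- (pow2_abs t); generalize (Rabs_pos c) (Rabs_pos t); intros; nra.
Qed.

Definition lfreq (k : R) (j1 j2 : Z) : R := IZR j1 + IZR j2 * k.

Lemma char2_sub1_le j1 j2 s r :
  Cmod (char2 j1 j2 s r - 1)%C <= 4 * wt j1 j2 * (Rabs s + Rabs r).
Proof.
unfold char2; set (t := IZR j1 * s + IZR j2 * r).
assert (T : Rabs t <= wt j1 j2 * (Rabs s + Rabs r)).
{ unfold t; eapply Rle_trans; [apply Rabs_triang|]; rewrite !Rabs_mult.
  generalize (Rabs_j1_le_wt j1 j2) (Rabs_j2_le_wt j1 j2) (Rabs_pos s) (Rabs_pos r); intros.
  rewrite Rmult_plus_distr_l; apply Rplus_le_compat; apply Rmult_le_compat_r; auto. }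
replace (4 * wt j1 j2 * (Rabs s + Rabs r)) with (2 * (2 * (wt j1 j2 * (Rabs s + Rabs r)))) by ring.
assert (T0 := Rabs_pos t).
apply Cmod_le_ReIm; simpl.
- replace (cos t + - (1)) with (- (1 - cos t)) by ring; rewrite Rabs_Ropp.
  destruct (Rle_lt_dec (Rabs t) 1) as [L|L].
  + generalize (one_minus_cos_le t); rewrite <- (pow2_abs t); intros; rewrite Rabs_pos_eq; nra.
  + generalize (COS_bound t); intros; apply Rabs_le; lra.
- rewrite Ropp_0, Rplus_0_r; eapply Rle_trans; [apply Rabs_sin_le|]; lra.
Qed.

Lemma char2_sub_lin_le k j1 j2 h :
  Cmod (char2 j1 j2 h (k * h) - 1 - Ci * RtoC (lfreq k j1 j2 * h))%C
    <= 2 * (lfreq k j1 j2 * h) ^ 2.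
Proof.
unfold char2; replace (IZR j1 * h + IZR j2 * (k * h)) with (lfreq k j1 j2 * h) by (unfold lfreq; ring).
set (t := lfreq k j1 j2 * h).
apply Cmod_le_ReIm; simpl.
- generalize (one_minus_cos_le t) (pow2_ge_0 t); intros; apply Rabs_le; simpl in *; lra.
- replace (sin t + - 0 + - (0 * 0 + 1 * t)) with (sin t - t) by ring.
  apply (Rabs_sin_sub_le t).
Qed.

(** The constant of the sup norm estimate [series_bound]: [25] bounds a partial sum and
    [2 * wtail 0] the truncation error at radius [0], both relative to [M]. *)
Definition cw : R := 25 + 2 * wtail 0.

Lemma cw_ge_25 : 25 <= cw.
Proof. unfold cw; generalize (wtail_ge_0 0); lra. Qed.

Lemma series_bound M a x y : qdecay M a -> Cmod (fourier_series a x y) <= cw * M.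
Proof.
intros H.
replace (fourier_series a x y) with (fpart a 0 x y + (fourier_series a x y - fpart a 0 x y))%C by ring.
eapply Rle_trans; [apply Cmod_triangle|].
generalize (fpart_err M a 0 x y H); intros E.
assert (B : Cmod (fpart a 0 x y) <= M * 25).
{ eapply Rle_trans; [apply (Cmod_bsum _ (fun j1 j2 => M * / wt j1 j2)), (qdecay_char2 M a x y H)|].
  eapply Rle_trans; [apply (bsum_le_scal _ (fun j1 j2 => / wt j1 j2) M); intros; apply Rle_refl|].
  apply Rmult_le_compat_l; [apply (qdecay_ge_0 M a H)|apply wsum_le]. }
unfold cw; lra.
Qed.

Lemma rapid_bound2 a : rapid a -> exists M, 0 <= M /\ forall j1 j2, Cmod (a j1 j2) * wt j1 j2 <= M * / wt j1 j2.
Proof.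
intros H; destruct (H 2%nat) as [M HM]; exists M; split.
- eapply Rle_trans; [|apply (HM 0%Z 0%Z)].
  apply Rmult_le_pos; [apply Cmod_ge_0|apply pow_le; generalize (wt_ge_1 0 0); lra].
- intros j1 j2; assert (W := wt_ge_1 j1 j2).
  apply Rmult_le_reg_r with (wt j1 j2); [lra|].
  rewrite (Rmult_assoc M), Rinv_l by lra; specialize (HM j1 j2); simpl in HM; lra.
Qed.

Lemma series_sub Ma Mb a b x y : qdecay Ma a -> qdecay Mb b ->
  (fourier_series a x y - fourier_series b x y)%C = fourier_series (fun j1 j2 => a j1 j2 - b j1 j2)%C x y.
Proof.
intros Ha Hb.
replace (fun j1 j2 => a j1 j2 - b j1 j2)%C with (fun j1 j2 => RtoC 1 * a j1 j2 + RtoC (-1) * b j1 j2)%C.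
- rewrite (series_lin Ma Mb) by auto; apply C_ext; simpl; ring.
- apply fun2_ext; intros; apply C_ext; simpl; ring.
Qed.

Lemma series_lipschitz a : rapid a -> exists L, 0 <= L /\ forall x y x' y',
  Cmod (fourier_series a x' y' - fourier_series a x y)%C <= L * (Rabs (x' - x) + Rabs (y' - y)).
Proof.
intros H; destruct (rapid_bound2 a H) as [M [M0 HM]]; destruct (rapid_qdecay a H) as [Ma HMa].
exists (cw * (4 * M)); split.
{ generalize cw_ge_25; intros; apply Rmult_le_pos; lra. }
intros x y x' y'.
set (s := x' - x); set (r := y' - y).
replace x' with (x + s) by (unfold s; ring); replace y' with (y + r) by (unfold r; ring).
rewrite series_shift.
rewrite (series_sub Ma Ma); auto using qdecay_char2.
rewrite Rmult_assoc; apply series_bound; intros j1 j2.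
replace (a j1 j2 * char2 j1 j2 s r - a j1 j2)%C with (a j1 j2 * (char2 j1 j2 s r - 1))%C by ring.
rewrite Cmod_mult.
eapply Rle_trans; [apply Rmult_le_compat_l, char2_sub1_le; apply Cmod_ge_0|].
specialize (HM j1 j2).
assert (S0 : 0 <= 4 * (Rabs s + Rabs r)) by (generalize (Rabs_pos s) (Rabs_pos r); lra).
generalize (Rmult_le_compat_r _ _ _ S0 HM); lra.
Qed.

(** The space on which multiplication operators are inverted: it is preserved by multiplication with
    decaying series without positive frequencies and by uniform limits, which is what a Neumann
    series requires. *)
Definition cminus (k : R) (f : R -> R -> C) : Prop :=
  ccont f /\ (exists K, forall x y, Cmod (f x y) <= K) /\
  forall m1 m2, 0 < lfreq k m1 m2 -> ccoef f m1 m2 = RtoC 0.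

Definition neg_supp (k : R) (a : Z -> Z -> C) : Prop :=
  forall j1 j2, 0 < lfreq k j1 j2 -> a j1 j2 = RtoC 0.

(** At a positive frequency the convolution runs over pairs whose frequencies add up to it, so one
    member of each pair is positive and every term vanishes. *)
Lemma cminus_series_mult k M a f : qdecay M a -> neg_supp k a -> cminus k f ->
  cminus k (fun x y => fourier_series a x y * f x y)%C.
Proof.
intros Ha Hn [Hf [[K HK] Hc]]; split; [|split].
- apply ccont_mult; auto; apply (ccont_series M); auto.
- exists (cw * M * K); intros x y; rewrite Cmod_mult.
  apply Rmult_le_compat; auto using Cmod_ge_0; apply series_bound; auto.
- intros m1 m2 Hm; apply (ccoef_series_mult M a f K m1 m2 _ 0); auto.
  intros N _; apply (bsum_zero (G := C_AbelianMonoid)); intros j1 j2.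
  destruct (Rlt_le_dec 0 (lfreq k j1 j2)) as [L|L].
  + rewrite (Hn _ _ L); unfold zero; simpl; ring.
  + rewrite Hc; [unfold zero; simpl; ring|].
    unfold lfreq in *; rewrite !minus_IZR; lra.
Qed.

Lemma ccoef_plus f g m1 m2 : ccont f -> ccont g ->
  ccoef (fun x y => f x y + g x y)%C m1 m2 = (ccoef f m1 m2 + ccoef g m1 m2)%C.
Proof.
intros Hf Hg; unfold ccoef; rewrite <- mean2C_plus by (apply ccont_mult; auto using ccont_char2).
f_equal; apply fun2_ext; intros; ring.
Qed.

Lemma ccoef_scal c f m1 m2 : ccont f -> ccoef (fun x y => c * f x y)%C m1 m2 = (c * ccoef f m1 m2)%C.
Proof.
intros Hf; unfold ccoef; rewrite <- mean2C_scal by (apply ccont_mult; auto using ccont_char2).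
f_equal; apply fun2_ext; intros; ring.
Qed.

Lemma cminus_plus k f g : cminus k f -> cminus k g -> cminus k (fun x y => f x y + g x y)%C.
Proof.
intros [Hf [[K HK] Hc]] [Hg [[L HL] Hd]]; split; [apply ccont_plus; auto|split].
- exists (K + L); intros x y; eapply Rle_trans; [apply Cmod_triangle|]; apply Rplus_le_compat; auto.
- intros m1 m2 Hm; rewrite ccoef_plus, Hc, Hd by auto; ring.
Qed.

Lemma cminus_scal k c f : cminus k f -> cminus k (fun x y => c * f x y)%C.
Proof.
intros [Hf [[K HK] Hc]]; split; [apply ccont_mult; auto using ccont_const|split].
- exists (Cmod c * K); intros x y; rewrite Cmod_mult; apply Rmult_le_compat_l; auto using Cmod_ge_0.
- intros m1 m2 Hm; rewrite ccoef_scal, Hc by auto; ring.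
Qed.

Lemma cminus_limit k f :
  (forall e, 0 < e -> exists g, cminus k g /\ forall x y, Cmod (f x y - g x y)%C <= e) -> cminus k f.
Proof.
intros H.
assert (Cf : ccont f).
{ split; apply cont2_uniform_limit; intros e He; destruct (H e He) as [g [[[G1 G2] _] Hg]].
  - exists (fun x y => Re (g x y)); split; auto; intros x y; eapply Rle_trans; [|apply (Hg x y)].
    apply (re_le_Cmod (_ - _)%C).
  - exists (fun x y => Im (g x y)); split; auto; intros x y; eapply Rle_trans; [|apply (Hg x y)].
    apply (im_le_Cmod (_ - _)%C). }
split; auto; split.
- destruct (H 1 Rlt_0_1) as [g [[_ [[K HK] _]] Hg]].
  exists (1 + K); intros x y.
  replace (f x y) with ((f x y - g x y) + g x y)%C by ring.
  eapply Rle_trans; [apply Cmod_triangle|]; apply Rplus_le_compat; auto.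
- intros m1 m2 Hm; apply C_eq_small; intros e He.
  destruct (H (e / 2)) as [g [[Cg [_ Zg]] Hg]]; [lra|].
  rewrite <- (Zg m1 m2 Hm); replace e with (2 * (e / 2)) by field.
  apply ccoef_uniform; auto.
Qed.

Lemma cminus_one k : cminus k (fun _ _ => RtoC 1).
Proof.
split; [apply ccont_const|split; [exists 1; intros; rewrite Cmod_1; lra|]].
intros m1 m2 Hm; rewrite ccoef_one.
destruct (Z.eq_dec m1 0) as [->|]; auto; destruct (Z.eq_dec m2 0) as [->|]; auto.
unfold lfreq in Hm; lra.
Qed.

(** For a nowhere vanishing decaying series without positive frequencies this says, together with
    [cminus_series_mult], that multiplication by it is invertible on [cminus k]. *)
Definition inv_ok (k : R) (a : Z -> Z -> C) : Prop :=
  forall f, cminus k f -> cminus k (fun x y => f x y / fourier_series a x y)%C.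

(** The quotient [f / Q'] is the fixed point of the map sending [g] to [(f + (Q - Q') g) / Q]. This
    map preserves [cminus k] and contracts the sup norm by [1 / 2], so its iterates converge
    uniformly to [f / Q']. *)
Lemma inv_ok_step k M M' a a' d :
  qdecay M a -> qdecay M' a' -> neg_supp k a -> neg_supp k a' -> inv_ok k a -> 0 < d ->
  (forall x y, d <= Cmod (fourier_series a' x y)) ->
  (forall x y, d <= Cmod (fourier_series a x y)) ->
  (forall x y, Cmod (fourier_series a x y - fourier_series a' x y)%C
               <= Cmod (fourier_series a x y) / 2) ->
  inv_ok k a'.
Proof.
intros Ha Ha' Na Na' Hi Hd Hd' Hda Hc f Hf.
set (Q := fourier_series a) in *; set (Q' := fourier_series a') in *.
assert (NQ : forall x y, Q x y <> RtoC 0).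
{ intros x y E; generalize (Hda x y); rewrite E, Cmod_0; lra. }
assert (NQ' : forall x y, Q' x y <> RtoC 0).
{ intros x y E; generalize (Hd' x y); rewrite E, Cmod_0; lra. }
assert (Step : forall g, cminus k g -> cminus k (fun x y => (f x y + (Q x y - Q' x y) * g x y) / Q x y)%C).
{ intros g Hg; apply Hi, cminus_plus; auto.
  replace (fun x y => (Q x y - Q' x y) * g x y)%C with
    (fun x y => Q x y * g x y + RtoC (-1) * (Q' x y * g x y))%C
    by (apply fun2_ext; intros; apply C_ext; simpl; ring).
  apply cminus_plus; [|apply cminus_scal]; [apply (cminus_series_mult k M)|apply (cminus_series_mult k M')]; auto. }
assert (Hf' := Hf); destruct Hf' as [_ [[K HK] _]].
assert (K0 : 0 <= K) by (eapply Rle_trans; [apply Cmod_ge_0|apply (HK 0 0)]).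
(* The iteration starts at [0], where the error is [|f / Q'| <= K / d]. *)
assert (It : forall n, exists g, cminus k g /\
  forall x y, Cmod (f x y / Q' x y - g x y)%C <= K / d * (/ 2) ^ n).
{ induction n as [|n [g [Hg Eg]]].
  - exists (fun _ _ => RtoC 0 * RtoC 1)%C; split; [apply (cminus_scal k (RtoC 0)), cminus_one|].
    intros x y; replace (f x y / Q' x y - RtoC 0 * RtoC 1)%C with (f x y / Q' x y)%C by ring.
    rewrite Cmod_div by auto; simpl; rewrite Rmult_1_r.
    unfold Rdiv; apply Rmult_le_compat; auto using Cmod_ge_0.
    + left; apply Rinv_0_lt_compat; specialize (Hd' x y); lra.
    + apply Rinv_le_contravar; auto.
  - exists (fun x y => (f x y + (Q x y - Q' x y) * g x y) / Q x y)%C; split; [apply Step; auto|].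
    intros x y.
    replace (f x y / Q' x y - (f x y + (Q x y - Q' x y) * g x y) / Q x y)%C
      with ((Q x y - Q' x y) / Q x y * (f x y / Q' x y - g x y))%C by (field; auto).
    rewrite Cmod_mult, Cmod_div by auto.
    simpl; replace (K / d * (/ 2 * (/ 2) ^ n)) with (/ 2 * (K / d * (/ 2) ^ n)) by ring.
    apply Rmult_le_compat; auto using Cmod_ge_0.
    + apply Rmult_le_pos; [apply Cmod_ge_0|].
      left; apply Rinv_0_lt_compat; specialize (Hda x y); lra.
    + specialize (Hda x y); apply Rmult_le_reg_r with (Cmod (Q x y)); [lra|].
      unfold Rdiv; rewrite Rmult_assoc, Rinv_l by lra; specialize (Hc x y); lra. }
apply cminus_limit; intros e He.
(* The [+ 1] avoids a zero denominator when [K = 0]. *)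
destruct (pow_lt_1_zero (/ 2)) with (y := e / (K / d + 1)) as [N HN].
- rewrite Rabs_pos_eq; lra.
- assert (0 <= K / d) by (apply Rmult_le_pos; [auto|left; apply Rinv_0_lt_compat; auto]).
  apply Rdiv_lt_0_compat; lra.
- destruct (It N) as [g [Hg Eg]]; exists g; split; auto.
  intros x y; eapply Rle_trans; [apply Eg|].
  specialize (HN N (le_n N)).
  assert (P2 : 0 < (/ 2) ^ N) by (apply pow_lt; lra).
  rewrite Rabs_pos_eq in HN by lra.
  assert (KD : 0 <= K / d) by (apply Rmult_le_pos; [auto|left; apply Rinv_0_lt_compat; auto]).
  assert (E : (/ 2) ^ N * (K / d + 1) <= e).
  { left; apply Rmult_lt_reg_r with (/ (K / d + 1)); [apply Rinv_0_lt_compat; lra|].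
    rewrite Rmult_assoc, Rinv_r by lra; lra. }
  nra.
Qed.

Definition delta0 (j1 j2 : Z) : C := if Z.eq_dec j1 0 then if Z.eq_dec j2 0 then RtoC 1 else RtoC 0 else RtoC 0.

Lemma delta0_neq j1 j2 : (j1, j2) <> (0, 0)%Z -> delta0 j1 j2 = RtoC 0.
Proof.
intros H; unfold delta0; destruct (Z.eq_dec j1 0) as [->|]; auto.
destruct (Z.eq_dec j2 0) as [->|]; auto; congruence.
Qed.

Lemma rapid_delta0 : rapid delta0.
Proof.
intros p; exists 1; intros j1 j2.
destruct (Z.eq_dec j1 0) as [->|E]; [destruct (Z.eq_dec j2 0) as [->|E]|].
- unfold delta0; simpl; rewrite Cmod_1; unfold wt.
  replace ((1 + 0 ^ 2) * (1 + 0 ^ 2)) with 1 by ring; rewrite pow1; lra.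
- rewrite delta0_neq by congruence; rewrite Cmod_0; lra.
- rewrite delta0_neq by congruence; rewrite Cmod_0; lra.
Qed.

Lemma series_delta0 x y : fourier_series delta0 x y = RtoC 1.
Proof.
destruct (rapid_qdecay _ rapid_delta0) as [M HM].
apply C_eq_small; intros e He; destruct (wtail_small M e He) as [N HN].
eapply Rle_trans; [|exact HN].
replace (RtoC 1) with (fpart delta0 N x y); [apply fpart_err; auto|].
unfold fpart; rewrite (bsum_delta (G := C_AbelianMonoid) 0 0) by
  (try lia; intros; rewrite delta0_neq by auto; unfold zero; simpl; ring).
rewrite char2_0; unfold delta0; simpl; ring.
Qed.

(** The gauge at a point is its value of [G] divided by [6 L]: a displacement of that size in each
    coordinate costs at most half of the value. Compactness supplies one [e] such that every point
    is this close to a point whose gauge is at least [e], whence the lower bound [3 L e]. *)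
Lemma lipschitz_pos_min (G : R -> R -> R -> R) (L a b c d : R) : 0 < L ->
  (forall h x y h' x' y', Rabs (G h' x' y' - G h x y) <= L * (Rabs (h' - h) + Rabs (x' - x) + Rabs (y' - y))) ->
  (forall h x y, a <= h <= b -> c <= x <= d -> c <= y <= d -> 0 < G h x y) ->
  exists e, 0 < e /\ forall h x y, a <= h <= b -> c <= x <= d -> c <= y <= d -> e <= G h x y.
Proof.
intros HL HG Hp.
(* The value [1] is a default that makes the gauge positive outside the box as well. *)
assert (Hpos : forall u, 0 < if Rlt_dec 0 u then u / (6 * L) else 1).
{ intros u; destruct (Rlt_dec 0 u); [apply Rdiv_lt_0_compat; lra|lra]. }
set (delta := fun t : Compactness.Tn 3 R => mkposreal _ (Hpos (G (fst t) (fst (snd t)) (fst (snd (snd t)))))).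
destruct (compactness_value 3 (a, (c, (c, tt))) (b, (d, (d, tt))) delta) as [e He].
exists (3 * L * e); split; [generalize (cond_pos e); intros; nra|].
intros h x y Hh Hx Hy; apply Rnot_lt_le; intros Hlt.
apply (He (h, (x, (y, tt)))); [simpl; auto|].
intros [[h' [x' [y' []]]] [[B1 [B2 [B3 _]]] [[C1 [C2 [C3 _]]] De]]].
unfold delta in C1, C2, C3, De; cbn [pos fst snd] in C1, C2, C3, De.
assert (P := Hp h' x' y' B1 B2 B3).
destruct (Rlt_dec 0 (G h' x' y')) as [_|N]; [|lra].
set (g := G h' x' y') in *.
assert (Hg : g / (6 * L) * (6 * L) = g) by (field; lra).
set (q := g / (6 * L)) in *.
generalize (HG h x y h' x' y'); fold g.
rewrite (Rabs_minus_sym h'), (Rabs_minus_sym x'), (Rabs_minus_sym y').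
intros K; generalize (Rle_trans _ _ _ (Rle_abs _) K); intros K'.
nra.
Qed.

(** * Continuation from secants to the tangent *)

Lemma rapid_plus a b : rapid a -> rapid b -> rapid (fun j1 j2 => a j1 j2 + b j1 j2)%C.
Proof.
intros Ha Hb p; destruct (Ha p) as [A HA]; destruct (Hb p) as [B HB].
exists (A + B); intros j1 j2.
eapply Rle_trans; [|apply Rplus_le_compat; [apply HA|apply HB]].
rewrite <- Rmult_plus_distr_r; apply Rmult_le_compat_r; [|apply Cmod_triangle].
apply pow_le; generalize (wt_ge_1 j1 j2); lra.
Qed.

Lemma rapid_scal c a : rapid a -> rapid (fun j1 j2 => c * a j1 j2)%C.
Proof. apply (rapid_mul_bdd (fun _ _ => c) (Cmod c)); intros; lra. Qed.

Lemma series_plus a b x y : rapid a -> rapid b ->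
  fourier_series (fun j1 j2 => a j1 j2 + b j1 j2)%C x y = (fourier_series a x y + fourier_series b x y)%C.
Proof.
intros Ha Hb; destruct (rapid_qdecay a Ha) as [A HA]; destruct (rapid_qdecay b Hb) as [B HB].
replace (fun j1 j2 => a j1 j2 + b j1 j2)%C with (fun j1 j2 => RtoC 1 * a j1 j2 + RtoC 1 * b j1 j2)%C
  by (apply fun2_ext; intros; ring).
rewrite (series_lin A B) by auto; ring.
Qed.

Lemma series_scal c a x y : rapid a ->
  fourier_series (fun j1 j2 => c * a j1 j2)%C x y = (c * fourier_series a x y)%C.
Proof.
intros Ha; destruct (rapid_qdecay a Ha) as [A HA].
replace (fun j1 j2 => c * a j1 j2)%C with (fun j1 j2 => c * a j1 j2 + RtoC 0 * a j1 j2)%C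
  by (apply fun2_ext; intros; ring).
rewrite (series_lin A A) by auto; ring.
Qed.

Lemma neg_supp_delta0 k : neg_supp k delta0.
Proof.
intros j1 j2 H; apply delta0_neq; intros E; inversion E; subst.
unfold lfreq in H; lra.
Qed.

Lemma neg_supp_plus k a b : neg_supp k a -> neg_supp k b -> neg_supp k (fun j1 j2 => a j1 j2 + b j1 j2)%C.
Proof. intros Ha Hb j1 j2 H; rewrite Ha, Hb by auto; ring. Qed.

Lemma neg_supp_mul k (mu a : Z -> Z -> C) : neg_supp k a -> neg_supp k (fun j1 j2 => mu j1 j2 * a j1 j2)%C.
Proof. intros Ha j1 j2 H; rewrite Ha by auto; ring. Qed.

Lemma inv_ok_scal k c a : rapid a -> c <> RtoC 0 -> (forall x y, fourier_series a x y <> RtoC 0) ->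
  inv_ok k a -> inv_ok k (fun j1 j2 => c * a j1 j2)%C.
Proof.
intros Ha Hc Hn H f Hf.
replace (fun x y => f x y / fourier_series (fun j1 j2 => c * a j1 j2)%C x y)%C
  with (fun x y => / c * (f x y / fourier_series a x y))%C.
- apply cminus_scal, H, Hf.
- apply fun2_ext; intros x y; rewrite series_scal by auto; field; auto.
Qed.

Lemma inv_ok_delta0 k : inv_ok k delta0.
Proof.
intros f Hf; replace (fun x y => f x y / fourier_series delta0 x y)%C with f; auto.
apply fun2_ext; intros; rewrite series_delta0; field.
Qed.

Lemma series_periodic a (n m : Z) x y :
  fourier_series a (x + IZR n * (2 * PI)) (y + IZR m * (2 * PI)) = fourier_series a x y.
Proof. unfold fourier_series; f_equal; apply fun2_ext; intros; now rewrite char2_period. Qed.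

(* The coefficients of [h + F(x + h, y + k h) - F(x, y)], where [F] is the series of [b]. *)
Definition secant (k : R) (b : Z -> Z -> C) (h : R) (j1 j2 : Z) : C :=
  (RtoC h * delta0 j1 j2 + (char2 j1 j2 h (k * h) - 1) * b j1 j2)%C.

(** The coefficients of [1 + D F], where [F] is the series of [b]; for [F = zeta - alpha] this is
    [zeta_alpha] on the torus. *)
Definition tangent (k : R) (b : Z -> Z -> C) (j1 j2 : Z) : C := (delta0 j1 j2 + dmul k b j1 j2)%C.

Lemma lfreq_eq_0 k j1 j2 : irrational k -> lfreq k j1 j2 = 0 -> (j1, j2) = (0, 0)%Z.
Proof.
intros Hk L; unfold lfreq in L; destruct (Z.eq_dec j2 0) as [->|J2].
- f_equal; apply eq_IZR; lra.
- exfalso; apply (Hk (- j1)%Z j2 J2); rewrite opp_IZR; apply not_0_IZR in J2.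
  apply Rmult_eq_reg_r with (IZR j2); auto; unfold Rdiv; rewrite Rmult_assoc, Rinv_l by auto; lra.
Qed.

Section Homotopy.
Variables (k : R) (b : Z -> Z -> C).
Hypotheses (Hb : rapid b) (Hneg : neg_supp k b).

Lemma rapid_shift_sub h : rapid (fun j1 j2 => (char2 j1 j2 h (k * h) - 1) * b j1 j2)%C.
Proof.
apply (rapid_mul_bdd _ 2); auto; intros j1 j2.
eapply Rle_trans; [apply Cmod_triangle|]; rewrite Cmod_char2, Cmod_opp, Cmod_1; lra.
Qed.

Lemma rapid_secant h : rapid (secant k b h).
Proof. apply rapid_plus; [apply rapid_scal, rapid_delta0|apply rapid_shift_sub]. Qed.

Lemma rapid_tangent : rapid (tangent k b).
Proof. apply rapid_plus; [apply rapid_delta0|apply rapid_dmul; auto]. Qed.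

Lemma neg_supp_secant h : neg_supp k (secant k b h).
Proof. apply neg_supp_plus; apply neg_supp_mul; auto using neg_supp_delta0. Qed.

Lemma neg_supp_tangent : neg_supp k (tangent k b).
Proof. apply neg_supp_plus; [apply neg_supp_delta0|apply neg_supp_mul; auto]. Qed.

Lemma series_secant h x y : fourier_series (secant k b h) x y =
  (RtoC h + fourier_series b (x + h) (y + k * h) - fourier_series b x y)%C.
Proof.
unfold secant; rewrite series_plus, series_scal, series_delta0;
  auto using rapid_scal, rapid_delta0, rapid_shift_sub.
rewrite series_shift.
destruct (rapid_qdecay b Hb) as [M HM].
replace (fun j1 j2 => (char2 j1 j2 h (k * h) - 1) * b j1 j2)%C with
  (fun j1 j2 => b j1 j2 * char2 j1 j2 h (k * h) - b j1 j2)%C by (apply fun2_ext; intros; ring).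
rewrite <- (series_sub M M) by auto using qdecay_char2; ring.
Qed.

Lemma secant_far : exists H, 0 < H /\ forall h x y, H <= h ->
  Cmod (fourier_series (secant k b h) x y - RtoC h)%C <= h / 2.
Proof.
destruct (rapid_qdecay b Hb) as [M HM].
assert (M0 := qdecay_ge_0 M b HM).
assert (W := cw_ge_25).
(* The secant differs from [h] by at most twice the sup norm bound [cw * M], and this is at most
   [h / 2] once [h >= 4 * cw * M]. *)
exists (4 * cw * M + 1); split; [nra|].
intros h x y Hh; rewrite series_secant.
replace (_ - _)%C with (fourier_series b (x + h) (y + k * h) + - fourier_series b x y)%C by ring.
eapply Rle_trans; [apply Cmod_triangle|]; rewrite Cmod_opp.
generalize (series_bound M b (x + h) (y + k * h) HM) (series_bound M b x y HM); lra.
Qed.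

(** The first-order remainder of a character is quadratic in [lfreq * h]; the factor [lfreq ^ 2]
    costs two powers of the weight, which the rapid decay of [b] absorbs. *)
Lemma secant_near : exists B, 0 <= B /\ forall h x y,
  Cmod (fourier_series (secant k b h) x y - RtoC h * fourier_series (tangent k b) x y)%C <= B * h ^ 2.
Proof.
assert (R1 : rapid (fun j1 j2 => RtoC (wt j1 j2) * b j1 j2)%C).
{ apply (rapid_mul _ 1); auto; intros j1 j2; assert (W := wt_ge_1 j1 j2).
  rewrite Cmod_R, Rabs_pos_eq; lra. }
destruct (rapid_bound2 _ R1) as [M [M0 HM]].
assert (W := cw_ge_25).
exists (cw * (2 * (1 + Rabs k) ^ 2 * M)); split.
{ generalize (pow2_ge_0 (1 + Rabs k)); intros.
  apply Rmult_le_pos; [lra|apply Rmult_le_pos; lra]. }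
intros h x y.
rewrite <- series_scal by apply rapid_tangent.
destruct (rapid_qdecay _ (rapid_secant h)) as [M1 H1].
destruct (rapid_qdecay _ (rapid_scal (RtoC h) _ rapid_tangent)) as [M2 H2].
rewrite (series_sub M1 M2) by auto.
rewrite Rmult_assoc; apply series_bound; intros j1 j2.
unfold secant, tangent, dmul.
replace (_ - _)%C with ((char2 j1 j2 h (k * h) - 1 - Ci * RtoC (lfreq k j1 j2 * h)) * b j1 j2)%C.
2: { unfold lfreq; rewrite (RtoC_mult (_ + _) h); ring. }
rewrite Cmod_mult.
eapply Rle_trans; [apply Rmult_le_compat_r, char2_sub_lin_le; apply Cmod_ge_0|].
assert (L : lfreq k j1 j2 ^ 2 <= ((1 + Rabs k) * wt j1 j2) ^ 2).
{ rewrite <- (pow2_abs (lfreq _ _ _)); apply pow_incr; split; [apply Rabs_pos|apply Rabs_l_le_wt]. }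
specialize (HM j1 j2); rewrite Cmod_mult, Cmod_R, (Rabs_pos_eq (wt j1 j2)) in HM
  by (generalize (wt_ge_1 j1 j2); lra).
apply Rle_trans with (2 * ((1 + Rabs k) * wt j1 j2) ^ 2 * h ^ 2 * Cmod (b j1 j2)).
- apply Rmult_le_compat_r; [apply Cmod_ge_0|].
  rewrite Rpow_mult_distr; generalize (pow2_ge_0 h); intros; nra.
- assert (P : 0 <= 2 * (1 + Rabs k) ^ 2 * h ^ 2).
  { generalize (pow2_ge_0 (1 + Rabs k)) (pow2_ge_0 h); intros; nra. }
  generalize (Rmult_le_compat_l _ _ _ P HM); lra.
Qed.

Lemma secant_lipschitz : exists L, 0 < L /\ forall h x y h' x' y',
  Cmod (fourier_series (secant k b h') x' y' - fourier_series (secant k b h) x y)%C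
   <= L * (Rabs (h' - h) + Rabs (x' - x) + Rabs (y' - y)).
Proof.
destruct (series_lipschitz b Hb) as [L [L0 HL]].
exists (1 + L * (2 + Rabs k)); split; [generalize (Rabs_pos k); nra|].
intros h x y h' x' y'; rewrite !series_secant.
replace (_ - _)%C with (RtoC (h' - h) +
  ((fourier_series b (x' + h') (y' + k * h') - fourier_series b (x + h) (y + k * h))
   + - (fourier_series b x' y' - fourier_series b x y)))%C by (rewrite RtoC_minus; ring).
eapply Rle_trans; [apply Cmod_triangle|].
eapply Rle_trans; [apply Rplus_le_compat_l, Cmod_triangle|].
rewrite Cmod_opp, Cmod_R.
assert (A := HL (x + h) (y + k * h) (x' + h') (y' + k * h')).
assert (B := HL x y x' y').
assert (C1 : Rabs (x' + h' - (x + h)) <= Rabs (x' - x) + Rabs (h' - h)).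
{ replace (x' + h' - (x + h)) with ((x' - x) + (h' - h)) by ring; apply Rabs_triang. }
assert (C2 : Rabs (y' + k * h' - (y + k * h)) <= Rabs (y' - y) + Rabs k * Rabs (h' - h)).
{ replace (y' + k * h' - (y + k * h)) with ((y' - y) + k * (h' - h)) by ring.
  rewrite <- Rabs_mult; apply Rabs_triang. }
generalize (Rabs_pos k) (Rabs_pos (h' - h)) (Rabs_pos (x' - x)) (Rabs_pos (y' - y)); intros.
set (p := Rabs (h' - h)) in *; set (q := Rabs (x' - x)) in *; set (r := Rabs (y' - y)) in *.
assert (D : L * (Rabs (x' + h' - (x + h)) + Rabs (y' + k * h' - (y + k * h)))
   <= L * (q + p + (r + Rabs k * p))) by (apply Rmult_le_compat_l; lra).
assert (0 <= L * Rabs k * q) by (repeat apply Rmult_le_pos; auto).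
assert (0 <= L * Rabs k * r) by (repeat apply Rmult_le_pos; auto).
assert (0 <= L * p) by (apply Rmult_le_pos; auto).
lra.
Qed.

Hypothesis Hinj : forall h x y, 0 < h ->
  (RtoC h + fourier_series b (x + h) (y + k * h) - fourier_series b x y <> RtoC 0)%C.
Hypothesis Htan : forall x y, fourier_series (tangent k b) x y <> RtoC 0.

Lemma tangent_min : exists d, 0 < d /\ forall x y, d <= Cmod (fourier_series (tangent k b) x y).
Proof.
destruct (series_lipschitz _ rapid_tangent) as [L [L0 HL]].
(* The first variable is a dummy ranging over [[0, 1]]. *)
destruct (lipschitz_pos_min (fun _ x y => Cmod (fourier_series (tangent k b) x y)) (1 + L) 0 1 0 (2 * PI))
  as [d [D0 D]].
- lra.
- intros h x y h' x' y'.
  eapply Rle_trans; [|eapply Rle_trans; [apply (HL x y x' y')|]].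
  + set (u := fourier_series _ x' y'); set (v := fourier_series _ x y); apply Rabs_le; split.
    * assert (T := Cmod_triangle u (v - u)).
      replace (u + (v - u))%C with v in T by ring.
      replace (v - u)%C with (- (u - v))%C in T by ring; rewrite Cmod_opp in T; lra.
    * assert (T := Cmod_triangle v (u - v)).
      replace (v + (u - v))%C with u in T by ring; lra.
  + generalize (Rabs_pos (h' - h)) (Rabs_pos (x' - x)) (Rabs_pos (y' - y)); intros; nra.
- intros; apply Cmod_gt_0, Htan.
- exists d; split; auto; intros x y.
  destruct (period_reduce x) as [n Hn]; destruct (period_reduce y) as [m Hm].
  rewrite <- (series_periodic _ n m); apply (D 0); lra.
Qed.

(** The range of [h] must stay away from [0], where the secants themselves tend to zero. *)
Lemma secant_min h1 h2 : 0 < h1 -> exists d, 0 < d /\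
  forall h x y, h1 <= h <= h2 -> d <= Cmod (fourier_series (secant k b h) x y).
Proof.
intros H1.
destruct secant_lipschitz as [L [L0 HL]].
destruct (lipschitz_pos_min (fun h x y => Cmod (fourier_series (secant k b h) x y)) L h1 h2 0 (2 * PI))
  as [d [D0 D]].
- lra.
- intros h x y h' x' y'.
  eapply Rle_trans; [|apply HL].
  set (u := fourier_series _ x' y'); set (v := fourier_series _ x y); apply Rabs_le; split.
  + assert (T := Cmod_triangle u (v - u)).
    replace (u + (v - u))%C with v in T by ring.
    replace (v - u)%C with (- (u - v))%C in T by ring; rewrite Cmod_opp in T; lra.
  + assert (T := Cmod_triangle v (u - v)).
    replace (v + (u - v))%C with u in T by ring; lra.
- intros h x y Hh _ _; apply Cmod_gt_0; rewrite series_secant; apply Hinj; lra.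
- exists d; split; auto; intros h x y Hh.
  destruct (period_reduce x) as [n Hn]; destruct (period_reduce y) as [m Hm].
  rewrite <- (series_periodic _ n m); apply (D h); lra.
Qed.

(* Continuation in [h]: invertibility is clear for large [h], is preserved by small steps,
   and passes to the tangent as [h] tends to [0]. *)
Lemma inv_ok_tangent : inv_ok k (tangent k b).
Proof.
destruct secant_far as [H0 [H0p Hfar]].
destruct secant_near as [B [B0 Hnear]].
destruct tangent_min as [d0 [D0 Hd0]].
(* Chosen so that the secant at [h1] differs from [h1] times the tangent by at most
   [B h1 ^ 2 <= h1 d0 / 4], which is less than half the modulus of the secant: the last step of the
   continuation. *)
set (h1 := Rmin (d0 / (4 * (B + 1))) H0).
assert (P1 : 0 < h1) by (apply Rmin_pos; auto; apply Rdiv_lt_0_compat; lra).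
assert (P2 : h1 <= H0) by apply Rmin_r.
assert (P3 : B * h1 <= d0 / 4).
{ assert (E : h1 <= d0 / (4 * (B + 1))) by apply Rmin_l.
  assert (E2 : d0 / (4 * (B + 1)) * (4 * (B + 1)) = d0) by (field; lra).
  nra. }
clearbody h1.
destruct (secant_min h1 H0 P1) as [d [Dp Hd]].
destruct secant_lipschitz as [L [L0 HL]].
(* The base is the constant [H0], by which division is harmless and from which the secant at [H0]
   differs by at most [H0 / 2]. *)
assert (Start : inv_ok k (secant k b H0)).
{ destruct (rapid_qdecay _ (rapid_scal (RtoC H0) _ rapid_delta0)) as [M1 M1H].
  destruct (rapid_qdecay _ (rapid_secant H0)) as [M2 M2H].
  assert (E : forall x y, fourier_series (fun j1 j2 => RtoC H0 * delta0 j1 j2)%C x y = RtoC H0).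
  { intros; rewrite series_scal, series_delta0 by apply rapid_delta0; ring. }
  apply (inv_ok_step k M1 M2 (fun j1 j2 => RtoC H0 * delta0 j1 j2)%C _ (Rmin d H0) M1H M2H).
  - apply neg_supp_mul, neg_supp_delta0.
  - apply neg_supp_secant.
  - apply inv_ok_scal; auto using rapid_delta0, inv_ok_delta0.
    + intros F; apply (f_equal Re) in F; simpl in F; lra.
    + intros x y; rewrite series_delta0; intros F; apply (f_equal Re) in F; simpl in F; lra.
  - apply Rmin_pos; auto.
  - intros x y; eapply Rle_trans; [apply Rmin_l|apply Hd; lra].
  - intros x y; rewrite E, Cmod_R, Rabs_pos_eq by lra; apply Rmin_r.
  - intros x y; rewrite E, Cmod_R, (Rabs_pos_eq H0) by lra.
    replace (RtoC H0 - fourier_series (secant k b H0) x y)%C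
      with (- (fourier_series (secant k b H0) x y - RtoC H0))%C by ring.
    rewrite Cmod_opp; apply Hfar; lra. }
(* The number of steps is such that one step of length [tau] changes the secant by at most
   [L tau <= d / 2], half of its minimal modulus. *)
destruct (INR_unbounded (2 * L * (H0 - h1) / d)) as [N HN].
assert (HNpos : 0 <= 2 * L * (H0 - h1) / d).
{ apply Rmult_le_pos; [nra|left; apply Rinv_0_lt_compat; auto]. }
assert (NP : 0 < INR N) by lra.
set (tau := (H0 - h1) / INR N).
assert (T0 : 0 <= tau) by (apply Rmult_le_pos; [lra|left; apply Rinv_0_lt_compat; auto]).
assert (TN : INR N * tau = H0 - h1) by (unfold tau; field; lra).
assert (TL : L * tau <= d / 2).
{ apply Rmult_le_reg_l with (INR N); auto.
  replace (INR N * (L * tau)) with (L * (H0 - h1)) by (rewrite <- TN; ring).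
  apply Rmult_lt_compat_r with (r := d) in HN; auto.
  unfold Rdiv in HN; rewrite Rmult_assoc, Rinv_l in HN by lra; lra. }
assert (Mid : forall n, (n <= N)%nat -> inv_ok k (secant k b (H0 - INR n * tau))).
{ induction n; intros Hn.
  - simpl; rewrite Rmult_0_l, Rminus_0_r; auto.
  - assert (Hn' : INR (S n) <= INR N) by (apply le_INR; lia).
    rewrite S_INR in *.
    assert (I1 : (INR n + 1) * tau <= INR N * tau) by (apply Rmult_le_compat_r; auto).
    assert (I2 : 0 <= INR n * tau) by (apply Rmult_le_pos; auto using pos_INR).
    destruct (rapid_qdecay _ (rapid_secant (H0 - INR n * tau))) as [M1 M1H].
    destruct (rapid_qdecay _ (rapid_secant (H0 - (INR n + 1) * tau))) as [M2 M2H].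
    apply (inv_ok_step k M1 M2 (secant k b (H0 - INR n * tau)) _ d M1H M2H (neg_supp_secant _) (neg_supp_secant _) (IHn ltac:(lia)) Dp).
    + intros x y; apply Hd; lra.
    + intros x y; apply Hd; lra.
    + intros x y.
      eapply Rle_trans; [apply HL|].
      rewrite !Rminus_diag, Rabs_R0, !Rplus_0_r.
      replace (H0 - INR n * tau - (H0 - (INR n + 1) * tau)) with tau by ring.
      rewrite Rabs_pos_eq by auto.
      assert (K := Hd (H0 - INR n * tau) x y ltac:(lra)); lra. }
specialize (Mid N (le_n N)); rewrite TN in Mid.
replace (H0 - (H0 - h1)) with h1 in Mid by ring.
assert (Sc : inv_ok k (fun j1 j2 => RtoC h1 * tangent k b j1 j2)%C).
{ destruct (rapid_qdecay _ (rapid_secant h1)) as [M1 M1H].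
  destruct (rapid_qdecay _ (rapid_scal (RtoC h1) _ rapid_tangent)) as [M2 M2H].
  assert (E : forall x y, fourier_series (fun j1 j2 => RtoC h1 * tangent k b j1 j2)%C x y
     = (RtoC h1 * fourier_series (tangent k b) x y)%C).
  { intros; rewrite series_scal by apply rapid_tangent; ring. }
  apply (inv_ok_step k M1 M2 (secant k b h1) _ (Rmin d (h1 * d0)) M1H M2H).
  - apply neg_supp_secant.
  - apply neg_supp_mul, neg_supp_tangent.
  - exact Mid.
  - apply Rmin_pos; auto; apply Rmult_lt_0_compat; auto.
  - intros x y; eapply Rle_trans; [apply Rmin_r|].
    rewrite E, Cmod_mult, Cmod_R, Rabs_pos_eq by lra; apply Rmult_le_compat_l; auto; lra.
  - intros x y; eapply Rle_trans; [apply Rmin_l|apply Hd; lra].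
  - intros x y; rewrite E; assert (N1 := Hnear h1 x y).
    set (u := fourier_series (secant k b h1) x y) in *.
    set (v := (RtoC h1 * fourier_series (tangent k b) x y)%C) in *.
    assert (V : h1 * d0 <= Cmod v).
    { unfold v; rewrite Cmod_mult, Cmod_R, Rabs_pos_eq by lra; apply Rmult_le_compat_l; auto; lra. }
    assert (T := Cmod_triangle u (- (u - v))).
    replace (u + - (u - v))%C with v in T by ring; rewrite Cmod_opp in T.
    assert (BB : B * h1 ^ 2 <= h1 * d0 / 4) by nra.
    clearbody u v; clear - N1 V T BB.
    assert (U0 := Cmod_ge_0 u).
    set (D := Cmod (u - v)%C) in *; set (p := h1 * d0) in *; set (q := B * h1 ^ 2) in *.
    clearbody D p q; lra. }
replace (tangent k b) with (fun j1 j2 => / RtoC h1 * (RtoC h1 * tangent k b j1 j2))%C.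
- assert (NH : RtoC h1 <> RtoC 0) by (intros F; apply (f_equal Re) in F; simpl in F; lra).
  apply inv_ok_scal; auto.
  + apply rapid_scal, rapid_tangent.
  + intros F; apply (f_equal (fun z => z * RtoC h1)%C) in F.
    rewrite Cinv_l in F by auto; apply (f_equal Re) in F; simpl in F; lra.
  + intros x y; rewrite series_scal by apply rapid_tangent; apply Cmult_neq_0; auto.
- apply fun2_ext; intros; field; intros F; apply (f_equal Re) in F; simpl in F; lra.
Qed.

(** For the mean, the product of the tangent with its reciprocal is expanded at frequency zero: a
    term with [lfreq > 0] has a vanishing tangent coefficient, a term with [lfreq < 0] pairs with a
    positive frequency of the reciprocal, and irrationality leaves only the origin, where the
    tangent has coefficient [1]. *)
Lemma inverse_tangent : irrational k -> let g := (fun x y => / fourier_series (tangent k b) x y)%C in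
  cminus k g /\ ccoef g 0 0 = RtoC 1.
Proof.
intros Hk g.
assert (Hg : cminus k g).
{ replace g with (fun x y => RtoC 1 / fourier_series (tangent k b) x y)%C.
  - apply inv_ok_tangent, cminus_one.
  - apply fun2_ext; intros; unfold g, Cdiv; ring. }
split; auto.
destruct (rapid_qdecay _ rapid_tangent) as [M HM].
assert (T00 : tangent k b 0 0 = RtoC 1).
{ unfold tangent, dmul, delta0; simpl; rewrite Rmult_0_l, Rplus_0_l; ring. }
assert (E1 : ccoef (fun x y => fourier_series (tangent k b) x y * g x y)%C 0 0 = ccoef g 0 0).
{ destruct Hg as [Cg [[K HK] Zg]].
  apply (ccoef_series_mult M _ g K 0 0 _ 0); auto.
  intros N _; rewrite (bsum_delta (G := C_AbelianMonoid) 0 0); try lia.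
  - rewrite T00; simpl; ring.
  - intros j1 j2 Hj; destruct (total_order_T (lfreq k j1 j2) 0) as [[L|L]|L].
    + rewrite Zg; [unfold zero; simpl; ring|unfold lfreq in *; rewrite !minus_IZR; lra].
    + exfalso; apply Hj, (lfreq_eq_0 k); auto.
    + rewrite neg_supp_tangent by auto; unfold zero; simpl; ring. }
rewrite <- E1.
replace (fun x y => fourier_series (tangent k b) x y * g x y)%C with (fun _ _ : R => RtoC 1).
- rewrite ccoef_one; reflexivity.
- apply fun2_ext; intros; unfold g; field; auto.
Qed.
End Homotopy.

(** * Quasi-periodic lifts *)

(** A step of Euclid's algorithm: unless the remainder of [v] modulo [g] is zero, either it or its
    complement to [g] lies in [(0, g / 2]]. *)
Lemma ZplusZk_step k g v : 0 < g -> (exists n m : Z, g = k * IZR n + IZR m) ->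
  (exists n m : Z, v = k * IZR n + IZR m) ->
  (exists q : Z, v = IZR q * g) \/
  exists n m : Z, 0 < k * IZR n + IZR m <= g / 2.
Proof.
intros Hg [n [m Eg]] [n' [m' Ev]].
set (q := Int_part (v / g)).
destruct (base_Int_part (v / g)) as [H1 H2]; fold q in H1, H2.
assert (E : v / g * g = v) by (field; lra).
assert (R0 : 0 <= v - IZR q * g) by nra.
assert (R1 : v - IZR q * g < g) by nra.
destruct (Req_dec (v - IZR q * g) 0) as [Z|Z]; [left; exists q; lra|right].
destruct (Rle_lt_dec (v - IZR q * g) (g / 2)).
- exists (n' - q * n)%Z, (m' - q * m)%Z; rewrite !minus_IZR, !mult_IZR.
  replace (k * (IZR n' - IZR q * IZR n) + (IZR m' - IZR q * IZR m)) with (v - IZR q * g)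
    by (rewrite Ev, Eg; ring); lra.
- exists (n - (n' - q * n))%Z, (m - (m' - q * m))%Z; rewrite !minus_IZR, !mult_IZR.
  replace (k * (IZR n - (IZR n' - IZR q * IZR n)) + (IZR m - (IZR m' - IZR q * IZR m)))
    with (g - (v - IZR q * g)) by (rewrite Ev, Eg; ring); lra.
Qed.

(** Halving can fail only if both [1] and [k] are integer multiples of the current element, and
    their quotient would then be rational. *)
Lemma ZplusZk_small k N : irrational k -> exists n m : Z, 0 < k * IZR n + IZR m <= (/ 2) ^ N.
Proof.
intros Hk; induction N as [|N [n [m [G0 G1]]]].
- exists 0%Z, 1%Z; simpl; lra.
- set (g := k * IZR n + IZR m) in *.
  assert (Eg : exists n m : Z, g = k * IZR n + IZR m) by (exists n, m; auto).
  destruct (ZplusZk_step k g 1 G0 Eg) as [[q1 E1]|[n' [m' H']]].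
  { exists 0%Z, 1%Z; ring. }
  2: { exists n', m'; simpl; lra. }
  destruct (ZplusZk_step k g k G0 Eg) as [[q2 E2]|[n' [m' H']]].
  { exists 1%Z, 0%Z; ring. }
  2: { exists n', m'; simpl; lra. }
  exfalso; apply (Hk q2 q1).
  + intros ->; rewrite Rmult_0_l in E1; lra.
  + assert (Q : IZR q1 <> 0) by (intros F; rewrite F in E1; lra).
    apply Rmult_eq_reg_r with (IZR q1); auto.
    unfold Rdiv; rewrite Rmult_assoc, Rinv_l, Rmult_1_r by auto.
    rewrite E2 at 1; rewrite Rmult_assoc, (Rmult_comm g), <- E1; ring.
Qed.

Lemma ZplusZk_dense k t e : irrational k -> 0 < e ->
  exists n m : Z, Rabs (k * IZR n + IZR m - t) < e.
Proof.
intros Hk He.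
destruct (pow_lt_1_zero (/ 2)) with (y := e) as [N HN]; auto.
{ rewrite Rabs_pos_eq; lra. }
specialize (HN N (le_n N)).
rewrite Rabs_pos_eq in HN by (apply pow_le; lra).
destruct (ZplusZk_small k N Hk) as [n [m [G0 G1]]].
set (g := k * IZR n + IZR m) in *.
set (q := Int_part (t / g)).
destruct (base_Int_part (t / g)) as [H1 H2]; fold q in H1, H2.
assert (E : t / g * g = t) by (field; lra).
exists (q * n)%Z, (q * m)%Z; rewrite !mult_IZR.
replace (k * (IZR q * IZR n) + IZR q * IZR m - t) with (IZR q * g - t) by (unfold g; ring).
apply Rabs_def1; nra.
Qed.

(** Advancing the first variable by [2 PI n] moves the second by [2 PI k n]; modulo periods the line
    thus meets the vertical through [(x, y)] in a dense set, and continuity does the rest. *)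
Lemma torus_fun_line_eq_0 k theta w : irrational k -> torus_fun w ->
  (forall a, w a (theta + k * a) = 0) -> forall x y, w x y = 0.
Proof.
intros Hk Hw H x y; apply NNPP; intros N.
assert (P := two_PI_pos).
destruct (torus_fun_cont2 w Hw x y (mkposreal _ (Rabs_pos_lt _ N))) as [d Hd]; simpl in Hd.
destruct (ZplusZk_dense k ((y - theta - k * x) / (2 * PI)) (d / (2 * PI)) Hk) as [n [m Hnm]].
{ apply Rdiv_lt_0_compat; auto; apply cond_pos. }
specialize (H (x + IZR n * (2 * PI))).
rewrite <- (torus_fun_period w (- n) m) in H by auto.
replace (x + IZR n * (2 * PI) + IZR (- n) * (2 * PI)) with x in H by (rewrite opp_IZR; ring).
set (y' := theta + _ + _) in H.
assert (K := Hd x y'); rewrite Rminus_diag, Rabs_R0, H, Rminus_0_l, Rabs_Ropp in K.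
assert (F : Rabs (y' - y) < d).
{ replace (y' - y) with (2 * PI * (k * IZR n + IZR m - (y - theta - k * x) / (2 * PI)))
    by (unfold y'; field; lra).
  rewrite Rabs_mult, (Rabs_pos_eq (2 * PI)) by lra.
  apply Rmult_lt_compat_l with (r := 2 * PI) in Hnm; auto.
  replace (2 * PI * (d / (2 * PI))) with (pos d) in Hnm by (field; lra); auto. }
generalize (K (cond_pos d) F); lra.
Qed.

Definition line (k theta : R) (U : R -> R -> R) (a : R) : R := U a (theta + k * a).

(** [epsilon] picks some continuous representative, and two of them agree on a dense line, hence
    everywhere. *)
Lemma qp_lift_line k theta U : irrational k -> torus_fun U -> qp_lift k theta (line k theta U) = U.
Proof.
intros Hk HU; unfold qp_lift.
assert (S := epsilon_spec (inhabits (fun _ _ : R => 0))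
  (fun V => torus_fun V /\ qp_rep k theta V (line k theta U))
  (ex_intro _ U (conj HU (fun a => eq_refl)))).
set (V := epsilon _ _) in *; destruct S as [HV E].
apply fun2_ext; intros x y.
assert (D := torus_fun_line_eq_0 k theta (fun x y => V x y + -1 * U x y) Hk).
cbv beta in D; apply Rminus_diag_uniq; unfold Rminus; rewrite <- (D ltac:(apply torus_fun_plus, torus_fun_mult; auto using torus_fun_const) ltac:(intros a; rewrite <- (E a); unfold line; ring) x y); ring.
Qed.

Lemma qp_H_line k theta U : irrational k -> torus_fun U ->
  qp_H k theta (line k theta U) = line k theta (torus_H k U).
Proof. intros Hk HU; apply functional_extensionality; intros a; unfold qp_H; now rewrite qp_lift_line. Qed.

Lemma Derive_line k theta U : torus_Cn 1 U -> Derive (line k theta U) = line k theta (torus_D k U).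
Proof.
intros HU; apply functional_extensionality; intros a; apply is_derive_unique.
apply (torus_D_line k theta U a HU).
Qed.

(** The moving point travels in the direction [(1, k)], along which [torus_D] is the derivative. *)
Lemma is_derive_moving k U (al : R -> R) (t x y l : R) : torus_Cn 1 U -> is_derive al t l ->
  is_derive (fun s => U (x - al s) (y - k * al s)) t (- l * torus_D k U (x - al t) (y - k * al t)).
Proof.
intros HU Hl.
assert (K := torus_Cn_line k U (x - al t) (y - k * al t) 1 HU); rewrite !Rmult_1_l in K.
set (D := torus_D k U (x - al t) (y - k * al t)) in *.
assert (E : is_derive (fun s => al t - al s) t (- l)).
{ replace (- l) with (minus 0 l) by (unfold minus, plus, opp; simpl; ring).
  apply (is_derive_minus (V := R_NormedModule) (fun _ => al t) al); auto.
  apply (is_derive_const (V := R_NormedModule)). }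
replace 0 with (al t - al t) in K by ring.
assert (C := is_derive_comp (fun s => U (x - al t + 1 * s) (y - k * al t + k * s)) (fun s => al t - al s) t D (- l) K E).
assert (X : forall s : R, U (x - al t + 1 * (al t - al s)) (y - k * al t + k * (al t - al s))
   = U (x - al s) (y - k * al s)) by (intros; f_equal; ring).
apply (is_derive_ext _ _ _ _ X C).
Qed.

Section Inverse.
Variables (k : R) (a : Z -> Z -> C).
Hypotheses (Ha : rapid a) (Hh : herm a) (Hk : irrational k).

Definition eta_t := rser a.
Definition xi_t := rser (hmul k a).
Definition E_t := rser (dmul k a).
Definition X_t (x y : R) := 1 + rser (dmul k (hmul k a)) x y.
Definition J_t (x y : R) := X_t x y ^ 2 + E_t x y ^ 2.
(** The coefficients of [xi + i eta], that is of [zeta - alpha]. *)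
Definition zcoef (j1 j2 : Z) : C := (hmul k a j1 j2 + Ci * a j1 j2)%C.

Lemma rapid_zcoef : rapid zcoef.
Proof. apply rapid_plus; [apply rapid_hmul; auto|apply rapid_scal; auto]. Qed.

(** At a positive frequency [H] is multiplication by [- i], which cancels the [i] in front of
    [eta]. *)
Lemma neg_supp_zcoef : neg_supp k zcoef.
Proof.
intros j1 j2 H; unfold zcoef, hmul; unfold lfreq in H; rewrite sign_eq_1 by auto; ring.
Qed.

Lemma series_zcoef x y : fourier_series zcoef x y = (RtoC (xi_t x y) + Ci * RtoC (eta_t x y))%C.
Proof.
unfold zcoef; rewrite series_plus, series_scal, !series_herm; auto using rapid_hmul, rapid_scal, herm_hmul.
Qed.

Lemma series_tangent x y : fourier_series (tangent k zcoef) x y = (RtoC (X_t x y) + Ci * RtoC (E_t x y))%C.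
Proof.
replace (tangent k zcoef) with
  (fun j1 j2 => delta0 j1 j2 + (dmul k (hmul k a) j1 j2 + Ci * dmul k a j1 j2))%C.
- rewrite !series_plus, series_scal, series_delta0, !series_herm;
    auto using rapid_hmul, rapid_dmul, rapid_scal, rapid_plus, rapid_delta0, herm_hmul, herm_dmul.
  unfold X_t, E_t; rewrite RtoC_plus; ring.
- apply fun2_ext; intros; unfold tangent, dmul, zcoef; ring.
Qed.

Lemma torus_Cn_X n : torus_Cn n X_t.
Proof. apply torus_Cn_plus; [apply torus_Cn_const|apply torus_Cn_rser; auto using rapid_dmul, rapid_hmul]. Qed.

Lemma torus_Cn_E n : torus_Cn n E_t.
Proof. apply torus_Cn_rser; auto using rapid_dmul. Qed.

Lemma torus_Cn_J n : torus_Cn n J_t.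
Proof.
apply torus_Cn_plus; repeat apply torus_Cn_mult; auto using torus_Cn_X, torus_Cn_E, torus_Cn_const.
Qed.

Hypothesis Hinj : forall h x y, 0 < h ->
  (RtoC h + fourier_series zcoef (x + h) (y + k * h) - fourier_series zcoef x y <> RtoC 0)%C.
Hypothesis HJ : forall x y, J_t x y <> 0.

(* The reciprocal of the tangent has no positive frequencies and mean [1]; its real and
   imaginary parts [X / J] and [- E / J] are therefore conjugate up to the constant. *)
Lemma conjugate_inverse : exists M p, qdecay M p /\ herm p /\
  (forall x y, E_t x y / J_t x y = rser p x y) /\
  (forall x y, X_t x y / J_t x y = 1 - rser (hmul k p) x y).
Proof.
assert (Htan : forall x y, fourier_series (tangent k zcoef) x y <> RtoC 0).
{ intros x y F; rewrite series_tangent in F.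
  assert (F1 := f_equal Re F); assert (F2 := f_equal Im F); simpl in F1, F2.
  apply (HJ x y); unfold J_t; replace (X_t x y) with 0 by lra; replace (E_t x y) with 0 by lra; ring. }
destruct (inverse_tangent k zcoef rapid_zcoef neg_supp_zcoef Hinj Htan Hk) as [[Cg [_ Zg]] G0].
set (g := fun x y => (/ fourier_series (tangent k zcoef) x y)%C) in *.
set (chi := fun x y => E_t x y * / J_t x y).
set (rho := fun x y => X_t x y * / J_t x y).
assert (Tc : torus_Cn 4 chi) by (apply torus_Cn_mult; [apply torus_Cn_E|apply torus_Cn_inv; auto using torus_Cn_J]).
assert (Tr : torus_Cn 4 rho) by (apply torus_Cn_mult; [apply torus_Cn_X|apply torus_Cn_inv; auto using torus_Cn_J]).
assert (Cc := torus_fun_cont2 _ (torus_Cn_fun _ _ Tc)).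
assert (Cr := torus_fun_cont2 _ (torus_Cn_fun _ _ Tr)).
destruct (qdecay_fcoef chi Tc) as [M HM].
exists M, (fcoef chi); split; auto; split; [apply herm_fcoef; auto|].
assert (Ic := fourier_inversion chi Tc); assert (Ir := fourier_inversion rho Tr).
assert (Hc := herm_fcoef chi Cc); assert (Hr := herm_fcoef rho Cr).
(* Here [1 / (X + i E) = (X - i E) / J] is read on the level of coefficients. *)
assert (Eg : forall m1 m2, ccoef g m1 m2 = (fcoef rho m1 m2 + (- Ci) * fcoef chi m1 m2)%C).
{ intros m1 m2; rewrite !fcoef_ccoef, <- ccoef_scal, <- ccoef_plus;
    auto using ccont_RtoC, ccont_mult, ccont_const.
  f_equal; apply fun2_ext; intros x y; unfold g, rho, chi.
  rewrite series_tangent; generalize (HJ x y); unfold J_t; intros N.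
  apply C_ext; simpl; field; intros F; apply N; rewrite <- F; ring. }
split; [intros x y; apply (f_equal (fun f => f x y) Ic)|].
intros x y; change (rho x y = 1 - rser (hmul k (fcoef chi)) x y).
(* Positive frequencies come from the vanishing coefficients of [g], negative ones from these by
   conjugation. At the origin the means of [rho] and [chi] are real, so mean [1] for [g] is mean [1]
   for [rho]. *)
assert (Er : fcoef rho = fun j1 j2 => (RtoC 1 * delta0 j1 j2 + RtoC (-1) * hmul k (fcoef chi) j1 j2)%C).
{ apply fun2_ext; intros j1 j2; unfold hmul.
  destruct (total_order_T (lfreq k j1 j2) 0) as [[L|L]|L].
  - assert (L2 : 0 < lfreq k (- j1) (- j2)) by (unfold lfreq in *; rewrite !opp_IZR; lra).
    assert (E := Zg _ _ L2); rewrite Eg, Hr, Hc in E.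
    rewrite delta0_neq by (intros F; inversion F; subst; unfold lfreq in L; lra).
    unfold lfreq in L; rewrite sign_eq_m1 by auto.
    assert (E1 := f_equal Re E); assert (E2 := f_equal Im E); simpl in E1, E2.
    apply C_ext; simpl; lra.
  - apply (lfreq_eq_0 k) in L; auto; inversion L; subst.
    rewrite Rmult_0_l, Rplus_0_l, sign_0.
    assert (E := Eg 0%Z 0%Z); rewrite G0 in E.
    assert (R0 : Im (fcoef rho 0 0) = 0).
    { generalize (f_equal Im (Hr 0 0)%Z).
      change (fcoef rho (- 0) (- 0)) with (fcoef rho 0 0); destruct (fcoef rho 0 0); simpl; lra. }
    assert (C0 : Im (fcoef chi 0 0) = 0).
    { generalize (f_equal Im (Hc 0 0)%Z).
      change (fcoef chi (- 0) (- 0)) with (fcoef chi 0 0); destruct (fcoef chi 0 0); simpl; lra. }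
    change (delta0 0 0) with (RtoC 1).
    destruct (fcoef rho 0 0) as [r1 r2]; destruct (fcoef chi 0 0) as [c1 c2].
    assert (E1 := f_equal Re E); simpl in E1, R0, C0; apply C_ext; simpl; lra.
  - assert (E := Zg _ _ L); rewrite Eg in E.
    rewrite delta0_neq by (intros F; inversion F; subst; unfold lfreq in L; lra).
    unfold lfreq in L; rewrite sign_eq_1 by auto.
    assert (E1 := f_equal Re E); assert (E2 := f_equal Im E); simpl in E1, E2.
    apply C_ext; simpl; lra. }
rewrite Ir, Er.
destruct (rapid_qdecay _ rapid_delta0) as [M' HM'].
unfold rser; rewrite (series_lin M' M) by auto using qdecay_hmul.
rewrite series_delta0; simpl; ring.
Qed.
End Inverse.

(** * The traveling wave *)

Lemma Derive_plus_const (f : R -> R) (d x : R) : Derive (fun x => f x + d) x = Derive f x.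
Proof. unfold Derive; f_equal; apply Lim_ext; intros h; f_equal; ring. Qed.

Lemma torus_D_plus_const k u d : torus_D k (fun x y => u x y + d) = torus_D k u.
Proof.
apply fun2_ext; intros x y; unfold torus_D, d1, d2.
now rewrite (Derive_plus_const (fun x => u x y)), (Derive_plus_const (fun y => u x y)).
Qed.

Lemma torus_D_scal k r u : torus_D k (fun x y => r * u x y) = fun x y => r * torus_D k u x y.
Proof.
apply fun2_ext; intros x y; unfold torus_D, d1, d2.
rewrite (Derive_scal (fun x => u x y)), (Derive_scal (fun y => u x y)); ring.
Qed.

Lemma sign_sqr_neq_0 x : x <> 0 -> sign x * sign x = 1.
Proof.
intros H; destruct (total_order_T x 0) as [[L|L]|L].
- rewrite sign_eq_m1 by auto; ring.
- lra.
- rewrite sign_eq_1 by auto; ring.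
Qed.

Lemma Re_cartesian_shift (u v w : R) : Re (RtoC u + Ci * RtoC v + RtoC w)%C = u + w.
Proof. simpl; ring. Qed.

Lemma Im_cartesian_shift (u v w : R) : Im (RtoC u + Ci * RtoC v + RtoC w)%C = v.
Proof. simpl; ring. Qed.

Section Wave.
(** The coefficients [p] are those of [E / J], and [K] is the Bernoulli constant, the mean that [P]
    subtracts in the traveling wave equation. *)
Variables (k c g tau M K : R) (a p : Z -> Z -> C) (alpha0 : R -> R).
Hypotheses (Ha : rapid a) (Hh : herm a) (Hk : irrational k)
  (Hp : qdecay M p) (Hph : herm p)
  (HJ : forall x y, J_t k a x y <> 0)
  (Hchi : forall x y, E_t k a x y / J_t k a x y = rser p x y)
  (Hrho : forall x y, X_t k a x y / J_t k a x y = 1 - rser (hmul k p) x y)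
  (Hwave : forall x y, c ^ 2 / (2 * J_t k a x y) + g * eta_t a x y
     - tau * torus_kappa k (X_t k a) (eta_t a) x y = K)
  (Hal : forall t, ex_derive alpha0 t).

Let eta := eta_t a.
Let xi := xi_t k a.
Let E := E_t k a.
Let X := X_t k a.
Let J := J_t k a.
Let kap := torus_kappa k X eta.
(** The coefficients of [chi = psi_alpha / J = c E / J]; [hp] below is [H[chi]]. *)
Let pc (j1 j2 : Z) : C := (RtoC c * p j1 j2)%C.
Let m0 := Re (a 0%Z 0%Z).
Let cxi (x y : R) := c * xi x y.
Let tpsi (x y : R) := c * eta x y - c * m0.
Let hp (x y : R) := c * rser (hmul k p) x y.

Lemma qdecay_pc : qdecay (Rabs c * M) pc.
Proof.
intros j1 j2; unfold pc; rewrite Cmod_mult, Cmod_R, Rmult_assoc.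
apply Rmult_le_compat_l; [apply Rabs_pos|apply Hp].
Qed.

Lemma herm_pc : herm pc.
Proof. intros j1 j2; unfold pc; rewrite Hph; apply C_ext; simpl; ring. Qed.

Lemma rser_scal_qdecay r M' b x y : qdecay M' b -> rser (fun j1 j2 => RtoC r * b j1 j2)%C x y = r * rser b x y.
Proof.
intros Hb; unfold rser.
replace (fun j1 j2 => RtoC r * b j1 j2)%C with (fun j1 j2 => RtoC r * b j1 j2 + RtoC 0 * b j1 j2)%C
  by (apply fun2_ext; intros; ring).
rewrite (series_lin M' M') by auto; simpl; ring.
Qed.

Lemma D_eta : torus_D k eta = E.
Proof. apply torus_D_rser; auto. Qed.

Lemma D_xi : torus_D k xi = fun x y => X x y - 1.
Proof.
unfold xi, xi_t; rewrite torus_D_rser by auto using rapid_hmul.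
apply fun2_ext; intros; unfold X, X_t; ring.
Qed.

Lemma H_E : torus_H k E = fun x y => X x y - 1.
Proof.
destruct (rapid_qdecay _ (rapid_dmul k a Ha)) as [M1 HM1].
unfold E, E_t; rewrite (torus_H_rser k M1) by auto using herm_dmul.
apply fun2_ext; intros; unfold X, X_t.
replace (hmul k (dmul k a)) with (dmul k (hmul k a)); [ring|].
apply fun2_ext; intros; unfold dmul, hmul; ring.
Qed.

Lemma cxi_rser : cxi = rser (fun j1 j2 => RtoC c * hmul k a j1 j2)%C.
Proof.
destruct (rapid_qdecay _ (rapid_hmul k a Ha)) as [M1 HM1].
apply fun2_ext; intros; rewrite (rser_scal_qdecay c M1) by auto; reflexivity.
Qed.

Lemma herm_chmul : herm (fun j1 j2 => RtoC c * hmul k a j1 j2)%C.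
Proof. intros j1 j2; rewrite herm_hmul by auto; apply C_ext; simpl; ring. Qed.

Lemma rapid_chmul : rapid (fun j1 j2 => RtoC c * hmul k a j1 j2)%C.
Proof. apply rapid_scal, rapid_hmul, Ha. Qed.

(** The multiplier of [H] squares to [- 1] off the origin and vanishes at the origin, so [H[H[eta]]
    = - (eta - m0)] and [psi] is [c (eta - m0)]. *)
Lemma H_cxi : torus_H k cxi = fun x y => - tpsi x y.
Proof.
rewrite cxi_rser.
destruct (rapid_qdecay _ rapid_chmul) as [M1 HM1].
rewrite (torus_H_rser k M1) by auto using herm_chmul.
destruct (rapid_qdecay a Ha) as [M2 HM2]; destruct (rapid_qdecay _ rapid_delta0) as [M3 HM3].
apply fun2_ext; intros x y.
replace (hmul k _) with (fun j1 j2 => RtoC (- c) * a j1 j2 + RtoC (c * m0) * delta0 j1 j2)%C.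
- unfold rser; rewrite (series_lin M2 M3), series_delta0 by auto.
  unfold tpsi, eta, eta_t, rser; simpl; ring.
- apply fun2_ext; intros j1 j2; unfold hmul.
  destruct (Req_dec (lfreq k j1 j2) 0) as [L|L].
  + apply (lfreq_eq_0 k) in L; auto; inversion L; subst.
    rewrite Rmult_0_l, Rplus_0_l, sign_0; change (delta0 0 0) with (RtoC 1).
    assert (I0 : Im (a 0 0)%Z = 0).
    { generalize (f_equal Im (Hh 0 0)%Z); change (a (- 0)%Z (- 0)%Z) with (a 0 0)%Z.
      destruct (a 0 0)%Z; simpl; lra. }
    unfold m0; destruct (a 0 0)%Z as [u v]; simpl in I0; subst v; apply C_ext; simpl; ring.
  + rewrite delta0_neq by (intros F; inversion F; subst; unfold lfreq in L; lra).
    apply sign_sqr_neq_0 in L; unfold lfreq in L.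
    set (sg := sign _) in *; destruct (a j1 j2) as [u v].
    apply C_ext; simpl.
    * replace (- c * u) with (- c * (sg * sg) * u) by (rewrite L; ring); ring_simplify; ring.
    * replace (- c * v) with (- c * (sg * sg) * v) by (rewrite L; ring); ring_simplify; ring.
Qed.

Lemma torus_Cn_eta n : torus_Cn n eta.
Proof. apply torus_Cn_rser; auto. Qed.
Lemma torus_Cn_xi n : torus_Cn n xi.
Proof. apply torus_Cn_rser, rapid_hmul, Ha. Qed.
Lemma torus_Cn_cxi n : torus_Cn n cxi.
Proof. apply torus_Cn_scal, torus_Cn_xi. Qed.
Lemma torus_Cn_tpsi n : torus_Cn n tpsi.
Proof. apply torus_Cn_plus; [apply torus_Cn_scal, torus_Cn_eta|apply torus_Cn_const]. Qed.

Lemma D_cxi : torus_D k cxi = fun x y => c * (X x y - 1).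
Proof. unfold cxi; now rewrite torus_D_scal, D_xi. Qed.

Lemma D_tpsi : torus_D k tpsi = fun x y => c * E x y.
Proof.
unfold tpsi; change (fun x y => c * eta x y - c * m0) with (fun x y => (c * eta x y) + (- (c * m0))).
now rewrite (torus_D_plus_const k (fun x y => c * eta x y)), torus_D_scal, D_eta.
Qed.

Lemma chi_eq : (fun x y => c * E x y / J x y) = rser pc.
Proof.
apply fun2_ext; intros x y; unfold pc; rewrite (rser_scal_qdecay c M) by auto.
rewrite <- Hchi; fold E J; unfold Rdiv; ring.
Qed.

Lemma H_chi : torus_H k (rser pc) = hp.
Proof.
rewrite (torus_H_rser k (Rabs c * M)) by auto using qdecay_pc, herm_pc.
apply fun2_ext; intros x y; unfold hp; rewrite <- (rser_scal_qdecay c M) by auto using qdecay_hmul.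
f_equal; apply fun2_ext; intros; unfold hmul, pc; ring.
Qed.

Lemma hp_eq x y : hp x y = c * (1 - X x y / J x y).
Proof. unfold hp, X, J; rewrite Hrho; ring. Qed.

(** The terms with denominator [J] combine through [X^2 + E^2 = J] into the constant [c]. Since [X]
    has mean [1], the right-hand side has mean [c - al'], the derivative of [x0]. *)
Lemma x0_identity al' x y :
  X x y * (- hp x y + (c - al')) + E x y * rser pc x y = c - al' * X x y.
Proof.
rewrite hp_eq, <- chi_eq.
generalize (HJ x y); fold J; intros N.
assert (EJ : J x y = X x y ^ 2 + E x y ^ 2) by reflexivity.
apply Rmult_eq_reg_r with (J x y); auto.
replace ((X x y * (- (c * (1 - X x y / J x y)) + (c - al')) + E x y * (c * E x y / J x y)) * J x y)
  with (c * (X x y ^ 2 + E x y ^ 2) - al' * X x y * J x y) by (field; auto).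
rewrite <- EJ; ring.
Qed.

(** With [E^2 = J - X^2] the terms in [c^2] collapse to [c^2 / 2 - c^2 / (2 J)], and the traveling
    wave equation turns [- c^2 / (2 J) - g eta + tau kap] into [- K]. What remains is a constant
    plus the transport term. *)
Lemma phi_identity al' x y :
  ((c * E x y) ^ 2 - (c * (X x y - 1)) ^ 2) / (2 * J x y)
  - c * (X x y - 1) * hp x y + (c - al') * (c * (X x y - 1)) - g * eta x y + tau * kap x y
  = (c ^ 2 / 2 - K) + - al' * c * (X x y - 1).
Proof.
rewrite hp_eq, <- (Hwave x y); fold J X eta kap.
generalize (HJ x y); fold J; intros N.
assert (EJ : E x y ^ 2 = J x y - X x y ^ 2) by (unfold J, J_t, X, E; ring).
replace ((c * E x y) ^ 2) with (c ^ 2 * (J x y - X x y ^ 2)) by (rewrite <- EJ; ring).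
field; auto.
Qed.

(** * The translated wave profile on the torus *)

Section Shift.
Variables s r : R.
Let T := tshift s r.

Lemma T_xi_a d : (fun x y => 1 + torus_D k (fun x y => T xi x y + d) x y) = T X.
Proof.
rewrite torus_D_plus_const; unfold T; rewrite torus_D_shift, D_xi.
apply fun2_ext; intros; unfold tshift; ring.
Qed.

Lemma T_eta_a : torus_D k (T eta) = T E.
Proof. unfold T; now rewrite torus_D_shift, D_eta. Qed.

Lemma H_T_E : (fun x y => 1 + torus_H k (T E) x y) = T X.
Proof.
destruct (rapid_qdecay _ (rapid_dmul k a Ha)) as [M1 HM1].
unfold T, E, E_t; rewrite (torus_H_shift k M1) by auto using herm_dmul.
fold (E_t k a); fold E; rewrite H_E; apply fun2_ext; intros; unfold tshift; ring.
Qed.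

Lemma H_T_eta : torus_H k (T eta) = T xi.
Proof.
destruct (rapid_qdecay a Ha) as [M1 HM1].
unfold T, eta, eta_t; now rewrite (torus_H_shift k M1), (torus_H_rser k M1) by auto.
Qed.

Lemma T_psi : (fun x y => - torus_H k (T cxi) x y) = T tpsi.
Proof.
assert (C := H_cxi); rewrite cxi_rser in C |- *.
destruct (rapid_qdecay _ rapid_chmul) as [M1 HM1].
unfold T; rewrite (torus_H_shift k M1), C by auto using herm_chmul.
apply fun2_ext; intros; unfold tshift; ring.
Qed.

Lemma T_ph_a : torus_D k (T cxi) = T (fun x y => c * (X x y - 1)).
Proof. unfold T; now rewrite torus_D_shift, D_cxi. Qed.

Lemma T_psi_a : torus_D k (T tpsi) = T (fun x y => c * E x y).
Proof. unfold T; now rewrite torus_D_shift, D_tpsi. Qed.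

Lemma T_J : torus_J k (T X) (T eta) = T J.
Proof. apply fun2_ext; intros; unfold torus_J; rewrite T_eta_a; reflexivity. Qed.

Lemma T_kappa : torus_kappa k (T X) (T eta) = T kap.
Proof.
apply fun2_ext; intros; unfold torus_kappa; rewrite T_J, T_eta_a.
unfold T; rewrite !torus_D_shift; unfold tshift, kap, torus_kappa; rewrite D_eta.
replace (torus_J k X eta) with J; [reflexivity|].
apply fun2_ext; intros; unfold torus_J; rewrite D_eta; reflexivity.
Qed.

Lemma T_chi : (fun x y => T (fun x y => c * E x y) x y / T J x y) = T (rser pc).
Proof. rewrite <- chi_eq; reflexivity. Qed.

Lemma H_T_chi : torus_H k (T (rser pc)) = T hp.
Proof.
unfold T; rewrite (torus_H_shift k (Rabs c * M)), H_chi by auto using qdecay_pc, herm_pc; auto.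
Qed.

Lemma mean2_T_X : mean2 (T X) = 1.
Proof.
destruct (rapid_qdecay _ (rapid_dmul k _ (rapid_hmul k a Ha))) as [M1 HM1].
change (T X) with (fun x y => 1 + tshift s r (rser (dmul k (hmul k a))) x y).
rewrite mean2_plus, mean2_const, (mean2_shift M1); auto using herm_dmul, herm_hmul.
- unfold dmul; simpl; ring.
- apply cont2_const.
- apply torus_fun_cont2, torus_fun_shift, (torus_fun_rser M1); auto.
Qed.

Lemma cont2_T_X : cont2 (T X).
Proof. apply torus_fun_cont2, torus_fun_shift, (torus_Cn_fun 0), torus_Cn_X, Ha. Qed.

Lemma mean2_affine_X u v : mean2 (fun x y => u + v * T X x y) = u + v.
Proof.
assert (C := cont2_T_X).
rewrite mean2_plus, mean2_const, mean2_scal, mean2_T_X; auto using cont2_const.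
- ring.
- apply cont2_mult; auto using cont2_const.
Qed.

Lemma torus_fun_affine_X u v : torus_fun (fun x y => u + v * T X x y).
Proof.
apply torus_fun_plus, torus_fun_mult; try apply torus_fun_const.
apply torus_fun_shift, (torus_Cn_fun 0), torus_Cn_X, Ha.
Qed.

(** [X / J] is [1] minus a value of [H], and [H] removes the zero frequency; this is
    [P0[xi_alpha / J] = 1]. *)
Lemma mean2_T_rho : mean2 (fun x y => T X x y / T J x y) = 1.
Proof.
replace (fun x y => T X x y / T J x y) with (fun x y => 1 - tshift s r (rser (hmul k p)) x y).
- rewrite mean2_minus, mean2_const, (mean2_shift M) by
    (try apply cont2_const; try apply torus_fun_cont2, torus_fun_shift, (torus_fun_rser M);
     auto using qdecay_hmul, herm_hmul).
  unfold hmul; rewrite Rmult_0_l, Rplus_0_l, sign_0; simpl; ring.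
- apply fun2_ext; intros; unfold T, tshift, X, J; now rewrite Hrho.
Qed.

Lemma torus_fun_T_rho : torus_fun (fun x y => T X x y / T J x y).
Proof.
apply torus_fun_mult; [apply torus_fun_shift, (torus_Cn_fun 0), torus_Cn_X, Ha|].
apply torus_fun_inv; [apply torus_fun_shift, (torus_Cn_fun 0), torus_Cn_J, Ha|].
intros; apply HJ.
Qed.
End Shift.

(** The prescribed [c P0[xi_alpha / J] - alpha0'], evaluated with mean [1]. *)
Let C1 (t : R) := c - Derive alpha0 t.
Let x0 (t : R) := c * t - alpha0 t.

Lemma x0_derive t : is_derive x0 t (c - Derive alpha0 t).
Proof.
unfold x0; apply (is_derive_minus (V := R_NormedModule) (fun t => c * t) alpha0).
- auto_derive; auto; ring.
- apply Derive_correct, Hal.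
Qed.

(** Every quantity in the system is the translate of its profile for the initial wave; after
    substitution the equations reduce to pointwise algebra and the derivative of a moving
    profile. *)
Lemma torus_part : torus_evolution k g tau C1
  (fun a1 a2 t => (RtoC (xi (a1 - alpha0 t) (a2 - k * alpha0 t))
     + Ci * RtoC (eta (a1 - alpha0 t) (a2 - k * alpha0 t)) + RtoC (x0 t))%C)
  (fun a1 a2 t => cxi (a1 - alpha0 t) (a2 - k * alpha0 t)).
Proof.
exists x0; intros t xi' eta' ph psi xi_a eta_a ph_a psi_a J' chi kappa.
set (s := alpha0 t); set (r := k * s).
assert (Exi : xi' = fun x y => tshift s r xi x y + x0 t).
{ apply fun2_ext; intros; apply Re_cartesian_shift. }
assert (Eeta : eta' = tshift s r eta).
{ apply fun2_ext; intros; apply Im_cartesian_shift. }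
assert (Eph : ph = tshift s r cxi) by reflexivity.
assert (Epsi : psi = tshift s r tpsi).
{ unfold psi; rewrite Eph; apply T_psi. }
assert (Exa : xi_a = tshift s r X) by (unfold xi_a; rewrite Exi; apply T_xi_a).
assert (Eea : eta_a = tshift s r E) by (unfold eta_a; rewrite Eeta; apply T_eta_a).
assert (Epha : ph_a = tshift s r (fun x y => c * (X x y - 1))) by (unfold ph_a; rewrite Eph; apply T_ph_a).
assert (Epsia : psi_a = tshift s r (fun x y => c * E x y)) by (unfold psi_a; rewrite Epsi; apply T_psi_a).
assert (EJ : J' = tshift s r J) by (unfold J'; rewrite Exa, Eeta; apply T_J).
assert (Echi : chi = tshift s r (rser pc)) by (unfold chi; rewrite Epsia, EJ; apply T_chi).
assert (Ekap : kappa = tshift s r kap) by (unfold kappa; rewrite Exa, Eeta; apply T_kappa).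
assert (EH := H_T_chi s r).
rewrite Exi, Eeta, Eph, Epsi, Exa, Eea, Epha, Epsia, EJ, Echi, Ekap.
clear xi' eta' ph psi xi_a eta_a ph_a psi_a J' chi kappa Exi Eeta Eph Epsi Exa Eea Epha Epsia EJ Echi Ekap.
destruct (rapid_qdecay a Ha) as [M1 HM1].
destruct (rapid_qdecay _ (rapid_dmul k a Ha)) as [M2 HM2].
destruct (rapid_qdecay _ rapid_chmul) as [M3 HM3].
repeat match goal with |- _ /\ _ => split end.
- apply torus_Cn_plus; [apply torus_Cn_shift, torus_Cn_xi|apply torus_Cn_const].
- apply torus_Cn_shift, torus_Cn_eta.
- apply torus_Cn_shift, torus_Cn_cxi.
- apply torus_Cn_shift, torus_Cn_tpsi.
- intros; apply HJ.
- apply (torus_abs_shift M1); auto.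
- apply (torus_abs_shift M2); auto using herm_dmul.
- rewrite cxi_rser; apply (torus_abs_shift M3); auto using herm_chmul.
- apply (torus_abs_shift (Rabs c * M)); auto using qdecay_pc, herm_pc.
- intros; rewrite H_T_eta; ring.
- intros x y; exact (f_equal (fun f => f x y) (eq_sym (H_T_E s r))).
- rewrite EH; unfold torus_P0.
  replace (mean2 _) with (c - Derive alpha0 t); [apply x0_derive|].
  unfold Rminus at 1; rewrite <- (mean2_affine_X s r c (- Derive alpha0 t)); f_equal; apply fun2_ext; intros x y.
  unfold tshift, C1; rewrite x0_identity; ring.
- intros x y; rewrite EH.
  apply (is_derive_ext (fun s => eta (x - alpha0 s) (y - k * alpha0 s))).
  { intros u; symmetry; apply Im_cartesian_shift. }
  match goal with |- is_derive _ _ ?v =>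
    replace v with (- Derive alpha0 t * torus_D k eta (x - alpha0 t) (y - k * alpha0 t)) end.
  + apply is_derive_moving; [apply torus_Cn_eta|apply Derive_correct, Hal].
  (* All terms with [c] cancel, leaving [- alpha0' E]. *)
  + rewrite D_eta; unfold tshift; fold s; fold r.
    rewrite hp_eq, <- chi_eq; unfold C1; field; apply HJ.
- intros x y; rewrite EH.
  replace (torus_P _ x y) with (- Derive alpha0 t * torus_D k cxi (x - alpha0 t) (y - k * alpha0 t)).
  + apply (is_derive_moving k cxi); [apply torus_Cn_cxi|apply Derive_correct, Hal].
  + rewrite D_cxi.
    match goal with |- _ = torus_P ?G x y => set (F := G) end.
    assert (EF : F = fun x y => (c ^ 2 / 2 - K + Derive alpha0 t * c) + (- Derive alpha0 t * c) * tshift s r X x y).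
    { apply fun2_ext; intros u v; etransitivity; [apply (phi_identity (Derive alpha0 t) (u - s) (v - r))|unfold tshift; ring]. }
    (* The mean of an expression affine in [X] is its value at [X = 1], so [P] leaves
       [- alpha0' c (X - 1)]. *)
    unfold torus_P, torus_P0; rewrite EF, mean2_affine_X; unfold tshift; fold s; fold r; ring.
Qed.

(** * Restriction of the translated wave to a line *)

Section Line.
Variables theta s r : R.
Let T := tshift s r.
Let L := line k theta.

Lemma Derive_line_eta : Derive (L (T eta)) = L (T E).
Proof. unfold L, T; now rewrite Derive_line, T_eta_a by apply torus_Cn_shift, torus_Cn_eta. Qed.

Lemma conf_xi_a_line : conf_xi_a k theta (L (T eta)) = L (T X).
Proof.
unfold conf_xi_a; rewrite Derive_line_eta.
unfold L; rewrite qp_H_line by (auto; apply torus_fun_shift, (torus_Cn_fun 0), torus_Cn_E, Ha).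
unfold T; rewrite <- H_T_E; reflexivity.
Qed.

Lemma conf_J_line : conf_J k theta (L (T eta)) = L (T J).
Proof. unfold conf_J; rewrite Derive_line_eta, conf_xi_a_line; reflexivity. Qed.

Lemma conf_kappa_line : conf_kappa k theta (L (T eta)) = L (T kap).
Proof.
unfold conf_kappa; rewrite conf_J_line, conf_xi_a_line, Derive_line_eta.
unfold L; rewrite !Derive_line by (apply torus_Cn_shift; try apply torus_Cn_X; try apply torus_Cn_E; apply Ha).
unfold T; rewrite <- T_kappa; unfold torus_kappa, line; now rewrite T_J, T_eta_a.
Qed.

Lemma xi_a_over_J_line :
  (fun b => conf_xi_a k theta (L (T eta)) b / conf_J k theta (L (T eta)) b)
  = L (fun x y => T X x y / T J x y).
Proof. now rewrite conf_J_line, conf_xi_a_line. Qed.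
End Line.

(** Moving by [s] along a line is the torus translation by [(s, k s)], so [theta] is unchanged. *)
Lemma line_shift theta (s b : R) (U : R -> R -> R) :
  U (b - s) (theta + k * (b - s)) = line k theta (tshift s (k * s) U) b.
Proof. unfold line, tshift; f_equal; ring. Qed.

Lemma qp_in_line (Q : (R -> R -> R) -> Prop) theta U : Q U -> qp_in Q k theta (line k theta U).
Proof. intros H; exists U; split; auto; intros b; reflexivity. Qed.

(** Since the lift of a restriction [line k theta U] is [U] itself, each one-dimensional operator
    acts as its torus counterpart, and the computation on the torus can be read along the line. *)
Lemma conformal_part theta : conformal_evolution k g tau theta C1
  (fun b t => (RtoC (b - alpha0 t + xi (b - alpha0 t) (theta + k * (b - alpha0 t)))
     + Ci * RtoC (eta (b - alpha0 t) (theta + k * (b - alpha0 t))) + RtoC (c * t))%C)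
  (fun b t => cxi (b - alpha0 t) (theta + k * (b - alpha0 t))).
Proof.
exists x0; intros t xi' eta' ph psi xi_a eta_a ph_a psi_a J' chi kappa x0_rhs phi_rhs.
set (s := alpha0 t); set (r := k * s).
assert (Exi : xi' = fun b => b + x0 t + line k theta (tshift s r xi) b).
{ apply functional_extensionality; intros b; unfold xi'; rewrite Re_cartesian_shift, line_shift.
  fold s; fold r; unfold x0; fold s; ring. }
assert (Eeta : eta' = line k theta (tshift s r eta)).
{ apply functional_extensionality; intros b; unfold eta'; rewrite Im_cartesian_shift; apply line_shift. }
assert (Eph : ph = line k theta (tshift s r cxi)).
{ apply functional_extensionality; intros b; apply line_shift. }
assert (Fcxi : torus_fun (tshift s r cxi)) by apply torus_fun_shift, (torus_Cn_fun 0), torus_Cn_cxi.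
assert (Epsi : psi = line k theta (tshift s r tpsi)).
{ unfold psi; rewrite Eph, qp_H_line, <- T_psi by auto; reflexivity. }
assert (Exa : xi_a = line k theta (tshift s r X)) by (unfold xi_a; rewrite Eeta; apply conf_xi_a_line).
assert (Eea : eta_a = line k theta (tshift s r E)) by (unfold eta_a; rewrite Eeta; apply Derive_line_eta).
assert (Epha : ph_a = line k theta (tshift s r (fun x y => c * (X x y - 1)))).
{ unfold ph_a; rewrite Eph, Derive_line, T_ph_a; auto; apply torus_Cn_shift, torus_Cn_cxi. }
assert (Epsia : psi_a = line k theta (tshift s r (fun x y => c * E x y))).
{ unfold psi_a; rewrite Epsi, Derive_line, T_psi_a; auto; apply torus_Cn_shift, torus_Cn_tpsi. }
assert (EJ : J' = line k theta (tshift s r J)) by (unfold J'; rewrite Eeta; apply conf_J_line).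
assert (Echi : chi = line k theta (tshift s r (rser pc))).
{ unfold chi; rewrite Epsia, EJ, <- T_chi; reflexivity. }
assert (Ekap : kappa = line k theta (tshift s r kap)) by (unfold kappa; rewrite Eeta; apply conf_kappa_line).
assert (Achi : torus_abs (tshift s r (rser pc))).
{ apply (torus_abs_shift (Rabs c * M)); auto using qdecay_pc, herm_pc. }
assert (EH : qp_H k theta chi = line k theta (tshift s r hp)).
{ rewrite Echi, qp_H_line, H_T_chi; auto; apply Achi. }
(* The pointwise identities exhibit both right-hand sides as restrictions of functions affine in
   [X], which determines their lifts and means. *)
assert (Ex0 : x0_rhs = line k theta (fun x y => c + - Derive alpha0 t * tshift s r X x y)).
{ apply functional_extensionality; intros b; unfold x0_rhs; rewrite EH, Exa, Eea, Echi.
  etransitivity; [apply (x0_identity (Derive alpha0 t) (b - s) (theta + k * b - r))|unfold line, tshift; ring]. }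
assert (Ephr : phi_rhs = line k theta
   (fun x y => (c ^ 2 / 2 - K + Derive alpha0 t * c) + (- Derive alpha0 t * c) * tshift s r X x y)).
{ apply functional_extensionality; intros b; unfold phi_rhs; rewrite EH, Epsia, Epha, EJ, Eeta, Ekap.
  etransitivity; [apply (phi_identity (Derive alpha0 t) (b - s) (theta + k * b - r))|unfold line, tshift; ring]. }
rewrite EH, Ex0, Ephr, Exi, Eeta, Eph, Epsi, Exa, Eea, EJ, Echi.
clear xi' eta' ph psi xi_a eta_a ph_a psi_a J' chi kappa x0_rhs phi_rhs
  EH Ex0 Ephr Exi Eeta Eph Epsi Exa Eea Epha Epsia EJ Echi Ekap.
destruct (rapid_qdecay a Ha) as [M1 HM1].
destruct (rapid_qdecay _ (rapid_dmul k a Ha)) as [M2 HM2].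
destruct (rapid_qdecay _ rapid_chmul) as [M3 HM3].
repeat match goal with |- _ /\ _ => split end.
- replace (fun b => b + x0 t + line k theta (tshift s r xi) b - b)
    with (line k theta (fun x y => tshift s r xi x y + x0 t)).
  + apply qp_in_line, torus_Cn_plus; [apply torus_Cn_shift, torus_Cn_xi|apply torus_Cn_const].
  + apply functional_extensionality; intros b; unfold line; ring.
- apply qp_in_line, torus_Cn_shift, torus_Cn_eta.
- apply qp_in_line, torus_Cn_shift, torus_Cn_cxi.
- apply qp_in_line, torus_Cn_shift, torus_Cn_tpsi.
- intros b; apply HJ.
- apply qp_in_line, (torus_abs_shift M1); auto.
- apply qp_in_line, (torus_abs_shift M2); auto using herm_dmul.
- apply qp_in_line; rewrite cxi_rser; apply (torus_abs_shift M3); auto using herm_chmul.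
- apply qp_in_line, Achi.
- apply qp_in_line, torus_fun_affine_X.
- apply qp_in_line, torus_fun_affine_X.
- intros b; rewrite qp_H_line, H_T_eta; auto.
  apply torus_fun_shift, (torus_Cn_fun 0), torus_Cn_eta.
- intros b.
  assert (D := torus_D_line k theta (tshift s r xi) b (torus_Cn_shift 1 s r xi (torus_Cn_xi 1))).
  rewrite torus_D_shift, D_xi in D.
  replace (line k theta (tshift s r X) b) with (1 + tshift s r (fun x y => X x y - 1) b (theta + k * b))
    by (unfold line, tshift; ring).
  apply (is_derive_plus (V := R_NormedModule) (fun b => b + x0 t)); [auto_derive; auto|exact D].
- unfold qp_P0; rewrite qp_lift_line by (auto; apply torus_fun_affine_X).
  unfold torus_P0; rewrite mean2_affine_X; apply x0_derive.
- intros b.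
  assert (X1 : forall u : R, eta (b - alpha0 u) (theta + k * b - k * alpha0 u) =
    Im (RtoC (b - alpha0 u + xi (b - alpha0 u) (theta + k * (b - alpha0 u)))
     + Ci * RtoC (eta (b - alpha0 u) (theta + k * (b - alpha0 u))) + RtoC (c * u))%C).
  { intros u; rewrite Im_cartesian_shift; f_equal; ring. }
  apply (is_derive_ext _ _ _ _ X1).
  match goal with |- is_derive _ _ ?v =>
    replace v with (- Derive alpha0 t * torus_D k eta (b - alpha0 t) (theta + k * b - k * alpha0 t)) end.
  + apply is_derive_moving; [apply torus_Cn_eta|apply Derive_correct, Hal].
  + rewrite D_eta; unfold line, tshift; fold s; fold r.
    rewrite hp_eq, <- chi_eq; unfold C1; field; apply HJ.
- intros b.
  assert (X1 : forall u : R, cxi (b - alpha0 u) (theta + k * b - k * alpha0 u) =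
    cxi (b - alpha0 u) (theta + k * (b - alpha0 u))) by (intros; f_equal; ring).
  apply (is_derive_ext _ _ _ _ X1).
  unfold qp_P; rewrite qp_lift_line by (auto; apply torus_fun_affine_X).
  match goal with |- is_derive _ _ ?v =>
    replace v with (- Derive alpha0 t * torus_D k cxi (b - alpha0 t) (theta + k * b - k * alpha0 t)) end.
  + apply (is_derive_moving k cxi); [apply torus_Cn_cxi|apply Derive_correct, Hal].
  + rewrite D_cxi; unfold torus_P, torus_P0; rewrite mean2_affine_X.
    unfold tshift; fold s; fold r; ring.
Qed.

Lemma C1_part theta t :
  let u b := conf_xi_a k theta (fun b => eta (b - alpha0 t) (theta + k * (b - alpha0 t))) b
    / conf_J k theta (fun b => eta (b - alpha0 t) (theta + k * (b - alpha0 t))) b in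
  quasi_periodic k theta u /\ C1 t = c * qp_P0 k theta u - Derive alpha0 t.
Proof.
intros u.
assert (Eu : u = line k theta (fun x y => tshift (alpha0 t) (k * alpha0 t) X x y
                                         / tshift (alpha0 t) (k * alpha0 t) J x y)).
{ unfold u; rewrite <- xi_a_over_J_line.
  replace (fun b => eta (b - alpha0 t) (theta + k * (b - alpha0 t)))
    with (line k theta (tshift (alpha0 t) (k * alpha0 t) eta)); auto.
  apply functional_extensionality; intros b; symmetry; apply line_shift. }
clearbody u; subst u; split.
- apply qp_in_line, torus_fun_T_rho.
- unfold qp_P0; rewrite qp_lift_line by (auto; apply torus_fun_T_rho).
  unfold torus_P0; rewrite mean2_T_rho; unfold C1; ring.
Qed.
End Wave.

Theorem corollaryA4 :
  forall (k c g tau : R) (etahat : Z -> Z -> C) (teta0 : R -> R -> R)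
         (M eps : R),
  0 < k -> irrational k -> 0 < eps ->
  (forall j1 j2 : Z, etahat (- j1)%Z (- j2)%Z = Cconj (etahat j1 j2)) ->
  (forall j1 j2 : Z,
     Cmod (etahat j1 j2)
     <= M * exp (- 3 * eps * Rmax k 1 * IZR (Z.max (Z.abs j1) (Z.abs j2)))) ->
  (forall a1 a2 : R, RtoC (teta0 a1 a2) = fourier_series etahat a1 a2) ->
  let txi0 := torus_H k teta0 in
  let tzeta0 (a1 a2 : R) : C := (RtoC (txi0 a1 a2) + Ci * RtoC (teta0 a1 a2))%C in
  let tphi0 (a1 a2 : R) : R := c * txi0 a1 a2 in
  let eta0 (theta a : R) : R := teta0 a (theta + k * a) in
  let phi0 (theta a : R) : R := tphi0 a (theta + k * a) in
  let xi0 (theta a : R) : R := a + txi0 a (theta + k * a) in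
  let zeta0 (theta a : R) : C := (RtoC (xi0 theta a) + Ci * RtoC (eta0 theta a))%C in
  (forall theta : R, 0 <= theta < 2 * PI ->
     (forall a b : R, zeta0 theta a = zeta0 theta b -> a = b) /\
     (forall a : R, DeriveC (zeta0 theta) a <> RtoC 0)) ->
  torus_traveling_wave k c g tau teta0 ->
  forall alpha0 : R -> R,
  (forall t : R, ex_derive alpha0 t /\ continuous (Derive alpha0) t) ->
  let zeta (theta a t : R) : C :=
    (zeta0 theta (a - alpha0 t)%R + RtoC (c * t))%C in
  let phi (theta a t : R) : R := phi0 theta (a - alpha0 t) in
  let tzeta (a1 a2 t : R) : C :=
    (tzeta0 (a1 - alpha0 t)%R (a2 - k * alpha0 t)%R + RtoC (c * t - alpha0 t))%C in
  let tphi (a1 a2 t : R) : R :=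
    tphi0 (a1 - alpha0 t) (a2 - k * alpha0 t) in
  let xi_a_over_J (theta t a : R) : R :=
    let eta (b : R) : R := Im (zeta theta b t) in
    conf_xi_a k theta eta a / conf_J k theta eta a in
  exists C1 : R -> R,
    (forall theta t : R,
       quasi_periodic k theta (xi_a_over_J theta t) /\
       C1 t = c * qp_P0 k theta (xi_a_over_J theta t) - Derive alpha0 t) /\
    (forall theta : R,
       conformal_evolution k g tau theta C1 (zeta theta) (phi theta)) /\
    torus_evolution k g tau C1 tzeta tphi /\
    (forall theta a t : R,
       zeta theta a t = (RtoC a + tzeta a (theta + k * a)%R t)%C /\
       phi theta a t = tphi a (theta + k * a) t).
Proof.
intros k c g tau a teta0 M eps Hk0 Hk Heps Hh Hdec Hteta txi0 tzeta0 tphi0 eta0 phi0 xi0 zeta0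
  Hzeta Hwave alpha0 Halpha zeta phi tzeta tphi xi_a_over_J.
assert (Ha : rapid a).
{ apply (exp_decay_rapid a M (3 * eps * Rmax k 1)).
  - apply Rmult_lt_0_compat; [lra|]; generalize (Rmax_l k 1); lra.
  - intros j1 j2; eapply Rle_trans; [apply Hdec|]; right; f_equal; f_equal; ring. }
assert (Eeta : teta0 = eta_t a).
{ apply fun2_ext; intros x y; apply (f_equal Re (Hteta x y)). }
subst teta0.
destruct (rapid_qdecay a Ha) as [Ma HMa].
assert (Exi : txi0 = xi_t k a) by apply (torus_H_rser k Ma a HMa Hh).
clearbody txi0; subst txi0.
assert (Czeta : forall theta b, zeta0 theta b = (RtoC b + fourier_series (zcoef k a) b (theta + k * b))%C).
{ intros theta b; rewrite series_zcoef by auto; unfold zeta0, xi0, eta0; rewrite RtoC_plus; ring. }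
(* Up to a period in the second variable, each point lies on a line with [theta] in [[0, 2 PI)],
   where the assumptions on [zeta0] apply. *)
assert (Red : forall x y, exists (n : Z) theta, 0 <= theta < 2 * PI /\ theta + k * x = y + IZR n * (2 * PI)).
{ intros x y; destruct (period_reduce (y - k * x)) as [n Hn].
  exists n, (y - k * x + IZR n * (2 * PI)); split; auto; ring. }
assert (Tper : forall U n x y, torus_fun U -> U x (y + IZR n * (2 * PI)) = U x y).
{ intros U n x y HU; rewrite <- (torus_fun_period U 0 n x y HU); f_equal; ring. }
(* A vanishing secant would give [zeta0] the same value at [x] and [x + h] on such a line. *)
assert (Hinj : forall h x y, 0 < h -> (RtoC h + fourier_series (zcoef k a) (x + h) (y + k * h)
    - fourier_series (zcoef k a) x y <> RtoC 0)%C).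
{ intros h x y Hh0 F; destruct (Red x y) as [n [theta [Ht E]]].
  destruct (Hzeta theta Ht) as [Inj _].
  assert (Q : x + h = x); [|lra].
  apply Inj; rewrite !Czeta.
  replace (theta + k * (x + h)) with (y + k * h + IZR n * (2 * PI)) by (rewrite Rmult_plus_distr_l, <- Rplus_assoc, E; ring).
  rewrite E.
  assert (P : forall x y, fourier_series (zcoef k a) x (y + IZR n * (2 * PI)) = fourier_series (zcoef k a) x y).
  { intros u v; rewrite <- (series_periodic (zcoef k a) 0 n u v); f_equal; ring. }
  rewrite !P, RtoC_plus.
  replace (RtoC x + RtoC h + fourier_series (zcoef k a) (x + h) (y + k * h))%C
    with ((RtoC h + fourier_series (zcoef k a) (x + h) (y + k * h) - fourier_series (zcoef k a) x y)
      + (RtoC x + fourier_series (zcoef k a) x y))%C by ring.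
  rewrite F; ring. }
(* [J] is the squared modulus of [zeta_alpha], so a zero of [J] annihilates both the real and the
   imaginary part of the derivative. *)
assert (HJ : forall x y, J_t k a x y <> 0).
{ intros x y F; destruct (Red x y) as [n [theta [Ht E]]].
  destruct (Hzeta theta Ht) as [_ Der]; apply (Der x).
  assert (X0 : X_t k a x y = 0 /\ E_t k a x y = 0).
  { unfold J_t in F; generalize (pow2_ge_0 (X_t k a x y)) (pow2_ge_0 (E_t k a x y)); intros.
    split; apply Rsqr_0_uniq; rewrite Rsqr_pow2; lra. }
  destruct X0 as [X0 E0].
  assert (Dxi := torus_D_line k theta (xi_t k a) x (torus_Cn_xi k a Ha 1)).
  assert (Deta := torus_D_line k theta (eta_t a) x (torus_Cn_eta a Ha 1)).
  rewrite (D_xi k a Ha), E, (Tper (X_t k a)), X0 in Dxi by apply (torus_Cn_fun 0), torus_Cn_X, Ha.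
  rewrite (D_eta k a Ha), E, (Tper (E_t k a)), E0 in Deta by apply (torus_Cn_fun 0), torus_Cn_E, Ha.
  unfold DeriveC; apply C_ext.
  - apply is_derive_unique.
    apply (is_derive_ext (fun b => b + xi_t k a b (theta + k * b))).
    { intros b; unfold zeta0, xi0; simpl; ring. }
    replace (Re (RtoC 0)) with (1 + (0 - 1)) by (simpl; ring).
    apply (is_derive_plus (V := R_NormedModule) (fun b => b)); auto.
    apply (is_derive_id (K := R_AbsRing)).
  - apply is_derive_unique.
    apply (is_derive_ext (fun b => eta_t a b (theta + k * b))); [|exact Deta].
    intros b; unfold zeta0, eta0; simpl; ring. }
destruct (conjugate_inverse k a Ha Hh Hk Hinj HJ) as [Mp [p [Hp [Hph [Hchi Hrho]]]]].
set (F := fun x y => c ^ 2 / (2 * J_t k a x y) + g * eta_t a x y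
     - tau * torus_kappa k (X_t k a) (eta_t a) x y).
(* The torus equation says exactly that [F] equals its mean, which then serves as the constant
   [K]. *)
assert (HF : forall x y, F x y = mean2 F).
{ intros x y; apply Rminus_diag_uniq.
  unfold torus_traveling_wave in Hwave; cbv zeta in Hwave.
  assert (EX : (fun x y => 1 + torus_H k (torus_D k (eta_t a)) x y) = X_t k a).
  { rewrite (D_eta k a Ha), (H_E k a Ha Hh); apply fun2_ext; intros; ring. }
  rewrite EX in Hwave.
  assert (EJ : torus_J k (X_t k a) (eta_t a) = J_t k a).
  { apply fun2_ext; intros; unfold torus_J; rewrite (D_eta k a Ha); reflexivity. }
  rewrite EJ in Hwave; exact (Hwave x y). }
assert (Hal : forall t, ex_derive alpha0 t) by (intros t; apply (Halpha t)).
exists (fun t => c - Derive alpha0 t).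
split; [|split; [|split]].
- intros theta t.
  assert (E : (fun b => Im (zeta theta b t)) =
     fun b => eta_t a (b - alpha0 t) (theta + k * (b - alpha0 t))).
  { apply functional_extensionality; intros b; apply Im_cartesian_shift. }
  unfold xi_a_over_J; rewrite E.
  apply (C1_part k c Mp a p alpha0); auto.
- intros theta; apply (conformal_part k c g tau Mp (mean2 F) a p alpha0); auto.
- apply (torus_part k c g tau Mp (mean2 F) a p alpha0); auto.
- intros theta b t; split.
  + unfold zeta, tzeta, tzeta0, zeta0, xi0, eta0.
    replace (theta + k * (b - alpha0 t)) with (theta + k * b - k * alpha0 t) by ring.
    apply C_ext; simpl; ring.
  + unfold phi, tphi, phi0; f_equal; ring.
Qed.
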